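(* Let $(M,g,\circ,e,\mathcal{E})$ be a semi-simple Frobenius manifold with $\mathcal{L}_{\mathcal{E}}(g)=(2-d)g$, $d\in\mathbb{R}$. Let $(u^1,\dots,u^m)$ be canonical local coordinates normalized so that $\mathcal{E}=\sum_\alpha u^\alpha e_\alpha$, where $e_\alpha=\partial_{u^\alpha}$; let $\eta$ be the associated metric potential, $\eta_\alpha:=e_\alpha\eta=g(e_\alpha,e_\alpha)$ and $\eta_{\alpha\beta}:=e_\alpha e_\beta\eta$. Let $\kappa$ be the $\mathbb{C}$-anti-linear involution of $\mathcal{T}_M^{(1,0)}$ defined by $\kappa e_\alpha=\frac{|\eta_\alpha|}{\eta_\alpha}e_\alpha$. Then the CDV$\oplus$-structure $(M,g,\circ,e,\mathcal{E},\kappa)$ is a harmonic Frobenius manifold, with harmonic potential $P$ given by $Pe_\alpha=\sum_\beta P_\alpha^\beta e_\beta$, where $$P_\beta^\beta=-u^\beta,\qquad P_\beta^\alpha=\frac{\overline{\eta_{\alpha\beta}}}{2|\eta_\alpha\eta_\beta|}\cdot\eta_\beta\quad\text{for all }\alpha\neq\beta.$$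
   Context: Frobenius manifold. $M$ is a complex analytic manifold of dimension $m$, $\Theta_M$ is its sheaf of holomorphic vector fields; $g$ is a holomorphic symmetric non-degenerate bilinear form on $\Theta_M$ with Levi-Civita connection $\nabla$; $\circ$ is a holomorphic commutative associative product on $\Theta_M$ with unit field $e$; $\mathcal{E}$ is a holomorphic vector field (Euler field). These satisfy: $\nabla$ is flat; $g(X\circ Y,Z)=g(X,Y\circ Z)$; $\nabla e=0$; with $c(X,Y,Z):=g(X\circ Y,Z)$ the tensor $(\nabla_Zc)(U,V,W)$ is symmetric in its four arguments; $\nabla(\nabla\mathcal{E})=0$, $\mathcal{L}_{\mathcal{E}}(\circ)=\circ$, and $\mathcal{L}_{\mathcal{E}}(g)=(2-d)g$ for some constant $d$. It is semi-simple if near every point there are holomorphic coordinates $(u^1,\dots,u^m)$, called canonical, with $\partial_{u^\alpha}\circ\partial_{u^\beta}=\delta_{\alpha\beta}\partial_{u^\alpha}$. In canonical coordinates $g(\partial_{u^\alpha},\partial_{u^\beta})=0$ for $\alpha\ne\beta$, and there is locally a holomorphic function $\eta$ (the metric potential) with $g(\partial_{u^\alpha},\partial_{u^\alpha})=\partial\eta/\partial u^\alpha$. $\mathcal{T}_M^{(1,0)}$ is the $C^\infty$ complex vector bundle underlying the holomorphic tangent bundle, with its operator $\overline\partial$; $g$, $\circ$ are extended $C^\infty$-linearly and $\nabla$ is extended to a $(1,0)$-connection. The Chern connection $D_h=D'+\overline\partial$ of a Hermitian pseudo-metric $h$ is the unique connection with $(0,1)$-part $\overline\partial$ and $D_h(h)=0$.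 CDV-structure. Given a Frobenius manifold and a smooth fiberwise $\mathbb{C}$-anti-linear involution $\kappa$ of $\mathcal{T}_M^{(1,0)}$, put $h:=g(\cdot,\kappa\,\cdot)$, $D:=D_h$ with $(1,0)$-part $D'$ and $(0,1)$-part $D''=\overline\partial$, $C_XY=\Phi_XY:=-X\circ Y$, $\tilde C:=\kappa C\kappa$ (i.e. $\tilde C_{\overline X}=\kappa C_X\kappa$), $\mathcal{U}:=\mathcal{E}\circ$, $\mathcal{Q}:=D_{\mathcal{E}}-\mathcal{L}_{\mathcal{E}}-\frac{2-d}{2}\mathrm{Id}$. One says $(M,g,\circ,e,\mathcal{E},\kappa)$ is a CDV-structure if $d\in\mathbb{R}$, $D_ee=0$, and $(\mathcal{T}_M^{(1,0)}\to M,D,C,\tilde C,\kappa,h,\mathcal{U},\mathcal{Q})$ is a CV-structure, i.e.: (1) $(C+D'')^2=0$, $(\tilde C+D')^2=0$, $D'(C)=0$, $D''(\tilde C)=0$, $D'D''+D''D'=-(C\tilde C+\tilde CC)$; (2) $\kappa^2=\mathrm{Id}$, $D(\kappa)=0$ (i.e. $D'_X\kappa=\kappa D''_{\overline X}$ and $D''_{\overline X}\kappa=\kappa D'_X$), $\kappa C\kappa=\tilde C$; (3) $h$ is a Hermitian pseudo-metric (linear on the left, semi-linear on the right, non-degenerate, $h(b,a)=\overline{h(a,b)}$), real-valued on $\ker(\kappa-\mathrm{Id})$, with $h(C_Xa,b)=h(a,\tilde C_{\overline X}b)$ and $D(h)=0$; (4) $[C,\mathcal{U}]=0$, $D'(\mathcal{U})-[C,\mathcal{Q}]+C=0$,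 $D''(\mathcal{U})=0$, $D'(\mathcal{Q})+[C,\kappa\mathcal{U}\kappa]=0$, $\kappa\mathcal{Q}\kappa+\mathcal{Q}=0$, $h(\mathcal{U}a,b)=h(a,\kappa\mathcal{U}\kappa b)$, $h(\mathcal{Q}a,b)=h(a,\mathcal{Q}b)$. It is a CDV$\oplus$-structure if in addition $h$ is positive definite. (The $\kappa$ in the claim does define a CDV$\oplus$-structure.) Harmonic Frobenius manifold. Let $P$ be a smooth endomorphism of $\mathcal{T}_M^{(1,0)}$, $P^*$ its $g$-adjoint and $P^\dag$ its $h$-adjoint, and set $\mathcal{V}:=\nabla\mathcal{E}-\frac{2-d}{2}\mathrm{Id}$ (as an endomorphism $X\mapsto\nabla_X\mathcal{E}-\frac{2-d}{2}X$). The CDV$\oplus$-structure is a harmonic Frobenius manifold with harmonic potential $P$ if $$D'P=\Phi,\qquad D'=\nabla-[P^\dag,\Phi],\qquad P^*=P,\qquad \mathcal{Q}=\mathcal{V}+[P^\dag,\mathcal{U}],$$ where $D'P$ is the induced $(1,0)$-derivative of $P$ as an endomorphism, and the second relation means $D'_XY=\nabla_XY-[P^\dag,\Phi_X]Y$. *)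

(* Defs.v *)
From HB Require Import structures.
From mathcomp Require Import all_boot all_order all_algebra.
From mathcomp Require Import all_classical all_reals.
From mathcomp Require Import topology normedtype derive.
From mathcomp Require Import complex.

Set Implicit Arguments.
Unset Strict Implicit.
Unset Printing Implicit Defensive.

Import Order.TTheory GRing.Theory Num.Theory.
Import numFieldNormedType.Exports.

Local Open Scope classical_set_scope.
Local Open Scope ring_scope.

(* C^m as a real normed space: x + i y is the pair (x, y).  The library has no
   real normed structure on R[i], so that differentiability is that of
   MathComp-Analysis, over R, of real and imaginary parts. *)
Notation Cspace R m := ('rV[R]_m * 'rV[R]_m)%type.

Section Calculus.
Context {R : realType} {m : nat}.
Local Notation C := R[i].
Local Notation V := (Cspace R m).

(* For open O: f is of class C^k on O. *)
Fixpoint Ck (k : nat) (O : set V) (f : V -> R) : Prop :=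
  match k with
  | 0 => forall x, O x -> {for x, continuous f}
  | k'.+1 => (forall x, O x -> differentiable f x) /\
             (forall v : V, Ck k' O (fun x => 'D_v f x))
  end.

Definition smoothV (O : set V) (F : V -> C) : Prop :=
  forall k, Ck k O (fun x => complex.Re (F x)) /\
            Ck k O (fun x => complex.Im (F x)).

Definition pder (v : V) (F : V -> C) (x : V) : C :=
  Complex ('D_v (fun y => complex.Re (F y)) x)
          ('D_v (fun y => complex.Im (F y)) x).

(* The Wirtinger derivatives d/dz^j and d/d(conj z^j). *)
Definition dz (j : 'I_m) (F : V -> C) (x : V) : C :=
  (pder (delta_mx 0 j, 0) F x - 'i * pder (0, delta_mx 0 j) F x) / 2.

Definition dzbar (j : 'I_m) (F : V -> C) (x : V) : C :=
  (pder (delta_mx 0 j, 0) F x + 'i * pder (0, delta_mx 0 j) F x) / 2.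

Definition holV (O : set V) (F : V -> C) : Prop :=
  smoothV O F /\ forall x j, O x -> dzbar j F x = 0.

End Calculus.

(* [icoord] is the inverse of [coord] on [coord @` dom]; the values of [coord]
   outside [dom], and of [icoord] outside [coord @` dom], are irrelevant. *)
Record chart (R : realType) (m : nat) (M : topologicalType) := Chart {
  dom : set M;
  coord : M -> Cspace R m;
  icoord : Cspace R m -> M }.

Section Charts.
Context {R : realType} {m : nat} {M : topologicalType}.
Implicit Types c : chart R m M.

Definition is_chart c : Prop :=
  [/\ open (dom c), open (coord c @` dom c),
      (forall p, dom c p -> icoord c (coord c p) = p),
      (forall p, dom c p -> {for p, continuous (coord c)}) &
      (forall x, (coord c @` dom c) x -> {for x, continuous (icoord c)})].

(* The complex coordinate functions of a chart. *)
Definition zc c (j : 'I_m) (p : M) : R[i] :=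
  Complex ((coord c p).1 0 j) ((coord c p).2 0 j).

Definition hol_transition c c' : Prop :=
  forall j, holV (coord c @` (dom c `&` dom c')) (fun x => zc c' j (icoord c x)).

End Charts.

(* A holomorphic atlas, presented by the choice of one of its charts around
   each point.  No countability axiom is imposed. *)
Record complex_manifold (R : realType) (m : nat) := ComplexManifold {
  carrier :> topologicalType;
  chart_at : carrier -> chart R m carrier;
  carrier_hausdorff : hausdorff_space carrier;
  chart_at_is_chart : forall p, is_chart (chart_at p);
  chart_at_dom : forall p, dom (chart_at p) p;
  chart_at_transition :
    forall p q, hol_transition (chart_at p) (chart_at q) }.

(* The holomorphic tangent space T_p^(1,0)M is identified with C^m by the basis
   d/dz^j of the preferred chart [chart_at p] around p.  A section of T^(1,0)M
   is thus a function M -> C^m, but its values at different points are not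
   components in one and the same chart: its components in a chart c are the
   functions X(z^j), for z^j the coordinate functions of c. *)

Section VectorFields.
Context {R : realType} {m : nat} (M : complex_manifold R m).
Local Notation C := R[i].
Local Notation T := 'rV[R[i]]_m.
Local Notation field := (M -> 'rV[R[i]]_m).
Implicit Types (W : set M) (f : M -> C) (X Y Z : field) (p : M) (v : T).

Definition smooth_on W f : Prop :=
  forall q, smoothV (coord (chart_at q) @` (dom (chart_at q) `&` W))
                    (fun x => f (icoord (chart_at q) x)).

Definition hol_on W f : Prop :=
  forall q, holV (coord (chart_at q) @` (dom (chart_at q) `&` W))
                 (fun x => f (icoord (chart_at q) x)).

(* The derivatives of f along v and along the conjugate (0,1)-vector of v. *)
Definition del p v f : C :=
  \sum_j v 0 j *
    dz j (fun x => f (icoord (chart_at p) x)) (coord (chart_at p) p).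

Definition delbar p v f : C :=
  \sum_j (v 0 j)^* *
    dzbar j (fun x => f (icoord (chart_at p) x)) (coord (chart_at p) p).

Definition component (c : chart R m M) (j : 'I_m) X : M -> C :=
  fun q => del q (X q) (zc c j).

Definition smooth_field W X : Prop :=
  forall q j, smooth_on (W `&` dom (chart_at q)) (component (chart_at q) j X).

Definition hol_field W X : Prop :=
  forall q j, hol_on (W `&` dom (chart_at q)) (component (chart_at q) j X).

(* The (1,0)-part of the Lie bracket taken with d/dz-derivatives only.  For X
   holomorphic, the Lie bracket [X, Y] itself, i.e. the Lie derivative of Y. *)
Definition bracket X Y : field := fun p =>
  \row_j (del p (X p) (component (chart_at p) j Y) -
          del p (Y p) (component (chart_at p) j X)).

(* The operator dbar of T^(1,0)M, [dbar p v Y] being its value at p on Y along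
   the conjugate of v. *)
Definition dbar p v Y : T := \row_j delbar p v (component (chart_at p) j Y).

Definition fapp (A : M -> T -> T) X : field := fun p => A p (X p).

(* N p v Y is the covariant derivative at p of the section Y along v. *)
Definition derivation := M -> T -> field -> T.

Definition cov (N : derivation) X Y : field := fun p => N p (X p) Y.

(* (1,0)-connections.  Locality follows from the Leibniz rule, in which the
   function and the sections are only required to be smooth on W. *)
Definition conn10 (N : derivation) : Prop :=
  [/\ (forall W X Y, open W -> smooth_field W X -> smooth_field W Y ->
         smooth_field W (cov N X Y)),
      (forall W Y p, open W -> W p -> smooth_field W Y ->
         linear (fun v => N p v Y)) &
      (forall W f Y Z p v, open W -> W p -> smooth_on W f ->
         smooth_field W Y -> smooth_field W Z ->
         N p v (fun q => f q *: Y q + Z q) =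
           f p *: N p v Y + del p v f *: Y p + N p v Z)].

Definition antilinear (A : T -> T) : Prop :=
  forall (a : C) x y, A (a *: x + y) = a^* *: A x + A y.

Definition nondegenerate (b : T -> T -> C) : Prop :=
  forall x, (forall y, b x y = 0) -> x = 0.

(* Levi-Civita connection of a holomorphic metric, extended to a
   (1,0)-connection on smooth sections. *)
Record levi_civita (g : M -> T -> T -> C) (N : derivation) : Prop := {
  lc_conn : conn10 N;
  lc_hol : forall W X Y, open W -> hol_field W X -> hol_field W Y ->
    hol_field W (cov N X Y);
  lc_torsion : forall W X Y p, open W -> W p ->
    hol_field W X -> hol_field W Y ->
    cov N X Y p - cov N Y X p = bracket X Y p;
  lc_metric : forall W X Y Z p, open W -> W p ->
    hol_field W X -> hol_field W Y -> hol_field W Z ->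
    del p (X p) (fun q => g q (Y q) (Z q)) =
      g p (cov N X Y p) (Z p) + g p (Y p) (cov N X Z p) }.

(* N is the (1,0)-part D' of the Chern connection D' + dbar of h. *)
Record chern (h : M -> T -> T -> C) (N : derivation) : Prop := {
  chern_conn : conn10 N;
  chern_metric10 : forall W Y Z p v, open W -> W p ->
    smooth_field W Y -> smooth_field W Z ->
    del p v (fun q => h q (Y q) (Z q)) =
      h p (N p v Y) (Z p) + h p (Y p) (dbar p v Z);
  chern_metric01 : forall W Y Z p v, open W -> W p ->
    smooth_field W Y -> smooth_field W Z ->
    delbar p v (fun q => h q (Y q) (Z q)) =
      h p (dbar p v Y) (Z p) + h p (Y p) (N p v Z) }.

Record frobenius_data := FrobeniusData {
  fg : M -> T -> T -> C;
  fprod : M -> T -> T -> T;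
  funit : field;
  feuler : field;
  fnabla : derivation;
  fd : C }.

(* (nabla_Z c)(X1, X2, X3), for c(X, Y, Z) = g(X o Y, Z). *)
Definition nabla_c (F : frobenius_data) Z X1 X2 X3 : M -> C := fun p =>
  let c q x y z := fg F q (fprod F q x y) z in
  let N := fnabla F in
  del p (Z p) (fun q => c q (X1 q) (X2 q) (X3 q))
  - c p (cov N Z X1 p) (X2 p) (X3 p)
  - c p (X1 p) (cov N Z X2 p) (X3 p)
  - c p (X1 p) (X2 p) (cov N Z X3 p).

Record is_frobenius (F : frobenius_data) : Prop := {
  fg_hol : forall W X Y, open W -> hol_field W X -> hol_field W Y ->
    hol_on W (fun p => fg F p (X p) (Y p));
  fg_linear : forall p (a : C) x y z,
    fg F p (a *: x + y) z = a * fg F p x z + fg F p y z;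
  fg_sym : forall p x y, fg F p x y = fg F p y x;
  fg_nondeg : forall p, nondegenerate (fg F p);
  fprod_hol : forall W X Y, open W -> hol_field W X -> hol_field W Y ->
    hol_field W (fun p => fprod F p (X p) (Y p));
  fprod_linear : forall p z, linear (fun x => fprod F p x z);
  fprodC : forall p x y, fprod F p x y = fprod F p y x;
  fprodA : forall p x y z,
    fprod F p x (fprod F p y z) = fprod F p (fprod F p x y) z;
  funit_hol : hol_field setT (funit F);
  funitP : forall p x, fprod F p (funit F p) x = x;
  feuler_hol : hol_field setT (feuler F);
  fnablaP : levi_civita (fg F) (fnabla F);
  fnabla_flat : forall W X Y Z p, open W -> W p ->
    hol_field W X -> hol_field W Y -> hol_field W Z ->
    let N := fnabla F in
    cov N X (cov N Y Z) p - cov N Y (cov N X Z) p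
      - cov N (bracket X Y) Z p = 0;
  fg_invariant : forall p x y z,
    fg F p (fprod F p x y) z = fg F p x (fprod F p y z);
  funit_flat : forall p v, fnabla F p v (funit F) = 0;
  fnabla_c_sym : forall W X Y Z U p, open W -> W p ->
    hol_field W X -> hol_field W Y -> hol_field W Z -> hol_field W U ->
    [/\ nabla_c F X Y Z U p = nabla_c F Y X Z U p,
        nabla_c F X Y Z U p = nabla_c F X Z Y U p &
        nabla_c F X Y Z U p = nabla_c F X Y U Z p];
  feuler_affine : forall W X Y p, open W -> W p ->
    hol_field W X -> hol_field W Y ->
    let N := fnabla F in
    cov N X (cov N Y (feuler F)) p - cov N (cov N X Y) (feuler F) p = 0;
  feuler_prod : forall W X Y p, open W -> W p ->
    hol_field W X -> hol_field W Y ->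
    bracket (feuler F) (fun q => fprod F q (X q) (Y q)) p
      - fprod F p (bracket (feuler F) X p) (Y p)
      - fprod F p (X p) (bracket (feuler F) Y p) = fprod F p (X p) (Y p);
  feuler_metric : forall W X Y p, open W -> W p ->
    hol_field W X -> hol_field W Y ->
    del p (feuler F p) (fun q => fg F q (X q) (Y q))
      - fg F p (bracket (feuler F) X p) (Y p)
      - fg F p (X p) (bracket (feuler F) Y p)
      = (2 - fd F) * fg F p (X p) (Y p) }.

(* Charts of the maximal holomorphic atlas. *)
Definition hol_chart (u : chart R m M) : Prop :=
  is_chart u /\ forall p, hol_transition u (chart_at p) /\
                          hol_transition (chart_at p) u.

(* The vector field d/du^a on [dom u], written at p in the basis of
   [chart_at p]. *)
Definition frame (u : chart R m M) (a : 'I_m) : field := fun p =>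
  \row_j dz a (fun x => zc (chart_at p) j (icoord u x)) (coord u p).

Definition canonical_chart (F : frobenius_data) (u : chart R m M) : Prop :=
  hol_chart u /\
  forall p a b, dom u p ->
    fprod F p (frame u a p) (frame u b p) = (a == b)%:R *: frame u a p.

Definition semisimple (F : frobenius_data) : Prop :=
  forall p, exists u, canonical_chart F u /\ dom u p.

Definition normalized_chart (F : frobenius_data) (u : chart R m M) : Prop :=
  forall p, dom u p -> feuler F p = \sum_a zc u a p *: frame u a p.

(* The partial derivatives eta_a and eta_ab of eta in the coordinates u. *)
Definition part1 (u : chart R m M) (eta : M -> C) a : M -> C :=
  fun p => del p (frame u a p) eta.
Definition part2 (u : chart R m M) (eta : M -> C) a b : M -> C :=
  part1 u (part1 u eta b) a.

Definition metric_potential (F : frobenius_data) (u : chart R m M)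
    (eta : M -> C) : Prop :=
  hol_on (dom u) eta /\
  forall p a, dom u p -> fg F p (frame u a p) (frame u a p) = part1 u eta a p.

(* CV-structures on T^(1,0)M.  [D'] is the (1,0)-part of the connection D, whose
   (0,1)-part is D'' = dbar; [C1 p x] and [Ct p x] are the endomorphisms C_x and
   C~_(conj x) of the fiber at p; Q acts on sections.  Identities between
   End-valued forms are evaluated on X, Y holomorphic (which yield all tangent
   vectors) and on their conjugates, which commute with holomorphic fields. *)
Record is_CV (D' : derivation) (C1 Ct : M -> T -> T -> T) (kappa : M -> T -> T)
    (h : M -> T -> T -> C) (U : M -> T -> T) (Q : field -> field) : Prop := {
  cv_C_smooth : forall W X s, open W -> smooth_field W X -> smooth_field W s ->
    smooth_field W (fun p => C1 p (X p) (s p));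
  cv_C_linear : forall p x, linear (C1 p x);
  cv_C_form : forall p s, linear (fun x => C1 p x s);
  cv_kappa_smooth : forall W s, open W -> smooth_field W s ->
    smooth_field W (fapp kappa s);
  cv_kappa_antilinear : forall p, antilinear (kappa p);
  cv_h_smooth : forall W s t, open W -> smooth_field W s -> smooth_field W t ->
    smooth_on W (fun p => h p (s p) (t p));
  cv_U_smooth : forall W s, open W -> smooth_field W s ->
    smooth_field W (fapp U s);
  cv_U_linear : forall p, linear (U p);
  cv_Q_smooth : forall W s, open W -> smooth_field W s -> smooth_field W (Q s);
  cv_Q_linear : forall W f s t p, open W -> W p -> smooth_on W f ->
    smooth_field W s -> smooth_field W t ->
    Q (fun q => f q *: s q + t q) p = f p *: Q s p + Q t p;

  (* (C + D'')^2 = 0: parts of type (2,0), (1,1) and (0,2) *)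
  cv_CC : forall p x y s, C1 p x (C1 p y s) = C1 p y (C1 p x s);
  cv_D''C : forall W X s p v, open W -> W p ->
    hol_field W X -> smooth_field W s ->
    dbar p v (fun q => C1 q (X q) (s q)) = C1 p (X p) (dbar p v s);
  cv_D''D'' : forall W X Y s p, open W -> W p ->
    hol_field W X -> hol_field W Y -> smooth_field W s ->
    cov dbar X (cov dbar Y s) p - cov dbar Y (cov dbar X s) p
      - cov dbar (bracket X Y) s p = 0;
  (* (C~ + D')^2 = 0: parts of type (0,2), (1,1) and (2,0) *)
  cv_CtCt : forall p x y s, Ct p x (Ct p y s) = Ct p y (Ct p x s);
  cv_D'Ct : forall W X s p v, open W -> W p ->
    hol_field W X -> smooth_field W s ->
    D' p v (fun q => Ct q (X q) (s q)) = Ct p (X p) (D' p v s);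
  cv_D'D' : forall W X Y s p, open W -> W p ->
    hol_field W X -> hol_field W Y -> smooth_field W s ->
    cov D' X (cov D' Y s) p - cov D' Y (cov D' X s) p
      - cov D' (bracket X Y) s p = 0;
  cv_D'C : forall W X Y s p, open W -> W p ->
    hol_field W X -> hol_field W Y -> smooth_field W s ->
    (cov D' X (fun q => C1 q (Y q) (s q)) p - C1 p (Y p) (cov D' X s p))
    - (cov D' Y (fun q => C1 q (X q) (s q)) p - C1 p (X p) (cov D' Y s p))
    - C1 p (bracket X Y p) (s p) = 0;
  cv_D''Ct : forall W X Y s p, open W -> W p ->
    hol_field W X -> hol_field W Y -> smooth_field W s ->
    (cov dbar X (fun q => Ct q (Y q) (s q)) p - Ct p (Y p) (cov dbar X s p))
    - (cov dbar Y (fun q => Ct q (X q) (s q)) p - Ct p (X p) (cov dbar Y s p))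
    - Ct p (bracket X Y p) (s p) = 0;
  (* D'D'' + D''D' = -(C C~ + C~ C), at the pair (X, conj Y) *)
  cv_curv : forall W X Y s p, open W -> W p ->
    hol_field W X -> hol_field W Y -> smooth_field W s ->
    cov D' X (cov dbar Y s) p - cov dbar Y (cov D' X s) p =
      - (C1 p (X p) (Ct p (Y p) (s p)) - Ct p (Y p) (C1 p (X p) (s p)));

  cv_kappaK : forall p x, kappa p (kappa p x) = x;
  cv_D'kappa : forall W s p v, open W -> W p -> smooth_field W s ->
    D' p v (fapp kappa s) = kappa p (dbar p v s);
  cv_D''kappa : forall W s p v, open W -> W p -> smooth_field W s ->
    dbar p v (fapp kappa s) = kappa p (D' p v s);
  cv_Ct : forall p x s, kappa p (C1 p x (kappa p s)) = Ct p x s;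

  cv_h_linear : forall p (a : C) x y z,
    h p (a *: x + y) z = a * h p x z + h p y z;
  cv_h_semilinear : forall p (a : C) x y z,
    h p z (a *: x + y) = a^* * h p z x + h p z y;
  cv_h_nondeg : forall p, nondegenerate (h p);
  cv_h_herm : forall p x y, h p y x = (h p x y)^*;
  cv_h_real : forall p x y, kappa p x = x -> kappa p y = y ->
    h p x y \is Num.real;
  cv_h_C : forall p x a b, h p (C1 p x a) b = h p a (Ct p x b);
  cv_h_D : chern h D';

  cv_CU : forall p x s, C1 p x (U p s) = U p (C1 p x s);
  cv_D'U : forall W X s p, open W -> W p ->
    hol_field W X -> smooth_field W s ->
    (cov D' X (fapp U s) p - U p (cov D' X s p))
    - (C1 p (X p) (Q s p) - Q (fun q => C1 q (X q) (s q)) p)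
    + C1 p (X p) (s p) = 0;
  cv_D''U : forall W s p v, open W -> W p -> smooth_field W s ->
    dbar p v (fapp U s) - U p (dbar p v s) = 0;
  cv_D'Q : forall W X s p, open W -> W p ->
    hol_field W X -> smooth_field W s ->
    (cov D' X (Q s) p - Q (cov D' X s) p)
    + (C1 p (X p) (kappa p (U p (kappa p (s p))))
       - kappa p (U p (kappa p (C1 p (X p) (s p))))) = 0;
  cv_kappaQ : forall W s p, open W -> W p -> smooth_field W s ->
    kappa p (Q (fapp kappa s) p) + Q s p = 0;
  cv_h_U : forall p a b,
    h p (U p a) b = h p a (kappa p (U p (kappa p b)));
  cv_h_Q : forall W s t p, open W -> W p ->
    smooth_field W s -> smooth_field W t ->
    h p (Q s p) (t p) = h p (s p) (Q t p) }.

Section CDV.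
Context (F : frobenius_data) (kappa : M -> T -> T).

Definition Phi p (x y : T) : T := - fprod F p x y.
Definition Phit p (x y : T) : T := kappa p (Phi p x (kappa p y)).
Definition hform p (x y : T) : C := fg F p x (kappa p y).
Definition Uop p (x : T) : T := fprod F p (feuler F p) x.
Definition Qop (D' : derivation) (s : field) : field := fun p =>
  cov D' (feuler F) s p - bracket (feuler F) s p - ((2 - fd F) / 2) *: s p.

Record is_CDV (D' : derivation) : Prop := {
  cdv_d_real : fd F \is Num.real;
  cdv_chern : chern hform D';
  cdv_unit : forall p, cov D' (funit F) (funit F) p = 0;
  cdv_CV : is_CV D' Phi Phit kappa hform Uop (Qop D') }.

Definition is_CDVplus (D' : derivation) : Prop :=
  is_CDV D' /\ forall p x, x != 0 -> 0 < hform p x x.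

Definition adjoint (b : M -> T -> T -> C) (A B : M -> T -> T) : Prop :=
  forall p x y, b p (A p x) y = b p x (B p y).

Definition Vop (s : field) : field := fun p =>
  cov (fnabla F) s (feuler F) p - ((2 - fd F) / 2) *: s p.

(* D' and Pdag are determined by [cdv_chern] and [adjoint hform P Pdag]. *)
Definition harmonic_frobenius (P : M -> T -> T) : Prop :=
  exists (D' : derivation) (Pstar Pdag : M -> T -> T),
  [/\ is_CDVplus D',
      [/\ forall p, linear (P p),
          forall W s, open W -> smooth_field W s -> smooth_field W (fapp P s),
          adjoint (fg F) P Pstar & adjoint hform P Pdag],
      (forall W s p v, open W -> W p -> smooth_field W s ->
         D' p v (fapp P s) - P p (D' p v s) = Phi p v (s p)),
      (forall W s p v, open W -> W p -> smooth_field W s ->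
         D' p v s = fnabla F p v s
           - (Pdag p (Phi p v (s p)) - Phi p v (Pdag p (s p)))) &
      Pstar = P /\
      (forall W s p, open W -> W p -> smooth_field W s ->
         Qop D' s p = Vop s p
           + (Pdag p (Uop p (s p)) - Uop p (Pdag p (s p))))].

End CDV.

End VectorFields.

(* Main.v *)
Require Import Defs.
From HB Require Import structures.
From mathcomp Require Import all_boot all_order all_algebra.
From mathcomp Require Import all_classical all_reals.
From mathcomp Require Import topology normedtype landau derive realfun.
From mathcomp Require Import complex.
From mathcomp Require Import ring lra.
Import Order.TTheory GRing.Theory Num.Theory.
Import numFieldNormedType.Exports.
Local Open Scope classical_set_scope.
Local Open Scope ring_scope.

(** Near every point let e_a be the canonical frame, eta_a = g(e_a, e_a), and
    k_a = |eta_a| / eta_a, so that kappa e_a = k_a e_a.  The form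
    h = g(., kappa .) is diagonal in this frame, with positive coefficients
    |eta_a|; since h is diagonal and e_a is holomorphic, the Chern connection is
    diagonal as well,

      D'_v e_b = theta_b(v) e_b,   theta_b(v) = v(eta_b) / (2 eta_b),

    the logarithmic derivative of |eta_b|.  As g is diagonal with the symmetric
    matrix eta_ab of derivatives of its coefficients, the Koszul formula expresses
    the Levi-Civita connection by the eta_ab alone, and the off-diagonal part of
    nabla is exactly the commutator [P^dag, Phi]: the h-adjoint of P is
    kappa P kappa, whose off-diagonal coefficients are eta_ab / (2 eta_a).

    This suggests reading the relation D' = nabla - [P^dag, Phi] as a definition
    of D', with P^dag := kappa P kappa.  It makes sense globally, without any
    choice of coordinates ([chern10]), and the computation in the frame
    ([co_chern10]) identifies it with the diagonal connection above.  All the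
    operators involved, namely Phi, its conjugate, the multiplication by the Euler
    field and its conjugate, and D' itself, are then diagonal, so that each
    identity of a CV-structure is checked coefficient by coefficient, where it is
    an instance of the Leibniz rule, of the commutation of derivatives, or of the
    fact that theta_b is a holomorphic closed form ([theta_bracket],
    [hol_theta]).

    Homogeneity of the metric under the Euler field E gives
    theta_b(E) = - d / 2 ([theta_euler]), whence Q = 0 ([Qop_zero]).  The relation
    Q = V + [P^dag, U] follows from D' = nabla - [P^dag, Phi] and the vanishing of
    the torsion, and D'P = Phi from the formula for the coefficients of P
    ([del_Pcoef]): apart from an antiholomorphic factor they are
    eta_b / (|eta_a| |eta_b|), whose logarithmic derivative is theta_b - theta_a,
    while the diagonal coefficients are minus the coordinates.

    The first half of the file provides the calculus this needs: C^k functions of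
    several real variables with the symmetry of second derivatives
    ([derive_comm]), Wirtinger derivatives with their chain rule ([dz_comp]),
    independence of the chart, the expansion of vectors and fields in the frame of
    a holomorphic chart ([frame_basis], [bracket_component], [dbar_component]), and
    the locality of connections, which reduces them to their values on a frame
    ([conn_frame]). *)

Set Implicit Arguments.
Unset Strict Implicit.
Unset Printing Implicit Defensive.

Local Notation coord := Defs.coord.
Local Notation fprod := Defs.fprod.

(** * Locality of differentiability *)

Section Locality.
Context {R : realType} {V W : normedModType R}.

Lemma differentiable_near0 (f : V -> W) (x : V) :
  (\near x, f x = 0) -> differentiable f x.
Proof.
move=> f0.
have fx0 : f x = 0 by exact: nbhs_singleton f0.
have E : continuous (0 : V -> W) /\
   f \o shift x = cst (f x) + (0 : V -> W) +o_ (0 : V) id.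
  split; first exact: cst_continuous.
  apply/eqaddoP => e e0; have := f0; rewrite (near_shift 0) /= subr0.
  apply: filterS => y /= fy; rewrite !fctE fy fx0 addr0 subr0 normr0.
  by rewrite mulr_ge0 // ltW.
have dE : 'd f x = 0 :> (V -> W) by apply/diff_unique; case: E.
by apply/diff_locallyP; rewrite dE.
Qed.

(** Since g = f + (g - f), it is enough that a function vanishing near x is
    differentiable at x. *)
Lemma near_eq_differentiable (f g : V -> W) (x : V) :
  (\near x, f x = g x) -> differentiable f x -> differentiable g x.
Proof.
move=> fg df; have -> : g = f + (g - f) by rewrite addrC subrK.
apply: differentiableD => //; apply: differentiable_near0.
by near=> y; rewrite !fctE (near fg y)// subrr.
Unshelve. all: by end_near. Qed.

End Locality.

(** * Symmetry of second derivatives *)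

Section Schwarz.
Context {R : realType} {V : normedModType R}.
Implicit Types (f : V -> R) (x y v w : V).

Lemma is_derive_line f y v (a : R) : derivable f (y + a *: v) v ->
  is_derive a (1 : R) (fun h : R => f (y + h *: v)) ('D_v f (y + a *: v)).
Proof.
have E : (fun h : R => h^-1 *: (((fun h0 : R => f (y + h0 *: v)) \o shift a) (h *: (1 : R))
            - f (y + a *: v))) =
         (fun h : R => h^-1 *: ((f \o shift (y + a *: v)) (h *: v) - f (y + a *: v))).
  rewrite funeqE => h /=; congr (_ *: (f _ - _)).
  by rewrite -[h *: (1 : R)]/(h * 1) mulr1 scalerDl addrCA.
by move=> df; split; rewrite ?/derivable ?/derive /= E.
Qed.

(** The second difference of f at the vertices of the parallelogram with
    sides [s *: v] and [s *: w]. *)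
Definition square_diff f x v w (s : R) :=
  f (x + s *: v + s *: w) - f (x + s *: v) - (f (x + s *: w) - f x).

(** The mean value theorem along v, applied to the difference of f between two
    opposite sides, followed by the mean value theorem along w. *)
Lemma square_diff_mvt f x v w (s : R) : 0 < s ->
  (forall a b, 0 <= a <= s -> 0 <= b <= s ->
     let y := x + a *: v + b *: w in
     derivable f y v /\ derivable (fun z => 'D_v f z) y w) ->
  exists a b, [/\ 0 <= a <= s, 0 <= b <= s &
     square_diff f x v w s =
       'D_w (fun z => 'D_v f z) (x + a *: v + b *: w) * s ^+ 2].
Proof.
move=> s0 H.
have s0' : 0 <= s by exact: ltW.
have comm a b : x + b *: w + a *: v = x + a *: v + b *: w by rewrite addrAC.
pose g (a : R) := f (x + s *: w + a *: v) - f (x + a *: v).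
have dg (a : R) : 0 <= a <= s -> is_derive a (1:R) g
   ('D_v f (x + s *: w + a *: v) - 'D_v f (x + a *: v)).
  move=> as_; apply: is_deriveB; apply: is_derive_line.
    by rewrite comm; apply: (H a s as_ _).1; rewrite // lexx s0'.
  by have := (H a 0 as_ _).1; rewrite /= scale0r addr0; apply; rewrite lexx s0'.
have [||a as_ E] := @MVT_segment R g
   (fun a => 'D_v f (x + s *: w + a *: v) - 'D_v f (x + a *: v)) 0 s s0'.
- by move=> a; rewrite in_itv /= => /andP[/ltW a0 /ltW a1]; apply: dg; rewrite a0.
- apply: derivable_within_continuous => a; rewrite in_itv /= => ?.
  by have [] := dg a.
have as' : 0 <= a <= s by rewrite in_itv in as_.
pose k (b : R) := 'D_v f (x + a *: v + b *: w).
have dk (b : R) : 0 <= b <= s -> is_derive b (1:R) k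
   ('D_w (fun z => 'D_v f z) (x + a *: v + b *: w)).
  by move=> bs_; apply: is_derive_line; apply: (H a b as' bs_).2.
have [||b bs_ E'] := @MVT_segment R k
   (fun b => 'D_w (fun z => 'D_v f z) (x + a *: v + b *: w)) 0 s s0'.
- by move=> b; rewrite in_itv /= => /andP[/ltW b0 /ltW b1]; apply: dk; rewrite b0.
- apply: derivable_within_continuous => b; rewrite in_itv /= => ?.
  by have [] := dk b.
exists a, b; split => //.
rewrite expr2 mulrA -[X in _ * X * _]subr0 -E' /k scale0r addr0.
rewrite -[X in _ * X]subr0 -comm -E /g /square_diff !scale0r !addr0.
by rewrite (comm s s).
Qed.

Lemma near_square x v w (P : set V) : (\near x, P x) ->
  exists2 s : R, 0 < s & forall a b, 0 <= a <= s -> 0 <= b <= s ->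
    P (x + a *: v + b *: w).
Proof.
move=> /nbhs_ballP[r /= r0 rP].
have d0 : 0 < `|v| + `|w| + 1 by rewrite ltr_wpDl // addr_ge0.
(* The summand 1 keeps the denominator positive when v = w = 0. *)
exists (r / (`|v| + `|w| + 1)); first exact: divr_gt0.
move=> a b /andP[a0 a1] /andP[b0 b1]; apply: rP.
rewrite -ball_normE /= -addrA opprD addrA subrr add0r normrN.
apply: le_lt_trans (ler_normD _ _) _; rewrite !normrZ !ger0_norm //.
apply: (@le_lt_trans _ _ (r / (`|v| + `|w| + 1) * (`|v| + `|w|))).
  by rewrite mulrDr lerD // ler_wpM2r.
by rewrite mulrAC ltr_pdivrMr // ltr_pM2l // ltrDl.
Qed.

(** Schwarz's theorem.  [square_diff] is symmetric in v and w, so that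
    [square_diff_mvt] yields, in every neighbourhood of x, a value of one mixed
    derivative equal to a value of the other; both are continuous at x. *)
Theorem derive_comm f x v w :
  (\forall y \near x, derivable f y v /\ derivable (fun z => 'D_v f z) y w) ->
  (\forall y \near x, derivable f y w /\ derivable (fun z => 'D_w f z) y v) ->
  {for x, continuous (fun y => 'D_w (fun z => 'D_v f z) y)} ->
  {for x, continuous (fun y => 'D_v (fun z => 'D_w f z) y)} ->
  'D_w (fun z => 'D_v f z) x = 'D_v (fun z => 'D_w f z) x.
Proof.
move=> H1 H2 c1 c2; apply/eqP/negPn/negP => neq.
set A := 'D_w _ x in neq c1; set B := 'D_v _ x in neq c2.
have e0 : 0 < `|A - B| / 2 by rewrite divr_gt0 // normr_gt0 subr_eq0.
have n1 : \forall y \near x, `|A - 'D_w (fun z => 'D_v f z) y| < `|A - B| / 2.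
  by move/cvgrPdist_lt: c1 => /(_ _ e0).
have n2 : \forall y \near x, `|B - 'D_v (fun z => 'D_w f z) y| < `|A - B| / 2.
  by move/cvgrPdist_lt: c2 => /(_ _ e0).
have [s s0 Hs] := near_square v w (filterI (filterI H1 H2) (filterI n1 n2)).
have [a [b [as_ bs_ E1]]] : exists a b, [/\ 0 <= a <= s, 0 <= b <= s &
     square_diff f x v w s =
       'D_w (fun z => 'D_v f z) (x + a *: v + b *: w) * s ^+ 2].
  apply: (square_diff_mvt s0) => a b ha hb; exact: (Hs a b ha hb).1.1.
have [b' [a' [bs' as' E2]]] : exists b a, [/\ 0 <= b <= s, 0 <= a <= s &
     square_diff f x w v s =
       'D_v (fun z => 'D_w f z) (x + b *: w + a *: v) * s ^+ 2].
  apply: (square_diff_mvt s0) => a' b' ha hb y; rewrite {}/y.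
  have -> : x + a' *: w + b' *: v = x + b' *: v + a' *: w by exact: addrAC.
  exact: (Hs b' a' hb ha).1.2.
have [_ [h1 _]] := Hs a b as_ bs_; have [_ [_ h2]] := Hs a' b' as' bs'.
have E : 'D_w (fun z => 'D_v f z) (x + a *: v + b *: w) =
         'D_v (fun z => 'D_w f z) (x + a' *: v + b' *: w).
  have C : x + b' *: w + a' *: v = x + a' *: v + b' *: w by exact: addrAC.
  rewrite C in E2.
  have E3 : square_diff f x v w s = square_diff f x w v s.
    have Cs : x + s *: w + s *: v = x + s *: v + s *: w by exact: addrAC.
    rewrite /square_diff Cs.
    move: (f (x + s *: v + s *: w)) (f (x + s *: v)) (f (x + s *: w)) (f x).
    by move=> p q r t; ring.
  move: E1 E2; rewrite E3 => -> /(mulIf _); apply.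
  exact: lt0r_neq0 (exprn_gt0 2 s0).
rewrite E in h1; move: h1 h2.
move: ('D_v _ (x + _ + _)) => q h1 h2.
have h3 := ler_distD q A B; rewrite (distrC q B) in h3.
by have := le_lt_trans h3 (ltrD h1 h2); rewrite -splitr ltxx.
Qed.

End Schwarz.

(** * Functions of class C^k *)

Section Ck.
Context {R : realType} {m : nat}.
Local Notation V := (Cspace R m).
Implicit Types (O : set V) (f g : V -> R) (x v w : V).

Lemma near_open O x (P : V -> Prop) : open O -> O x ->
  (forall y, O y -> P y) -> \near x, P x.
Proof. by move=> oO Ox H; apply: filterS H _; apply: open_nbhs_nbhs. Qed.

Lemma derive_eq_on O f g x v : open O -> O x -> (forall y, O y -> f y = g y) ->
  'D_v f x = 'D_v g x.
Proof. by move=> oO Ox fg; apply: near_eq_derive; exact: near_open fg. Qed.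

Lemma Ck_sub k O U f : U `<=` O -> Ck k O f -> Ck k U f.
Proof.
elim: k f => [|k IH] f sO /=; first by move=> H x /sO; exact: H.
by move=> [H1 H2]; split=> [x /sO|v]; [exact: H1|exact: IH].
Qed.

Lemma Ck_continuous k O f x : Ck k O f -> O x -> {for x, continuous f}.
Proof.
case: k => [|k] /=; first by move=> H; exact: H.
by move=> [H _] Ox; apply: differentiable_continuous; exact: H.
Qed.

Lemma CkW k O f : Ck k.+1 O f -> Ck k O f.
Proof.
elim: k f => [|k IH] f; first by move=> H x; exact: Ck_continuous H.
by move=> [H1 H2]; split => // v; apply: IH; exact: H2.
Qed.

(** For open O, membership in C^k depends on the values on O only. *)
Lemma Ck_eq k O f g : open O -> (forall x, O x -> f x = g x) ->
  Ck k O f -> Ck k O g.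
Proof.
move=> oO; elim: k f g => [|k IH] f g fg /=.
  move=> H x Ox; have := H x Ox.
  rewrite /prop_for /continuous_at -(fg x Ox).
  apply: cvg_trans; apply: near_eq_cvg; apply: near_open oO Ox _ => y Oy.
  by rewrite fg.
move=> [H1 H2]; split=> [x Ox|v].
  by apply: near_eq_differentiable (H1 x Ox); exact: near_open fg.
by apply: IH (H2 v) => x Ox; exact: derive_eq_on fg.
Qed.

Lemma Ck_local k O f :
  (forall x, O x -> exists2 U : set V, U x & Ck k (O `&` U) f) -> Ck k O f.
Proof.
elim: k f => [|k IH] f H.
  by move=> x Ox; have [U Ux] := H x Ox; apply.
split=> [x Ox|v].
  by have [U Ux [H1 _]] := H x Ox; exact: H1.
by apply: IH => x Ox; have [U Ux [_ H2]] := H x Ox; exists U; last exact: H2.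
Qed.

Lemma Ck_cst k O (c : R) : Ck k O (fun=> c).
Proof.
elim: k c => [|k IH] c /=; first by move=> x _; exact: cst_continuous.
split=> [x _|v]; first exact: differentiable_cst.
suff -> : (fun x => 'D_v (fun=> c) x) = (fun=> 0) by exact: IH.
by apply/funext => x; exact: derive_cst.
Qed.

Lemma CkD k O f g : open O -> Ck k O f -> Ck k O g ->
  Ck k O (fun x => f x + g x).
Proof.
move=> oO; elim: k f g => [|k IH] f g /=.
  by move=> Hf Hg x Ox; apply: continuousD; [exact: Hf|exact: Hg].
move=> [Hf Hf'] [Hg Hg']; split=> [x Ox|v].
  by apply: differentiableD; [exact: Hf|exact: Hg].
apply: (Ck_eq oO _ (IH _ _ (Hf' v) (Hg' v))) => x Ox.
by apply/esym/deriveD; apply: diff_derivable; [exact: Hf|exact: Hg].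
Qed.

Lemma CkM k O f g : open O -> Ck k O f -> Ck k O g ->
  Ck k O (fun x => f x * g x).
Proof.
move=> oO; elim: k f g => [|k IH] f g.
  by move=> Hf Hg x Ox; apply: continuousM; [exact: Hf|exact: Hg].
move=> Hf Hg; have [Hf1 Hf2] := Hf; have [Hg1 Hg2] := Hg; split=> [x Ox|v].
  by apply: differentiableM; [exact: Hf1|exact: Hg1].
have H := CkD oO (IH _ _ (CkW Hf) (Hg2 v)) (IH _ _ (CkW Hg) (Hf2 v)).
apply: (Ck_eq oO _ H) => x Ox.
by apply/esym/deriveM; apply: diff_derivable; [exact: Hf1|exact: Hg1].
Qed.

Lemma CkN k O f : open O -> Ck k O f -> Ck k O (fun x => - f x).
Proof.
move=> oO Hf; apply: (Ck_eq oO _ (CkM oO (Ck_cst k O (-1)) Hf)) => x _.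
by rewrite mulN1r.
Qed.

Lemma Ck_sum k O n (F : 'I_n -> V -> R) : open O -> (forall i, Ck k O (F i)) ->
  Ck k O (fun x => \sum_i F i x).
Proof.
move=> oO H.
have -> : (fun x => \sum_i F i x) = \sum_i F i by apply/funext => x; rewrite fct_sumE.
elim/big_ind: _ => [|f g Hf Hg|i _]; [exact: Ck_cst|exact: CkD|exact: H].
Qed.

(** The derivative of 1/f is a product of functions of lower class:
    (1/f)' = - (1/f) (1/f) f'. *)
Lemma CkV k O f : open O -> (forall x, O x -> f x != 0) -> Ck k O f ->
  Ck k O (fun x => (f x)^-1).
Proof.
move=> oO f0; elim: k => [|k IH].
  by move=> Hf x Ox; apply: continuousV; [exact: f0|exact: Hf].
move=> Hf; have [Hf1 Hf2] := Hf; split=> [x Ox|v].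
  by apply: differentiableV; [exact: Hf1|exact: f0].
have Hi := IH (CkW Hf).
apply: (Ck_eq oO _ (CkN oO (CkM oO (CkM oO Hi Hi) (Hf2 v)))) => x Ox.
have d : derivable f x v by apply: diff_derivable; exact: Hf1.
rewrite [RHS](deriveV (f0 _ Ox) d).
by rewrite -[_ *: _]/(_ * _) expr2 invfM mulNr.
Qed.

Lemma derive_sqrt f x v : 0 < f x -> differentiable f x ->
  differentiable (fun y => Num.sqrt (f y)) x /\
  'D_v (fun y => Num.sqrt (f y)) x = 'D_v f x / (2 * Num.sqrt (f x)).
Proof.
move=> fx0 df.
have ds := is_derive1_sqrt fx0.
have ds' : differentiable Num.sqrt (f x) by apply/derivable1_diffP.
have dc : differentiable (Num.sqrt \o f) x by exact: differentiable_comp.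
split; first exact: dc.
have E1 : 'd Num.sqrt (f x) (1 : R) = (2 * Num.sqrt (f x))^-1.
  by rewrite -(@derive_val _ _ _ _ _ _ _ ds) deriveE.
have E2 : 'd f x v = 'd f x v *: (1 : R) by rewrite -[_ *: _]/(_ * _) mulr1.
have -> : 'D_v (fun y => Num.sqrt (f y)) x = 'd (Num.sqrt \o f) x v.
  exact: (deriveE v dc).
by rewrite diff_comp //= E2 linearZ /= E1 deriveE.
Qed.

Lemma Ck_sqrt k O f : open O -> (forall x, O x -> 0 < f x) -> Ck k O f ->
  Ck k O (fun x => Num.sqrt (f x)).
Proof.
move=> oO f0; elim: k => [|k IH].
  by move=> Hf x Ox; apply: continuous_comp; [exact: Hf|exact: sqrt_continuous].
move=> Hf; have [Hf1 Hf2] := Hf.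
split=> [x Ox|v]; first by have [] := derive_sqrt 0 (f0 x Ox) (Hf1 x Ox).
have Hs := CkM oO (Ck_cst k O 2) (IH (CkW Hf)).
have Hi := CkV oO _ Hs.
apply: (Ck_eq oO _ (CkM oO (Hf2 v) (Hi _))) => x Ox.
  by rewrite (derive_sqrt _ (f0 x Ox) (Hf1 x Ox)).2.
by rewrite mulf_neq0 // gt_eqF // sqrtr_gt0 f0.
Qed.

End Ck.

(** * Composition of maps of C^m *)

Section Composition.
Context {R : realType} {m : nat}.
Local Notation V := (Cspace R m).
Implicit Types (O U : set V) (f g : V -> R) (x v w : V) (h : V -> V).

Definition dirx (j : 'I_m) : V := (delta_mx 0 j, 0).
Definition diry (j : 'I_m) : V := (0, delta_mx 0 j).

Lemma fst_sum (I : Type) (r : seq I) (F : I -> V) :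
  (\sum_(i <- r) F i).1 = \sum_(i <- r) (F i).1.
Proof. by elim/big_ind2: _ => // a b c d /= <- <-. Qed.

Lemma snd_sum (I : Type) (r : seq I) (F : I -> V) :
  (\sum_(i <- r) F i).2 = \sum_(i <- r) (F i).2.
Proof. by elim/big_ind2: _ => // a b c d /= <- <-. Qed.

Lemma Cspace_basis x : x = \sum_j (x.1 0 j *: dirx j + x.2 0 j *: diry j).
Proof.
rewrite [LHS]surjective_pairing [RHS]surjective_pairing; congr pair.
  rewrite fst_sum [LHS]row_sum_delta; apply: eq_bigr => j _ /=.
  by rewrite scaler0 addr0.
rewrite snd_sum [LHS]row_sum_delta; apply: eq_bigr => j _ /=.
by rewrite scaler0 add0r.
Qed.

Lemma derive_basis f x v : differentiable f x ->
  'D_v f x = \sum_j (v.1 0 j * 'D_(dirx j) f x + v.2 0 j * 'D_(diry j) f x).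
Proof.
move=> df; rewrite deriveE // [X in 'd f x X](Cspace_basis v) linear_sum.
by apply: eq_bigr => j _; rewrite linearD !linearZ /= !deriveE.
Qed.

Definition coordx (j : 'I_m) (y : V) : R := y.1 0 j.
Definition coordy (j : 'I_m) (y : V) : R := y.2 0 j.

Lemma linear_is_diff (f : V -> R) x : linear f -> continuous f -> is_diff x f f.
Proof.
move=> lf cf; pose fM := GRing.isLinear.Build _ _ _ _ _ lf.
pose fL : {linear _ -> _} := HB.pack f fM.
have -> : f = fL by [].
by apply: DiffDef; [exact: linear_differentiable|rewrite diff_lin].
Qed.

Lemma is_diff_coordx j x : is_diff x (coordx j) (coordx j).
Proof.
apply: linear_is_diff => [a y z|y]; first by rewrite /coordx /= !mxE.
by apply: (@continuous_comp _ _ _ fst (fun z : 'rV_m => z 0 j));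
  [exact: cvg_fst|exact: coord_continuous].
Qed.

Lemma is_diff_coordy j x : is_diff x (coordy j) (coordy j).
Proof.
apply: linear_is_diff => [a y z|y]; first by rewrite /coordy /= !mxE.
by apply: (@continuous_comp _ _ _ snd (fun z : 'rV_m => z 0 j));
  [exact: cvg_snd|exact: coord_continuous].
Qed.

Lemma derive_coordx j x v : 'D_v (coordx j) x = coordx j v.
Proof. by have [? E] := is_diff_coordx j x; rewrite deriveE // E. Qed.

Lemma derive_coordy j x v : 'D_v (coordy j) x = coordy j v.
Proof. by have [? E] := is_diff_coordy j x; rewrite deriveE // E. Qed.

Lemma coordwise h : h = fun x => \sum_j (coordx j (h x) *: dirx j + coordy j (h x) *: diry j).
Proof. by apply/funext => x; exact: Cspace_basis. Qed.

Lemma differentiable_coordwise h x :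
  (forall j, differentiable (fun y => coordx j (h y)) x) ->
  (forall j, differentiable (fun y => coordy j (h y)) x) -> differentiable h x.
Proof.
move=> dx dy.
have E : h = \sum_j ((fun y => coordx j (h y) *: dirx j) + (fun y => coordy j (h y) *: diry j)).
  by apply/funext => y; rewrite fct_sumE [LHS]Cspace_basis.
rewrite E; apply: differentiable_sum => j.
by apply: differentiableD; apply: differentiableZl.
Qed.

(** The derivative of h at x along v is the vector with coordinates the
    derivatives of the coordinates of h, because the coordinate functions are
    linear. *)
Lemma derive_comp f h x v : differentiable h x -> differentiable f (h x) ->
  'D_v (fun y => f (h y)) x =
    \sum_j ('D_v (fun y => coordx j (h y)) x * 'D_(dirx j) f (h x) +
            'D_v (fun y => coordy j (h y)) x * 'D_(diry j) f (h x)).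
Proof.
move=> dh df.
have dc g : differentiable g (h x) -> 'D_v (g \o h) x = 'd g (h x) ('d h x v).
  move=> dg; have dgh : differentiable (g \o h) x := differentiable_comp dh dg.
  have E1 := deriveE v dgh.
  have E2 := congr1 (fun F : V -> R => F v) (diff_comp dh dg).
  exact: etrans E1 E2.
rewrite -[LHS]/('D_v (f \o h) x) (dc f df) -(deriveE _ df) (derive_basis _ df).
apply: eq_bigr => j _.
have [dx Ex] := is_diff_coordx j (h x); have [dy Ey] := is_diff_coordy j (h x).
have -> : 'D_v (fun y => coordx j (h y)) x = coordx j ('d h x v).
  exact: etrans (dc _ dx) (congr1 (fun F : V -> R => F _) Ex).
have -> : 'D_v (fun y => coordy j (h y)) x = coordy j ('d h x v).
  exact: etrans (dc _ dy) (congr1 (fun F : V -> R => F _) Ey).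
by [].
Qed.

(** By the chain rule the derivatives of the composite are sums of products of
    components of the derivative of h with derivatives of f composed with h, to
    which the induction applies. *)
Lemma Ck_comp k O U f h : open O ->
  (forall x, O x -> U (h x)) ->
  (forall j, Ck k O (fun y => coordx j (h y))) ->
  (forall j, Ck k O (fun y => coordy j (h y))) ->
  Ck k U f -> Ck k O (fun x => f (h x)).
Proof.
move=> oO hU; elim: k f => [|k IH] f Hx Hy.
  move=> Hf x Ox; apply: (@continuous_comp _ _ _ h f); last exact: Hf (hU _ Ox).
  pose G y := \sum_j (coordx j (h y) *: dirx j + coordy j (h y) *: diry j).
  have -> : h = G := coordwise h.
  rewrite /continuous_at /G.
  apply: (@cvg_big _ _ (@GRing.add V)) => [z|j _].
    by apply: cvgD; [exact: cvg_fst|exact: cvg_snd].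
  apply: cvgD; (apply: cvgZ; last exact: cvg_cst).
    exact: (Hx j x Ox).
  exact: (Hy j x Ox).
move=> [Hf1 Hf2].
have dh x : O x -> differentiable h x.
  move=> Ox; apply: differentiable_coordwise => j.
    by have [H _] := Hx j; exact: H.
  by have [H _] := Hy j; exact: H.
split=> [x Ox|v].
  by apply: (@differentiable_comp _ _ _ _ h f); [exact: dh|apply/Hf1/hU].
have H : Ck k O (fun x => \sum_j
   ('D_v (fun y => coordx j (h y)) x * 'D_(dirx j) f (h x) +
    'D_v (fun y => coordy j (h y)) x * 'D_(diry j) f (h x))).
  apply: Ck_sum => // j.
  have Hx' i := CkW (Hx i); have Hy' i := CkW (Hy i).
  apply: CkD => //; apply: CkM => //.
  - by have [_ ] := Hx j; exact.
  - exact: (IH _ Hx' Hy' (Hf2 _)).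
  - by have [_ ] := Hy j; exact.
  - exact: (IH _ Hx' Hy' (Hf2 _)).
apply: (Ck_eq oO _ H) => x Ox.
by rewrite derive_comp //; [exact: dh|apply/Hf1/hU].
Qed.

End Composition.

(** * Smooth complex-valued functions *)

Section ComplexValued.
Context {R : realType} {m : nat}.
Local Notation V := (Cspace R m).
Local Notation C := R[i].
Local Notation Re := complex.Re.
Local Notation Im := complex.Im.
Implicit Types (O U : set V) (F G : V -> C) (x v w : V) (h : V -> V) (z : C).

Lemma cReD z1 z2 : Re (z1 + z2) = Re z1 + Re z2. Proof. by case: z1; case: z2. Qed.
Lemma cImD z1 z2 : Im (z1 + z2) = Im z1 + Im z2. Proof. by case: z1; case: z2. Qed.
Lemma cReM z1 z2 : Re (z1 * z2) = Re z1 * Re z2 - Im z1 * Im z2.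
Proof. by case: z1; case: z2. Qed.
Lemma cImM z1 z2 : Im (z1 * z2) = Re z1 * Im z2 + Im z1 * Re z2.
Proof. by case: z1; case: z2. Qed.
Lemma cReJ z : Re (z^*) = Re z. Proof. by case: z. Qed.
Lemma cImJ z : Im (z^*) = - Im z. Proof. by case: z. Qed.
Lemma cReV z : Re z^-1 = Re z / (Re z * Re z + Im z * Im z).
Proof. by case: z. Qed.
Lemma cImV z : Im z^-1 = - Im z / (Re z * Re z + Im z * Im z).
Proof. by case: z => a b /=; rewrite mulNr. Qed.
Lemma cReNorm z : Re `|z| = Num.sqrt (Re z * Re z + Im z * Im z).
Proof. by rewrite normc_def /= !expr2. Qed.
Lemma cImNorm z : Im `|z| = 0.
Proof. by rewrite normc_def. Qed.

Lemma cRe_real (a : R) z : Re (a%:C%C * z) = a * Re z.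
Proof. by case: z => b c /=; rewrite mul0r subr0. Qed.
Lemma cIm_real (a : R) z : Im (a%:C%C * z) = a * Im z.
Proof. by case: z => b c /=; rewrite mul0r addr0. Qed.

Lemma eq_ReIm z1 z2 : Re z1 = Re z2 -> Im z1 = Im z2 -> z1 = z2.
Proof. by case: z1 => a b; case: z2 => c d /= -> ->. Qed.

Lemma sqr_ReIm_gt0 z : z != 0 -> 0 < Re z * Re z + Im z * Im z.
Proof.
case: z => a b /=; rewrite eq_complex /= negb_and => ab.
rewrite lt_neqAle eq_sym -!expr2 addr_ge0 ?sqr_ge0 // andbT.
by rewrite paddr_eq0 ?sqr_ge0 // !sqrf_eq0 negb_and.
Qed.

Lemma smoothV_sub O U F : U `<=` O -> smoothV O F -> smoothV U F.
Proof. by move=> UO H k; have [H1 H2] := H k; split; exact: Ck_sub UO _. Qed.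

Lemma smoothV_eq O F G : open O -> (forall x, O x -> F x = G x) ->
  smoothV O F -> smoothV O G.
Proof.
move=> oO FG H k; have [H1 H2] := H k.
by split; [apply: Ck_eq oO _ H1|apply: Ck_eq oO _ H2] => x Ox; rewrite FG.
Qed.

Lemma smoothV_local O F :
  (forall x, O x -> exists2 U : set V, U x & smoothV (O `&` U) F) -> smoothV O F.
Proof.
by move=> H k; split; apply: Ck_local => x Ox; have [U Ux HU] := H x Ox;
  exists U => //; have [] := HU k.
Qed.

Lemma smoothV_cst O z : smoothV O (fun=> z).
Proof. by move=> k; split; exact: Ck_cst. Qed.

Lemma smoothVD O F G : open O -> smoothV O F -> smoothV O G ->
  smoothV O (fun x => F x + G x).
Proof.
move=> oO HF HG k; have [F1 F2] := HF k; have [G1 G2] := HG k.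
split; [apply: Ck_eq oO _ (CkD oO F1 G1)|apply: Ck_eq oO _ (CkD oO F2 G2)];
  by move=> x _; rewrite ?cReD ?cImD.
Qed.

Lemma smoothVM O F G : open O -> smoothV O F -> smoothV O G ->
  smoothV O (fun x => F x * G x).
Proof.
move=> oO HF HG k; have [F1 F2] := HF k; have [G1 G2] := HG k.
split.
  apply: Ck_eq oO _ (CkD oO (CkM oO F1 G1) (CkN oO (CkM oO F2 G2))) => x _.
  by rewrite cReM.
by apply: Ck_eq oO _ (CkD oO (CkM oO F1 G2) (CkM oO F2 G1)) => x _; rewrite cImM.
Qed.

Lemma smoothVJ O F : open O -> smoothV O F -> smoothV O (fun x => (F x)^*).
Proof.
move=> oO HF k; have [F1 F2] := HF k; split.
  by apply: Ck_eq oO _ F1 => x _; rewrite cReJ.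
by apply: Ck_eq oO _ (CkN oO F2) => x _; rewrite cImJ.
Qed.

Lemma Ck_normsq k O F : open O -> smoothV O F ->
  Ck k O (fun x => Re (F x) * Re (F x) + Im (F x) * Im (F x)).
Proof. by move=> oO HF; have [F1 F2] := HF k; apply: CkD => //; exact: CkM. Qed.

Lemma smoothVV O F : open O -> (forall x, O x -> F x != 0) ->
  smoothV O F -> smoothV O (fun x => (F x)^-1).
Proof.
move=> oO F0 HF k; have [F1 F2] := HF k.
have Hn := CkV oO (fun x Ox => lt0r_neq0 (sqr_ReIm_gt0 (F0 x Ox)))
  (Ck_normsq k oO HF).
split; first by apply: Ck_eq oO _ (CkM oO F1 Hn) => x _; rewrite cReV.
by apply: Ck_eq oO _ (CkM oO (CkN oO F2) Hn) => x _; rewrite cImV.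
Qed.

(** The modulus is the square root of a positive function where F does not
    vanish. *)
Lemma smoothV_norm O F : open O -> (forall x, O x -> F x != 0) ->
  smoothV O F -> smoothV O (fun x => `|F x|).
Proof.
move=> oO F0 HF k; split.
  apply: Ck_eq oO _ (Ck_sqrt oO (fun x Ox => sqr_ReIm_gt0 (F0 x Ox))
    (Ck_normsq k oO HF)) => x _; by rewrite cReNorm.
by apply: Ck_eq oO _ (Ck_cst k O 0) => x _; rewrite cImNorm.
Qed.

Lemma smoothV_sum O n (F : 'I_n -> V -> C) : open O ->
  (forall i, smoothV O (F i)) -> smoothV O (fun x => \sum_i F i x).
Proof.
move=> oO H.
have -> : (fun x => \sum_i F i x) = \sum_i F i by apply/funext => x; rewrite fct_sumE.
elim/big_ind: _ => [|f g Hf Hg|i _]; [exact: smoothV_cst|exact: smoothVD|exact: H].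
Qed.

Definition coordz (j : 'I_m) (y : V) : C := Complex (coordx j y) (coordy j y).

Lemma smoothV_comp O U F h : open O -> (forall x, O x -> U (h x)) ->
  (forall j, smoothV O (fun y => coordz j (h y))) ->
  smoothV U F -> smoothV O (fun x => F (h x)).
Proof.
move=> oO hU Hh HF k; have [F1 F2] := HF k.
have hx j : Ck k O (fun y => coordx j (h y)) by have [] := Hh j k.
have hy j : Ck k O (fun y => coordy j (h y)) by have [] := Hh j k.
by split; [apply: Ck_comp oO hU hx hy F1|apply: Ck_comp oO hU hx hy F2].
Qed.

Lemma smoothV_pder O F v : open O -> smoothV O F -> smoothV O (pder v F).
Proof. by move=> oO HF k; have [[_ F1] [_ F2]] := HF k.+1; split; [exact: F1|exact: F2]. Qed.

Lemma smoothV_dz O F j : open O -> smoothV O F -> smoothV O (dz j F).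
Proof.
move=> oO HF; apply: smoothVM => //; last exact: smoothV_cst.
apply: smoothVD => //; first exact: smoothV_pder.
apply: (smoothV_eq oO (F := fun x => -1 * ('i * pder (diry j) F x))) => [x _|].
  by rewrite mulN1r.
do 2 (apply: smoothVM => //; first exact: smoothV_cst).
exact: smoothV_pder.
Qed.

Lemma smoothV_dzbar O F j : open O -> smoothV O F -> smoothV O (dzbar j F).
Proof.
move=> oO HF; apply: smoothVM => //; last exact: smoothV_cst.
apply: smoothVD => //; first exact: smoothV_pder.
by apply: smoothVM => //; [exact: smoothV_cst|exact: smoothV_pder].
Qed.

Definition cdiff F x :=
  differentiable (fun y => Re (F y)) x /\ differentiable (fun y => Im (F y)) x.

Lemma smoothV_cdiff O F x : smoothV O F -> O x -> cdiff F x.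
Proof. by move=> HF Ox; have [[F1 _] [F2 _]] := HF 1%N; split; [exact: F1|exact: F2]. Qed.

Lemma cdiff_derivable F x v : cdiff F x ->
  derivable (fun y => Re (F y)) x v /\ derivable (fun y => Im (F y)) x v.
Proof. by move=> [H1 H2]; split; exact: diff_derivable. Qed.

Lemma pder_eq_on O F G x v : open O -> O x -> (forall y, O y -> F y = G y) ->
  pder v F x = pder v G x.
Proof.
by move=> oO Ox FG; congr Complex; apply: derive_eq_on oO Ox _ => y Oy; rewrite FG.
Qed.

Lemma pder_cst z x v : pder v (fun=> z) x = 0.
Proof. by apply: eq_ReIm; exact: derive_cst. Qed.

Lemma derive_ext (f g : V -> R) x v : f =1 g -> 'D_v f x = 'D_v g x.
Proof. by move=> /funext ->. Qed.

Lemma pderD F G x v : cdiff F x -> cdiff G x ->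
  pder v (fun y => F y + G y) x = pder v F x + pder v G x.
Proof.
move=> /(cdiff_derivable v)[F1 F2] /(cdiff_derivable v)[G1 G2].
apply: eq_ReIm; rewrite ?cReD ?cImD /=.
  by rewrite -(deriveD F1 G1); apply: derive_ext => y; rewrite cReD.
by rewrite -(deriveD F2 G2); apply: derive_ext => y; rewrite cImD.
Qed.

Lemma pderM F G x v : cdiff F x -> cdiff G x ->
  pder v (fun y => F y * G y) x = pder v F x * G x + F x * pder v G x.
Proof.
move=> /(cdiff_derivable v)[F1 F2] /(cdiff_derivable v)[G1 G2].
have D11 := derivableM F1 G1; have D22 := derivableM F2 G2.
have D12 := derivableM F1 G2; have D21 := derivableM F2 G1.
have M11 := deriveM F1 G1; have M22 := deriveM F2 G2.
have M12 := deriveM F1 G2; have M21 := deriveM F2 G1.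
have alg1 (a b c d a' b' c' d' : R) :
  a * c' + c * a' - (b * d' + d * b') = a' * c - b' * d + (a * c' - b * d').
  by ring.
have alg2 (a b c d a' b' c' d' : R) :
  a * d' + d * a' + (b * c' + c * b') = a' * d + b' * c + (a * d' + b * c').
  by ring.
apply: eq_ReIm; rewrite ?cReD ?cImD ?cReM ?cImM /=.
  transitivity ('D_v ((fun y => Re (F y)) * (fun y => Re (G y))
             - (fun y => Im (F y)) * (fun y => Im (G y))) x).
    by apply: derive_ext => y; rewrite cReM.
  rewrite (deriveB D11 D22) M11 M22; exact: alg1.
transitivity ('D_v ((fun y => Re (F y)) * (fun y => Im (G y))
             + (fun y => Im (F y)) * (fun y => Re (G y))) x).
  by apply: derive_ext => y; rewrite cImM.
rewrite (deriveD D12 D21) M12 M21; exact: alg2.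
Qed.

Lemma pderJ F x v : cdiff F x -> pder v (fun y => (F y)^*) x = (pder v F x)^*.
Proof.
move=> /(cdiff_derivable v)[F1 F2]; apply: eq_ReIm; rewrite ?cReJ ?cImJ /=.
  by apply: derive_ext => y; rewrite cReJ.
rewrite -(deriveN F2).
by apply: derive_ext => y; rewrite cImJ.
Qed.

Lemma pder_comm O F x v w : open O -> O x -> smoothV O F ->
  pder v (pder w F) x = pder w (pder v F) x.
Proof.
move=> oO Ox HF; have [F1 F2] := HF 2%N.
suff H (f : V -> R) : Ck 2 O f ->
   'D_v (fun y => 'D_w f y) x = 'D_w (fun y => 'D_v f y) x.
  by apply: eq_ReIm; [exact: (H _ F1)|exact: (H _ F2)].
move=> [d1 d2]; apply: derive_comm.
- apply: near_open oO Ox _ => y Oy; split; apply: diff_derivable; first exact: d1.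
  by have [d _] := d2 w; exact: d.
- apply: near_open oO Ox _ => y Oy; split; apply: diff_derivable; first exact: d1.
  by have [d _] := d2 v; exact: d.
- by have [_ d] := d2 w; exact: d.
- by have [_ d] := d2 v; exact: d.
Qed.

End ComplexValued.

(** * Wirtinger derivatives *)

Section Wirtinger.
Context {R : realType} {m : nat}.
Local Notation V := (Cspace R m).
Local Notation C := R[i].
Local Notation Re := complex.Re.
Local Notation Im := complex.Im.
Implicit Types (O U : set V) (F G : V -> C) (x v w : V) (h : V -> V) (z : C).

Lemma conj_half z : (z / 2)^* = z^* / 2.
Proof. by rewrite rmorphM fmorphV /= conjC_nat. Qed.

Lemma dz_eq_on O F G x j : open O -> O x -> (forall y, O y -> F y = G y) ->
  dz j F x = dz j G x.
Proof. by move=> oO Ox FG; rewrite /dz !(pder_eq_on _ oO Ox FG). Qed.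

Lemma dzbar_eq_on O F G x j : open O -> O x -> (forall y, O y -> F y = G y) ->
  dzbar j F x = dzbar j G x.
Proof. by move=> oO Ox FG; rewrite /dzbar !(pder_eq_on _ oO Ox FG). Qed.

Lemma dz_cst z x j : dz j (fun=> z) x = 0.
Proof. by rewrite /dz !pder_cst mulr0 subr0 mul0r. Qed.

Lemma dzD F G x j : cdiff F x -> cdiff G x ->
  dz j (fun y => F y + G y) x = dz j F x + dz j G x.
Proof.
move=> dF dG.
have alg (i a b c d : C) :
  (a + b - i * (c + d)) / 2 = (a - i * c) / 2 + (b - i * d) / 2 by field.
exact: etrans (congr2 (fun a b => (a - 'i * b) / 2) (pderD _ dF dG) (pderD _ dF dG))
  (alg _ _ _ _ _).
Qed.

Lemma dzM F G x j : cdiff F x -> cdiff G x ->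
  dz j (fun y => F y * G y) x = dz j F x * G x + F x * dz j G x.
Proof.
move=> dF dG.
have alg (i a b f g c d : C) : (a * g + f * b - i * (c * g + f * d)) / 2 =
  (a - i * c) / 2 * g + f * ((b - i * d) / 2) by field.
exact: etrans (congr2 (fun a b => (a - 'i * b) / 2) (pderM _ dF dG) (pderM _ dF dG))
  (alg _ _ _ _ _ _ _).
Qed.

Lemma dzbarE F x j : cdiff F x -> dzbar j F x = (dz j (fun y => (F y)^*) x)^*.
Proof.
move=> dF.
have alg (a b : C) : (a + 'i * b) / 2 = ((a^* - 'i * b^*) / 2)^*.
  by rewrite conj_half rmorphB rmorphM /= !conjCK conjCi mulNr opprK.
exact: etrans (alg _ _) (esym (congr2 (fun a b => ((a - 'i * b) / 2)^*)
  (pderJ _ dF) (pderJ _ dF))).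
Qed.

(** Pulls the constants out of [dz]; a second derivative of F then becomes a
    combination of real second derivatives. *)
Lemma pder_dz O F x v j : open O -> O x -> smoothV O F ->
  pder v (dz j F) x = (pder v (pder (dirx j) F) x - 'i * pder v (pder (diry j) F) x) / 2.
Proof.
move=> oO Ox HF.
have d1 : cdiff (pder (dirx j) F) x by exact: smoothV_cdiff (smoothV_pder _ oO HF) Ox.
have d2 : cdiff (pder (diry j) F) x by exact: smoothV_cdiff (smoothV_pder _ oO HF) Ox.
have dc z : cdiff (fun=> z) x by split; exact: differentiable_cst.
have d3 : cdiff (fun y => (- 'i) * pder (diry j) F y) x.
  apply: (smoothV_cdiff _ Ox); apply: smoothVM => //; first exact: smoothV_cst.
  exact: smoothV_pder.
have d4 : cdiff (fun y => pder (dirx j) F y + (- 'i) * pder (diry j) F y) x.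
  apply: (smoothV_cdiff _ Ox); apply: smoothVD => //; first exact: smoothV_pder.
  by apply: smoothVM => //; [exact: smoothV_cst|exact: smoothV_pder].
rewrite (_ : dz j F = fun y => (pder (dirx j) F y + (- 'i) * pder (diry j) F y) * 2^-1).
  by rewrite (pderM _ d4 (dc _)) (pderD _ d1 d3) (pderM _ (dc _) d2) !pder_cst
    mulr0 addr0 mul0r add0r mulNr.
by apply/funext => y; rewrite mulNr.
Qed.

Lemma pder_dzbar O F x v j : open O -> O x -> smoothV O F ->
  pder v (dzbar j F) x =
    (pder v (pder (dirx j) F) x + 'i * pder v (pder (diry j) F) x) / 2.
Proof.
move=> oO Ox HF.
have d1 : cdiff (pder (dirx j) F) x by exact: smoothV_cdiff (smoothV_pder _ oO HF) Ox.
have d2 : cdiff (pder (diry j) F) x by exact: smoothV_cdiff (smoothV_pder _ oO HF) Ox.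
have dc z : cdiff (fun=> z) x by split; exact: differentiable_cst.
have d3 : cdiff (fun y => 'i * pder (diry j) F y) x.
  apply: (smoothV_cdiff _ Ox); apply: smoothVM => //; first exact: smoothV_cst.
  exact: smoothV_pder.
have d4 : cdiff (fun y => pder (dirx j) F y + 'i * pder (diry j) F y) x.
  apply: (smoothV_cdiff _ Ox); apply: smoothVD => //; first exact: smoothV_pder.
  by apply: smoothVM => //; [exact: smoothV_cst|exact: smoothV_pder].
rewrite /dzbar (pderM _ d4 (dc _)) (pderD _ d1 d3) (pderM _ (dc _) d2).
by rewrite !pder_cst mulr0 addr0 mul0r add0r.
Qed.

Lemma dz_comm O F x j k : open O -> O x -> smoothV O F ->
  dz j (dz k F) x = dz k (dz j F) x.
Proof.
move=> oO Ox HF; rewrite [LHS]/dz [RHS]/dz !(pder_dz _ _ oO Ox HF).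
suff H a b c d a' b' c' d' : a = a' -> b = c' -> c = b' -> d = d' ->
  ((a - 'i * b) / 2 - 'i * ((c - 'i * d) / 2)) / 2 =
  ((a' - 'i * b') / 2 - 'i * ((c' - 'i * d') / 2)) / 2 :> C.
  by apply: H; exact: pder_comm oO Ox HF.
by move=> -> -> -> ->; field.
Qed.

Lemma dz_dzbar_comm O F x j k : open O -> O x -> smoothV O F ->
  dz j (dzbar k F) x = dzbar k (dz j F) x.
Proof.
move=> oO Ox HF; rewrite [LHS]/dz [RHS]/dzbar.
rewrite !(pder_dz _ _ oO Ox HF) !(pder_dzbar _ _ oO Ox HF).
suff H a b c d a' b' c' d' : a = a' -> b = c' -> c = b' -> d = d' ->
  ((a + 'i * b) / 2 - 'i * ((c + 'i * d) / 2)) / 2 =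
  ((a' - 'i * b') / 2 + 'i * ((c' - 'i * d') / 2)) / 2 :> C.
  by apply: H; exact: pder_comm oO Ox HF.
by move=> -> -> -> ->; field.
Qed.

Lemma pder_coordz x v j : pder v (coordz j) x = coordz j v.
Proof. by apply: eq_ReIm; [exact: derive_coordx|exact: derive_coordy]. Qed.

Lemma dz_coordz x j k : dz j (coordz k) x = (j == k)%:R.
Proof.
rewrite /dz !pder_coordz /coordz /coordx /coordy /= !mxE eqxx /= eq_sym.
rewrite (_ : Complex 0 _ = 'i * (j == k)%:R); last first.
  by rewrite -complexiE; case: eqP => _; simpc.
rewrite (_ : Complex _ 0 = (j == k)%:R); last by case: eqP.
by rewrite mulrA -expr2 sqrCi; field.
Qed.

Lemma cdiff_h h x : (forall k, cdiff (fun y => coordz k (h y)) x) -> differentiable h x.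
Proof.
by move=> H; apply: differentiable_coordwise => j; have [] := H j.
Qed.

(** With a + i b the derivative of the k-th component of h, the real chain rule
    yields a d/dx + b d/dy, and
    a d/dx + b d/dy = (a + i b) d/dz + (a - i b) d/d(conj z). *)
Lemma pder_comp G h x v :
  (forall k, cdiff (fun y => coordz k (h y)) x) -> cdiff G (h x) ->
  pder v (fun y => G (h y)) x =
    \sum_k (pder v (fun y => coordz k (h y)) x * dz k G (h x) +
            (pder v (fun y => coordz k (h y)) x)^* * dzbar k G (h x)).
Proof.
move=> /[dup] Hk /cdiff_h Hh [dr di].
have E : pder v (fun y => G (h y)) x =
  \sum_k (('D_v (fun y => coordx k (h y)) x)%:C%C * pder (dirx k) G (h x) +
          ('D_v (fun y => coordy k (h y)) x)%:C%C * pder (diry k) G (h x)).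
  apply: eq_ReIm => /=.
    rewrite (derive_comp v Hh dr) (big_morph _ cReD (erefl : Re 0 = 0)).
    apply: eq_bigr => k _; apply/esym.
    exact: etrans (cReD _ _) (congr2 +%R (cRe_real _ _) (cRe_real _ _)).
  rewrite (derive_comp v Hh di) (big_morph _ cImD (erefl : Im 0 = 0)).
  apply: eq_bigr => k _; apply/esym.
    exact: etrans (cImD _ _) (congr2 +%R (cIm_real _ _) (cIm_real _ _)).
rewrite E; apply: eq_bigr => k _.
have -> : pder v (fun y => coordz k (h y)) x =
  ('D_v (fun y => coordx k (h y)) x)%:C%C + 'i * ('D_v (fun y => coordy k (h y)) x)%:C%C.
  by rewrite -complexiE; apply: eq_ReIm; rewrite ?cReD ?cImD ?cReM ?cImM /=; ring.
move: ('D_v (fun y => coordx k (h y)) x) ('D_v (fun y => coordy k (h y)) x) => a b.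
rewrite rmorphD rmorphM /= conjCi.
have rc (c : R) : (c%:C%C)^* = c%:C%C :> C.
  by apply: eq_ReIm; rewrite ?cReJ ?cImJ //= oppr0.
rewrite !rc /dz /dzbar -/(dirx k) -/(diry k).
move: (a%:C%C) (b%:C%C) (pder (dirx k) G (h x)) (pder (diry k) G (h x)) => a' b' p q.
have i2 : 'i * 'i = -1 :> C by rewrite -expr2 sqrCi.
transitivity (a' * p - ('i * 'i) * b' * q); last by field.
by rewrite i2; ring.
Qed.

(** The Cauchy-Riemann equations for h remove the antiholomorphic terms of
    [pder_comp]. *)
Lemma dz_comp G h x j :
  (forall k, cdiff (fun y => coordz k (h y)) x) -> cdiff G (h x) ->
  (forall k, dzbar j (fun y => coordz k (h y)) x = 0) ->
  dz j (fun y => G (h y)) x = \sum_k dz j (fun y => coordz k (h y)) x * dz k G (h x).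
Proof.
move=> Hh HG Hb; rewrite {1}/dz !(pder_comp _ Hh HG) mulr_sumr -sumrB mulr_suml.
apply: eq_bigr => k _.
suff H (a b D E : C) : (a + 'i * b) / 2 = 0 ->
  (a * D + a^* * E - 'i * (b * D + b^* * E)) / 2 = (a - 'i * b) / 2 * D.
  by apply: H; exact: Hb.
move/eqP; rewrite mulf_eq0 invr_eq0 pnatr_eq0 orbF addr_eq0 => /eqP ->.
by rewrite rmorphN rmorphM /= conjCi; field.
Qed.

Lemma cdiffJ F x : cdiff F x -> cdiff (fun y => (F y)^*) x.
Proof.
move=> [d1 d2]; split.
  rewrite (_ : (fun y => Re (F y)^*) = fun y => Re (F y)) //.
  by apply/funext => y; rewrite cReJ.
rewrite (_ : (fun y => Im (F y)^*) = fun y => - Im (F y)).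
  exact: differentiableN.
by apply/funext => y; rewrite cImJ.
Qed.

Lemma dzbar_comp G h x j :
  (forall k, cdiff (fun y => coordz k (h y)) x) -> cdiff G (h x) ->
  (forall k, dzbar j (fun y => coordz k (h y)) x = 0) ->
  dzbar j (fun y => G (h y)) x =
    \sum_k (dz j (fun y => coordz k (h y)) x)^* * dzbar k G (h x).
Proof.
move=> Hh HG Hb.
have dGh : cdiff (fun y => G (h y)) x.
  have Hd := cdiff_h Hh; case: HG => d1 d2.
  split; [exact: (differentiable_comp Hd d1)|exact: (differentiable_comp Hd d2)].
rewrite dzbarE // (dz_comp (G := fun y => (G y)^*) Hh (cdiffJ HG) Hb) rmorph_sum.
by apply: eq_bigr => k _; rewrite (dzbarE _ HG); exact: rmorphM.
Qed.

(** Because [dz] and [dzbar] commute. *)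
Lemma holV_dz O F j : open O -> holV O F -> holV O (dz j F).
Proof.
move=> oO [HF H0]; split; first exact: smoothV_dz.
move=> x k Ox; rewrite -(dz_dzbar_comm _ _ oO Ox HF) -(dz_cst 0 x j).
by apply: dz_eq_on oO Ox _ => y Oy; exact: H0.
Qed.

End Wirtinger.

(** * Change of charts *)

Section Charts.
Context {R : realType} {m : nat} {M : topologicalType}.
Local Notation C := R[i].
Implicit Types (c : chart R m M) (f : M -> C) (W : set M) (p q : M).

Definition rep c f : Cspace R m -> C := fun x => f (icoord c x).
Definition img c W : set (Cspace R m) := coord c @` (dom c `&` W).
Definition pd c (j : 'I_m) f : M -> C := fun q => dz j (rep c f) (coord c q).
Definition pdbar c (j : 'I_m) f : M -> C := fun q => dzbar j (rep c f) (coord c q).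

Lemma icoordK c q : is_chart c -> dom c q -> icoord c (coord c q) = q.
Proof. by move=> [_ _ H _ _]; exact: H. Qed.

Lemma imgP c W q : dom c q -> W q -> img c W (coord c q).
Proof. by move=> cq Wq; exists q. Qed.

Lemma img_icoord c W x : is_chart c -> img c W x ->
  [/\ dom c (icoord c x), W (icoord c x) & coord c (icoord c x) = x].
Proof. by move=> cc [q [cq Wq] <-]; rewrite icoordK. Qed.

Lemma open_img c W : is_chart c -> open W -> open (img c W).
Proof.
move=> cc oW; have [od oi _ _ ci] := cc.
have -> : img c W = (coord c @` dom c) `&` icoord c @^-1` W.
  apply/seteqP; split=> x.
    by move=> [q [cq Wq] <-]; split; [exists q|rewrite /= icoordK].
  by move=> [[q cq <-]]; rewrite /= icoordK // => Wq; exists q.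
rewrite openE => x [ix Wx]; rewrite /interior; apply: filterI.
  by apply: open_nbhs_nbhs; split.
by apply: (ci x ix); apply: open_nbhs_nbhs; split.
Qed.

Lemma img_sub c W W' : W `<=` W' -> img c W `<=` img c W'.
Proof. by move=> WW x [q [cq Wq] <-]; exists q => //; split=> //; exact: WW. Qed.

Section Transition.
Variables (c c' : chart R m M).
Hypotheses (cc : is_chart c) (cc' : is_chart c') (t : hol_transition c c').

Let h (x : Cspace R m) := coord c' (icoord c x).

Lemma open_dom : open (dom c').
Proof. by have [] := cc'. Qed.

Lemma transition_smooth k : smoothV (img c (dom c')) (fun y => coordz k (h y)).
Proof. by have [H _] := t k; exact: H. Qed.

Lemma smooth_transfer W f : open W ->
  smoothV (img c' W) (rep c' f) -> smoothV (img c (dom c' `&` W)) (rep c f).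
Proof.
move=> oW H; have oO := open_img cc (openI open_dom oW).
have hO x : img c (dom c' `&` W) x -> img c' W (h x).
  by move=> /(img_icoord cc)[? [? ?] ?]; exact: imgP.
have Hh k : smoothV (img c (dom c' `&` W)) (fun y => coordz k (h y)).
  by apply: smoothV_sub (transition_smooth k); apply: img_sub => ? [].
apply: smoothV_eq oO _ (smoothV_comp oO hO Hh H) => x /(img_icoord cc)[? [? ?] _].
by rewrite /rep /h icoordK.
Qed.

Lemma transition_cdiff q : dom c q -> dom c' q ->
  forall k, cdiff (fun y => coordz k (h y)) (coord c q).
Proof.
by move=> cq c'q k; apply: smoothV_cdiff (transition_smooth k) (imgP cq c'q).
Qed.

Lemma transition_dzbar q : dom c q -> dom c' q ->
  forall j k, dzbar j (fun y => coordz k (h y)) (coord c q) = 0.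
Proof. by move=> cq c'q j k; have [_ H] := t k; apply: H; exact: imgP. Qed.

Lemma hcoord q : dom c q -> h (coord c q) = coord c' q.
Proof. by move=> cq; rewrite /h icoordK. Qed.

Lemma rep_transition W f q : open W -> W q -> dom c q -> dom c' q ->
  forall y, img c (dom c' `&` W) y -> rep c f y = rep c' f (h y).
Proof.
by move=> oW Wq cq c'q y /(img_icoord cc)[? [? ?] _]; rewrite /rep /h icoordK.
Qed.

(** The chain rule for the change of coordinates, which is holomorphic. *)
Lemma pd_transfer W f q j : open W -> W q -> dom c q -> dom c' q ->
  smoothV (img c' W) (rep c' f) ->
  pd c j f q = \sum_k pd c j (zc c' k) q * pd c' k f q.
Proof.
move=> oW Wq cq c'q H; have oO := open_img cc (openI open_dom oW).
have Oq : img c (dom c' `&` W) (coord c q) by apply: imgP.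
rewrite {1}/pd (dz_eq_on _ oO Oq (rep_transition f oW Wq cq c'q)).
have Hd : cdiff (rep c' f) (h (coord c q)).
  by rewrite hcoord //; apply: smoothV_cdiff H _; exact: imgP.
rewrite (dz_comp (transition_cdiff cq c'q) Hd (transition_dzbar cq c'q j)).
by rewrite hcoord.
Qed.

Lemma pdbar_transfer W f q j : open W -> W q -> dom c q -> dom c' q ->
  smoothV (img c' W) (rep c' f) ->
  pdbar c j f q = \sum_k (pd c j (zc c' k) q)^* * pdbar c' k f q.
Proof.
move=> oW Wq cq c'q H; have oO := open_img cc (openI open_dom oW).
have Oq : img c (dom c' `&` W) (coord c q) by apply: imgP.
rewrite {1}/pdbar (dzbar_eq_on _ oO Oq (rep_transition f oW Wq cq c'q)).
have Hd : cdiff (rep c' f) (h (coord c q)).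
  by rewrite hcoord //; apply: smoothV_cdiff H _; exact: imgP.
rewrite (dzbar_comp (transition_cdiff cq c'q) Hd (transition_dzbar cq c'q j)).
by rewrite hcoord.
Qed.

Lemma hol_transfer W f : open W ->
  holV (img c' W) (rep c' f) -> holV (img c (dom c' `&` W)) (rep c f).
Proof.
move=> oW [H H0]; split; first exact: smooth_transfer.
move=> _ j [q [cq [c'q Wq]] <-].
rewrite -[LHS]/(pdbar c j f q) (pdbar_transfer _ oW Wq cq c'q H).
by apply: big1 => k _; rewrite /pdbar H0 ?mulr0 //; exact: imgP.
Qed.

End Transition.

End Charts.

(** * Smooth and holomorphic functions on a complex manifold *)

Section SmoothFunctions.
Context {R : realType} {m : nat} {M : complex_manifold R m}.
Local Notation C := R[i].
Local Notation T := 'rV[R[i]]_m.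
Implicit Types (c : chart R m M) (f g : M -> C) (W : set M) (p q : M) (v w : T).

Lemma hol_chart_at p : hol_chart (chart_at p).
Proof. by split=> [|q]; [exact: chart_at_is_chart|split; exact: chart_at_transition]. Qed.

Lemma hol_chart_is_chart c : hol_chart c -> is_chart c. Proof. by case. Qed.
Lemma open_dom_hol c : hol_chart c -> open (dom c). Proof. by move=> [[]]. Qed.

Lemma chart_atK q : icoord (chart_at q) (coord (chart_at q) q) = q.
Proof. by apply: icoordK; [exact: chart_at_is_chart|exact: chart_at_dom]. Qed.

Lemma img_at q W : W q -> img (chart_at q) W (coord (chart_at q) q).
Proof. by move=> Wq; apply: imgP => //; exact: chart_at_dom. Qed.

Lemma open_img_at q W : open W -> open (img (chart_at q) W).
Proof. by apply: open_img; exact: chart_at_is_chart. Qed.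

Lemma img_cap_sub c c' W p : is_chart c ->
  img c W `&` img c (dom c') `<=` img c (dom c' `&` W).
Proof.
move=> cc x [[q [cq Wq] <-]] [q' [cq' c'q'] E]; exists q => //; split=> //; split=> //.
by rewrite -(icoordK cc cq) -E icoordK.
Qed.

(** Smoothness is defined with the charts [chart_at q] only.  Near the image of p,
    the transition from c to [chart_at p] carries it over to c. *)
Lemma smooth_on_rep c W f : hol_chart c -> open W -> smooth_on W f ->
  smoothV (img c W) (rep c f).
Proof.
move=> [cc ct] oW H; apply: smoothV_local => x [p [cp Wp] <-].
exists (img c (dom (chart_at p))); first by apply: imgP => //; exact: chart_at_dom.
apply: smoothV_sub (img_cap_sub p cc) _.
by apply: (smooth_transfer cc (chart_at_is_chart p) (ct p).1 oW); exact: H.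
Qed.

(** Conversely a single holomorphic chart whose domain contains W is enough. *)
Lemma rep_smooth_on c W f : hol_chart c -> open W -> W `<=` dom c ->
  smoothV (img c W) (rep c f) -> smooth_on W f.
Proof.
move=> [cc ct] oW Wc H q.
have := smooth_transfer (chart_at_is_chart q) cc (ct q).2 oW H.
by apply: smoothV_sub; apply: img_sub => p Wp; split => //; exact: Wc.
Qed.

Lemma rep_hol_on c W f : hol_chart c -> open W -> W `<=` dom c ->
  holV (img c W) (rep c f) -> hol_on W f.
Proof.
move=> [cc ct] oW Wc H q.
have [H1 H2] := hol_transfer (chart_at_is_chart q) cc (ct q).2 oW H.
have sub : img (chart_at q) W `<=` img (chart_at q) (dom c `&` W).
  by apply: img_sub => p Wp; split => //; exact: Wc.
by split=> [|x j /sub]; [exact: smoothV_sub sub H1|exact: H2].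
Qed.

Lemma hol_on_smooth W f : hol_on W f -> smooth_on W f.
Proof. by move=> H q; have [] := H q. Qed.

Lemma hol_on_rep c W f : hol_chart c -> open W -> hol_on W f ->
  holV (img c W) (rep c f).
Proof.
move=> hc oW H; split; first exact: smooth_on_rep hc oW (hol_on_smooth H).
move=> x j [p [cp Wp] <-]; have [cc ct] := hc.
have [_ H0] := hol_transfer cc (chart_at_is_chart p) (ct p).1 oW (H p).
by apply: H0; apply: imgP => //; split => //; exact: chart_at_dom.
Qed.

Lemma smooth_on_sub W W' f : W' `<=` W -> smooth_on W f -> smooth_on W' f.
Proof. by move=> sW H q; apply: smoothV_sub (img_sub sW) (H q). Qed.

Lemma hol_on_sub W W' f : W' `<=` W -> hol_on W f -> hol_on W' f.
Proof.
move=> sW H q; have [H1 H2] := H q.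
by split=> [|x j /(img_sub sW)]; [exact: smoothV_sub (img_sub sW) H1|exact: H2].
Qed.

(** Smoothness may therefore be verified near each point, in a chart adapted to
    that point. *)
Lemma smooth_on_local W f :
  (forall p, W p -> exists2 W' : set M, W' p & smooth_on (W `&` W') f) ->
  smooth_on W f.
Proof.
move=> H q; apply: smoothV_local => x [p [qp Wp] <-].
have [W' W'p H'] := H p Wp.
exists (img (chart_at q) W'); first exact: imgP.
apply: smoothV_sub (H' q) => y [[p1 [q1 W1] <-]] [p2 [q2 W2] E].
exists p1 => //; split=> //; split=> //.
have cc := chart_at_is_chart q.
by rewrite -(icoordK cc q1) -E icoordK.
Qed.

Lemma rep_eq_on c W f g : is_chart c -> (forall p, W p -> f p = g p) ->
  forall x, img c W x -> rep c f x = rep c g x.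
Proof. by move=> cc fg x /(img_icoord cc)[_ Wx _]; exact: fg. Qed.

Lemma smooth_on_eq W f g : open W -> (forall p, W p -> f p = g p) ->
  smooth_on W f -> smooth_on W g.
Proof.
move=> oW fg H q.
exact: smoothV_eq (open_img_at oW) (rep_eq_on (chart_at_is_chart q) fg) (H q).
Qed.

Lemma hol_on_eq W f g : open W -> (forall p, W p -> f p = g p) ->
  hol_on W f -> hol_on W g.
Proof.
move=> oW fg H q; have [H1 H2] := H q; split.
  exact: smoothV_eq (open_img_at oW) (rep_eq_on (chart_at_is_chart q) fg) H1.
move=> x j Wx; rewrite -(H2 x j Wx); apply: dzbar_eq_on (open_img_at oW) Wx _.
by move=> y Wy; apply/esym; exact: (rep_eq_on (chart_at_is_chart q) fg Wy).
Qed.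

Lemma smooth_on_cst W (z : C) : smooth_on W (fun=> z).
Proof. by move=> q; exact: smoothV_cst. Qed.

Lemma smooth_onD W f g : open W -> smooth_on W f -> smooth_on W g ->
  smooth_on W (fun p => f p + g p).
Proof. by move=> oW Hf Hg q; exact: smoothVD (open_img_at oW) (Hf q) (Hg q). Qed.

Lemma smooth_onM W f g : open W -> smooth_on W f -> smooth_on W g ->
  smooth_on W (fun p => f p * g p).
Proof. by move=> oW Hf Hg q; exact: smoothVM (open_img_at oW) (Hf q) (Hg q). Qed.

Lemma smooth_onJ W f : open W -> smooth_on W f -> smooth_on W (fun p => (f p)^*).
Proof. by move=> oW Hf q; exact: smoothVJ (open_img_at oW) (Hf q). Qed.

Lemma smooth_on_sum W n (f : 'I_n -> M -> C) : open W ->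
  (forall i, smooth_on W (f i)) -> smooth_on W (fun p => \sum_i f i p).
Proof.
move=> oW Hf q; apply: (smoothV_sum (F := fun i => rep _ (f i)) (open_img_at oW)).
by move=> i; exact: Hf.
Qed.

Lemma rep_neq0 c W f : is_chart c -> (forall p, W p -> f p != 0) ->
  forall x, img c W x -> rep c f x != 0.
Proof. by move=> cc H x /(img_icoord cc)[_ /H]. Qed.

Lemma smooth_onV W f : open W -> (forall p, W p -> f p != 0) ->
  smooth_on W f -> smooth_on W (fun p => (f p)^-1).
Proof.
move=> oW f0 Hf q.
exact: smoothVV (open_img_at oW) (rep_neq0 (chart_at_is_chart q) f0) (Hf q).
Qed.

Lemma smooth_on_norm W f : open W -> (forall p, W p -> f p != 0) ->
  smooth_on W f -> smooth_on W (fun p => `|f p|).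
Proof.
move=> oW f0 Hf q.
exact: smoothV_norm (open_img_at oW) (rep_neq0 (chart_at_is_chart q) f0) (Hf q).
Qed.

Lemma smooth_on_pd c W f j : hol_chart c -> open W -> W `<=` dom c ->
  smooth_on W f -> smooth_on W (pd c j f).
Proof.
move=> hc oW Wc H; have cc := hol_chart_is_chart hc.
apply: (rep_smooth_on hc oW Wc).
apply: smoothV_eq (open_img cc oW) _
  (smoothV_dz j (open_img cc oW) (smooth_on_rep hc oW H)).
by move=> x /(img_icoord cc)[_ _ E]; rewrite [RHS]/rep /pd E.
Qed.

Lemma smooth_on_pdbar c W f j : hol_chart c -> open W -> W `<=` dom c ->
  smooth_on W f -> smooth_on W (pdbar c j f).
Proof.
move=> hc oW Wc H; have cc := hol_chart_is_chart hc.
apply: (rep_smooth_on hc oW Wc).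
apply: smoothV_eq (open_img cc oW) _
  (smoothV_dzbar j (open_img cc oW) (smooth_on_rep hc oW H)).
by move=> x /(img_icoord cc)[_ _ E]; rewrite [RHS]/rep /pdbar E.
Qed.

Lemma hol_on_pd c W f j : hol_chart c -> open W -> W `<=` dom c ->
  hol_on W f -> hol_on W (pd c j f).
Proof.
move=> hc oW Wc H; have cc := hol_chart_is_chart hc.
have oO := open_img cc oW; apply: (rep_hol_on hc oW Wc).
have [H1 H2] := holV_dz j oO (hol_on_rep hc oW H).
have E x : img c W x -> dz j (rep c f) x = rep c (pd c j f) x.
  by move=> /(img_icoord cc)[_ _ E]; rewrite [RHS]/rep /pd E.
split; first exact: smoothV_eq oO E H1.
move=> x k Wx; rewrite -(H2 x k Wx); apply: dzbar_eq_on oO Wx _ => y Wy.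
by rewrite E.
Qed.

Lemma hol_on_zc c j : hol_chart c -> hol_on (dom c) (zc c j).
Proof. by move=> [_ ct] q; exact: (ct q).2. Qed.

Lemma pd_comm c W f j k q : hol_chart c -> open W -> W `<=` dom c -> W q ->
  smooth_on W f -> pd c j (pd c k f) q = pd c k (pd c j f) q.
Proof.
move=> hc oW Wc Wq H; have cc := hol_chart_is_chart hc.
have oO := open_img cc oW; have Oq : img c W (coord c q) by apply: imgP => //; exact: Wc.
have E i x : img c W x -> rep c (pd c i f) x = dz i (rep c f) x.
  by move=> /(img_icoord cc)[_ _ E]; rewrite [LHS]/rep /pd E.
rewrite /pd [LHS](dz_eq_on _ oO Oq (E k)) [RHS](dz_eq_on _ oO Oq (E j)).
exact: dz_comm oO Oq (smooth_on_rep hc oW H).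
Qed.

Lemma pd_pdbar_comm c W f j k q : hol_chart c -> open W -> W `<=` dom c -> W q ->
  smooth_on W f -> pd c j (pdbar c k f) q = pdbar c k (pd c j f) q.
Proof.
move=> hc oW Wc Wq H; have cc := hol_chart_is_chart hc.
have oO := open_img cc oW; have Oq : img c W (coord c q) by apply: imgP => //; exact: Wc.
have E1 x : img c W x -> rep c (pd c j f) x = dz j (rep c f) x.
  by move=> /(img_icoord cc)[_ _ E]; rewrite [LHS]/rep /pd E.
have E2 x : img c W x -> rep c (pdbar c k f) x = dzbar k (rep c f) x.
  by move=> /(img_icoord cc)[_ _ E]; rewrite [LHS]/rep /pdbar E.
rewrite [LHS]/pd [RHS]/pdbar (dz_eq_on _ oO Oq E2) (dzbar_eq_on _ oO Oq E1).
exact: dz_dzbar_comm oO Oq (smooth_on_rep hc oW H).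
Qed.

Lemma pd_zc c j k q : hol_chart c -> dom c q -> pd c j (zc c k) q = (j == k)%:R.
Proof.
move=> hc cq; have cc := hol_chart_is_chart hc; have oc := open_dom_hol hc.
rewrite /pd -(dz_coordz (coord c q) j k).
apply: dz_eq_on (open_img cc oc) (imgP cq cq) _ => x /(img_icoord cc)[_ _ E].
by rewrite /rep /zc E.
Qed.

End SmoothFunctions.

(** * Derivatives along tangent vectors, and coordinate frames *)

Section Derivations.
Context {R : realType} {m : nat} {M : complex_manifold R m}.
Local Notation C := R[i].
Local Notation T := 'rV[R[i]]_m.
Implicit Types (c : chart R m M) (f g : M -> C) (W : set M) (p q : M) (v w : T).

Lemma delE q v f : del q v f = \sum_j v 0 j * pd (chart_at q) j f q.
Proof. by []. Qed.

Lemma delbar_def q v f : delbar q v f = \sum_j (v 0 j)^* * pdbar (chart_at q) j f q.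
Proof. by []. Qed.

Lemma del_linear q (a : C) v w f :
  del q (a *: v + w) f = a * del q v f + del q w f.
Proof.
rewrite !delE mulr_sumr -big_split; apply: eq_bigr => j _ /=.
by rewrite !mxE mulrDl mulrA.
Qed.

Lemma del0 q f : del q 0 f = 0.
Proof. by rewrite delE big1 // => j _; rewrite mxE mul0r. Qed.

Lemma delDl q v w f : del q (v + w) f = del q v f + del q w f.
Proof. by have := del_linear q 1 v w f; rewrite scale1r mul1r. Qed.

Lemma delZl q a v f : del q (a *: v) f = a * del q v f.
Proof. by have := del_linear q a v 0 f; rewrite addr0 del0 addr0. Qed.

Lemma delNl q v f : del q (- v) f = - del q v f.
Proof. by rewrite -scaleN1r delZl mulN1r. Qed.

Lemma del_suml q n (v : 'I_n -> T) f : del q (\sum_i v i) f = \sum_i del q (v i) f.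
Proof. by elim/big_ind2: _ => [|a b d e <- <-|//]; [exact: del0|exact: delDl]. Qed.

Lemma rep_cdiff W f q : open W -> W q -> smooth_on W f ->
  cdiff (rep (chart_at q) f) (coord (chart_at q) q).
Proof. by move=> oW Wq H; apply: smoothV_cdiff (H q) _; exact: img_at. Qed.

Lemma del_eq_on W f g q v : open W -> W q -> (forall p, W p -> f p = g p) ->
  del q v f = del q v g.
Proof.
move=> oW Wq fg; apply: eq_bigr => j _; congr (_ * _).
exact: dz_eq_on (open_img_at oW) (img_at Wq) (rep_eq_on (chart_at_is_chart q) fg).
Qed.

Lemma delbar_eq_on W f g q v : open W -> W q -> (forall p, W p -> f p = g p) ->
  delbar q v f = delbar q v g.
Proof.
move=> oW Wq fg; apply: eq_bigr => j _; congr (_ * _).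
exact: dzbar_eq_on (open_img_at oW) (img_at Wq) (rep_eq_on (chart_at_is_chart q) fg).
Qed.

Lemma del_cst q v (z : C) : del q v (fun=> z) = 0.
Proof. by rewrite delE big1 // => j _; rewrite /pd dz_cst mulr0. Qed.

Section Leibniz.
Variables (W : set M) (q : M) (v : T).
Hypotheses (oW : open W) (Wq : W q).

Lemma delD f g : smooth_on W f -> smooth_on W g ->
  del q v (fun p => f p + g p) = del q v f + del q v g.
Proof.
move=> Hf Hg; rewrite !delE -big_split; apply: eq_bigr => j _ /=.
rewrite -mulrDr; congr (_ * _).
exact: dzD (rep_cdiff oW Wq Hf) (rep_cdiff oW Wq Hg).
Qed.

Lemma delM f g : smooth_on W f -> smooth_on W g ->
  del q v (fun p => f p * g p) = del q v f * g q + f q * del q v g.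
Proof.
move=> Hf Hg; rewrite !delE mulr_suml mulr_sumr -big_split; apply: eq_bigr => j _ /=.
have -> : pd (chart_at q) j (fun p => f p * g p) q =
    pd (chart_at q) j f q * g q + f q * pd (chart_at q) j g q.
  rewrite [LHS](dzM _ (rep_cdiff oW Wq Hf) (rep_cdiff oW Wq Hg)).
  by rewrite {2 3}/rep chart_atK.
by rewrite mulrDr mulrA; congr (_ + _); exact: mulrCA.
Qed.

Lemma del_sum n (f : 'I_n -> M -> C) : (forall i, smooth_on W (f i)) ->
  del q v (fun p => \sum_i f i p) = \sum_i del q v (f i).
Proof.
move=> Hf.
have E (r : seq 'I_n) : del q v (fun p => \sum_(i <- r) f i p) = \sum_(i <- r) del q v (f i).
  elim: r => [|i r IH].
    rewrite big_nil -[RHS](del_cst q v 0); congr del; apply/funext => p.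
    by rewrite big_nil.
  have -> : (fun p => \sum_(k <- i :: r) f k p) =
      fun p => f i p + \sum_(k <- r) f k p by apply/funext => p; rewrite big_cons.
  rewrite big_cons -IH; apply: (delD (Hf i)).
  have -> : (fun p => \sum_(k <- r) f k p) = \sum_(k <- r) f k.
    by apply/funext => p; rewrite fct_sumE.
  elim/big_ind: _ => [|g h Hg Hh|k _]; [exact: smooth_on_cst| |exact: Hf].
  exact: smooth_onD.
exact: E.
Qed.

(** The (0,1)-derivative is conjugate to the (1,0)-derivative; this transfers
    every rule for [del] to [delbar]. *)
Lemma delbarE f : smooth_on W f -> delbar q v f = (del q v (fun p => (f p)^*))^*.
Proof.
move=> Hf; rewrite delE rmorph_sum; apply: eq_bigr => j _.
rewrite rmorphM /=; congr (_ * _).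
exact: dzbarE (rep_cdiff oW Wq Hf).
Qed.

Lemma delJ f : smooth_on W f -> del q v (fun p => (f p)^*) = (delbar q v f)^*.
Proof. by move=> Hf; rewrite delbarE // conjCK. Qed.

Lemma delbarJ f : smooth_on W f -> delbar q v (fun p => (f p)^*) = (del q v f)^*.
Proof.
move=> Hf; rewrite delbarE; last exact: smooth_onJ.
by congr (del _ _ _)^*; apply/funext => p; rewrite conjCK.
Qed.

Lemma delbar_cst (z : C) : delbar q v (fun=> z) = 0.
Proof. by rewrite delbarE ?del_cst ?rmorph0 //; exact: smooth_on_cst. Qed.

Lemma delbarD f g : smooth_on W f -> smooth_on W g ->
  delbar q v (fun p => f p + g p) = delbar q v f + delbar q v g.
Proof.
move=> Hf Hg; have Hf' := smooth_onJ oW Hf; have Hg' := smooth_onJ oW Hg.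
apply: etrans (delbarE (smooth_onD oW Hf Hg)) _.
have -> : (fun p => (f p + g p)^*) = fun p => (f p)^* + (g p)^*.
  by apply/funext => p; rewrite rmorphD.
rewrite (delD Hf' Hg') rmorphD.
exact/esym/(congr2 +%R (delbarE Hf) (delbarE Hg)).
Qed.

Lemma delbarM f g : smooth_on W f -> smooth_on W g ->
  delbar q v (fun p => f p * g p) = delbar q v f * g q + f q * delbar q v g.
Proof.
move=> Hf Hg; have Hf' := smooth_onJ oW Hf; have Hg' := smooth_onJ oW Hg.
apply: etrans (delbarE (smooth_onM oW Hf Hg)) _.
have -> : (fun p => (f p * g p)^*) = fun p => (f p)^* * (g p)^*.
  by apply/funext => p; rewrite rmorphM.
rewrite (delM Hf' Hg').
have alg (a b c d : C) : (a * d^* + c^* * b)^* = a^* * d + c * b^*.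
  by rewrite rmorphD !rmorphM /= !conjCK.
apply: etrans (alg _ _ _ _) _.
exact/esym/(congr2 (fun a b => a * g q + f q * b) (delbarE Hf) (delbarE Hg)).
Qed.

Lemma delbar_sum n (f : 'I_n -> M -> C) : (forall i, smooth_on W (f i)) ->
  delbar q v (fun p => \sum_i f i p) = \sum_i delbar q v (f i).
Proof.
move=> Hf; rewrite delbarE; last exact: smooth_on_sum.
have -> : (fun p => (\sum_i f i p)^*) = fun p => \sum_i (f i p)^*.
  by apply/funext => p; rewrite rmorph_sum.
rewrite (del_sum (f := fun i p => (f i p)^*)); last by move=> i; exact: smooth_onJ.
by rewrite rmorph_sum; apply: eq_bigr => i _; rewrite delJ //= conjCK.
Qed.

Lemma delbar_hol f : hol_on W f -> delbar q v f = 0.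
Proof.
move=> Hf; rewrite delbar_def big1 // => j _.
by have [_ H0] := Hf q; rewrite /pdbar H0 ?mulr0 //; exact: img_at.
Qed.

Lemma del_conj_hol f : hol_on W f -> del q v (fun p => (f p)^*) = 0.
Proof.
by move=> Hf; rewrite delJ ?delbar_hol ?rmorph0 //; exact: hol_on_smooth.
Qed.

(** The expansion of v in the frame of an arbitrary holomorphic chart, its
    coefficients being the derivatives of the coordinates. *)
Lemma del_chart c f : hol_chart c -> dom c q -> smooth_on W f ->
  del q v f = \sum_k del q v (zc c k) * pd c k f q.
Proof.
move=> [cc ct] cq Hf; rewrite delE.
have Hc : smoothV (img c W) (rep c f) by exact: smooth_on_rep.
transitivity (\sum_j \sum_k v 0 j * (pd (chart_at q) j (zc c k) q * pd c k f q)).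
  apply: eq_bigr => j _; rewrite -mulr_sumr; congr (_ * _).
  exact: (pd_transfer (chart_at_is_chart q) cc (ct q).2 j oW Wq (chart_at_dom q) cq Hc).
rewrite exchange_big; apply: eq_bigr => k _ /=; rewrite delE mulr_suml.
by apply: eq_bigr => j _; rewrite mulrA.
Qed.

Lemma delbar_chart c f : hol_chart c -> dom c q -> smooth_on W f ->
  delbar q v f = \sum_k (del q v (zc c k))^* * pdbar c k f q.
Proof.
move=> [cc ct] cq Hf; rewrite delbar_def.
have Hc : smoothV (img c W) (rep c f) by exact: smooth_on_rep.
transitivity (\sum_j \sum_k (v 0 j)^* * ((pd (chart_at q) j (zc c k) q)^* * pdbar c k f q)).
  apply: eq_bigr => j _; rewrite -mulr_sumr; congr (_ * _).
  exact: (pdbar_transfer (chart_at_is_chart q) cc (ct q).2 j oW Wq (chart_at_dom q) cq Hc).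
rewrite exchange_big; apply: eq_bigr => k _ /=; rewrite delE rmorph_sum mulr_suml.
apply: eq_bigr => j _; rewrite mulrA; congr (_ * _); apply/esym; exact: rmorphM.
Qed.

Lemma del_frame c a f : hol_chart c -> dom c q -> smooth_on W f ->
  del q (frame c a q) f = pd c a f q.
Proof.
move=> [cc ct] cq Hf; rewrite delE.
rewrite (pd_transfer cc (chart_at_is_chart q) (ct q).1 a oW Wq cq (chart_at_dom q) (Hf q)).
by apply: eq_bigr => j _; rewrite mxE.
Qed.

End Leibniz.

Lemma zc_smooth c b : hol_chart c -> smooth_on (dom c) (zc c b).
Proof. by move=> hc; apply/hol_on_smooth/hol_on_zc. Qed.

Lemma del_frame_zc c a b q : hol_chart c -> dom c q ->
  del q (frame c a q) (zc c b) = (a == b)%:R.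
Proof.
move=> hc cq; rewrite (del_frame (open_dom_hol hc) cq) ?pd_zc //.
exact: zc_smooth.
Qed.

(** Applying [del_chart] to the coordinates of the preferred chart at q recovers
    the entries of v. *)
Lemma frame_basis c q v : hol_chart c -> dom c q ->
  v = \sum_a del q v (zc c a) *: frame c a q.
Proof.
move=> hc cq; apply/rowP => j.
have o1 := open_dom_hol hc; have h' := hol_chart_at q.
have o2 := open_dom_hol h'; have cq' := chart_at_dom q.
have -> : v 0 j = del q v (zc (chart_at q) j).
  rewrite delE (bigD1 j) //= pd_zc // eqxx mulr1 big1 ?addr0 // => k kj.
  by rewrite pd_zc // (negbTE kj) mulr0.
rewrite summxE (del_chart v o2 cq' hc cq (zc_smooth j h')).
by apply: eq_bigr => a _; rewrite !mxE.
Qed.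

Lemma frame_coord c q (x : 'I_m -> C) b : hol_chart c -> dom c q ->
  del q (\sum_a x a *: frame c a q) (zc c b) = x b.
Proof.
move=> hc cq.
have E a : del q (x a *: frame c a q) (zc c b) = x a * (a == b)%:R.
  by rewrite delZl (del_frame_zc a b hc cq).
rewrite del_suml (eq_bigr _ (fun a _ => E a)) (bigD1 b) // eqxx mulr1 big1.
  exact: addr0.
by move=> a /negbTE ->; rewrite mulr0.
Qed.

Lemma frame_inj c q v w : hol_chart c -> dom c q ->
  (forall b, del q v (zc c b) = del q w (zc c b)) -> v = w.
Proof.
move=> hc cq H; rewrite (frame_basis v hc cq) (frame_basis w hc cq).
by apply: eq_bigr => a _; rewrite H.
Qed.

End Derivations.

(** * Vector fields, brackets and the operator dbar *)

Section Fields.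
Context {R : realType} {m : nat} {M : complex_manifold R m}.
Local Notation C := R[i].
Local Notation T := 'rV[R[i]]_m.
Local Notation field := (M -> 'rV[R[i]]_m).
Implicit Types (c : chart R m M) (f g : M -> C) (W : set M) (p q : M) (v w : T).
Implicit Types (X Y Z : field).

Lemma component_frame c a b q : hol_chart c -> dom c q ->
  component c b (frame c a) q = (a == b)%:R.
Proof. exact: del_frame_zc. Qed.

Lemma hol_on_cst W (z : C) : hol_on W (fun=> z).
Proof.
move=> q; split=> [|x j _]; first exact: smoothV_cst.
by rewrite /dzbar !pder_cst mulr0 addr0 mul0r.
Qed.

(** A function annihilated by all (0,1)-vectors satisfies the Cauchy-Riemann
    equations in each chart: take the frame vectors of that chart. *)
Lemma holP W f : open W -> smooth_on W f ->
  (forall q v, W q -> delbar q v f = 0) -> hol_on W f.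
Proof.
move=> oW Hf H q; split=> [|_ j [p [qp Wp] <-]]; first exact: Hf.
have hq := hol_chart_at q.
have := delbar_chart (frame (chart_at q) j p) oW Wp hq qp Hf.
rewrite (H _ _ Wp) (bigD1 j) //= big1 => [|k kj]; last first.
  by rewrite del_frame_zc // eq_sym (negbTE kj) rmorph0 mul0r.
rewrite del_frame_zc // eqxx rmorph1 mul1r addr0 => /esym; exact.
Qed.

Lemma hol_onD W f g : open W -> hol_on W f -> hol_on W g ->
  hol_on W (fun p => f p + g p).
Proof.
move=> oW Hf Hg; have sf := hol_on_smooth Hf; have sg := hol_on_smooth Hg.
apply: (holP oW) => [|q v Wq]; first exact: smooth_onD.
by rewrite (delbarD v oW Wq sf sg) !(delbar_hol v Wq) // addr0.
Qed.

Lemma hol_onM W f g : open W -> hol_on W f -> hol_on W g ->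
  hol_on W (fun p => f p * g p).
Proof.
move=> oW Hf Hg; have sf := hol_on_smooth Hf; have sg := hol_on_smooth Hg.
apply: (holP oW) => [|q v Wq]; first exact: smooth_onM.
by rewrite (delbarM v oW Wq sf sg) !(delbar_hol v Wq) // mulr0 mul0r addr0.
Qed.

Lemma hol_on_sum W n (f : 'I_n -> M -> C) : open W ->
  (forall i, hol_on W (f i)) -> hol_on W (fun p => \sum_i f i p).
Proof.
move=> oW Hf.
have -> : (fun p => \sum_i f i p) = \sum_i f i by apply/funext => p; rewrite fct_sumE.
elim/big_ind: _ => [|f1 f2 H1 H2|i _]; [exact: hol_on_cst|exact: hol_onD|exact: Hf].
Qed.

Lemma hol_on_local W f :
  (forall p, W p -> exists2 W' : set M, W' p & hol_on (W `&` W') f) -> hol_on W f.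
Proof.
move=> H q; split.
  apply: smooth_on_local => p Wp; have [W' W'p H'] := H p Wp; exists W' => //.
  exact: hol_on_smooth.
move=> _ j [p [qp Wp] <-]; have [W' W'p H'] := H p Wp.
by have [_ H0] := H' q; apply: H0; exact: imgP.
Qed.

(** The components in two charts differ by the Jacobian matrix of the change of
    coordinates, which is holomorphic ([zc_pd_hol]). *)
Lemma component_change c c' X q b : hol_chart c -> hol_chart c' ->
  dom c q -> dom c' q ->
  component c' b X q = \sum_k component c k X q * pd c k (zc c' b) q.
Proof.
move=> hc hc' cq c'q.
exact: (del_chart _ (open_dom_hol hc') c'q hc cq (zc_smooth b hc')).
Qed.

Lemma zc_pd_hol c c' W k b : hol_chart c -> hol_chart c' -> open W ->
  W `<=` dom c `&` dom c' -> hol_on W (pd c k (zc c' b)).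
Proof.
move=> hc hc' oW Wc; apply: hol_on_pd => //; first by move=> p /Wc[].
by apply: hol_on_sub (hol_on_zc b hc') => p /Wc[].
Qed.

Lemma component_smooth_change c c' W X b : hol_chart c -> hol_chart c' ->
  open W -> W `<=` dom c `&` dom c' ->
  (forall k, smooth_on W (component c k X)) -> smooth_on W (component c' b X).
Proof.
move=> hc hc' oW Wc H.
have E q : W q -> \sum_k component c k X q * pd c k (zc c' b) q = component c' b X q.
  by move=> /Wc[cq c'q]; rewrite -component_change.
apply: (smooth_on_eq oW E); apply: smooth_on_sum => // k; apply: smooth_onM => //.
exact: hol_on_smooth (zc_pd_hol _ _ hc hc' oW Wc).
Qed.

Lemma component_hol_change c c' W X b : hol_chart c -> hol_chart c' ->
  open W -> W `<=` dom c `&` dom c' ->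
  (forall k, hol_on W (component c k X)) -> hol_on W (component c' b X).
Proof.
move=> hc hc' oW Wc H.
have E q : W q -> \sum_k component c k X q * pd c k (zc c' b) q = component c' b X q.
  by move=> /Wc[cq c'q]; rewrite -component_change.
apply: (hol_on_eq oW E); apply: hol_on_sum => // k; apply: hol_onM => //.
exact: zc_pd_hol.
Qed.

Lemma smooth_field_component c W X b : hol_chart c -> open W -> W `<=` dom c ->
  smooth_field W X -> smooth_on W (component c b X).
Proof.
move=> hc oW Wc H; apply: smooth_on_local => p Wp.
exists (dom (chart_at p)); first exact: chart_at_dom.
have o := open_dom_hol (hol_chart_at p).
apply: (component_smooth_change _ (hol_chart_at p) hc); first exact: openI.
  by move=> q [Wq pq]; split => //; exact: Wc.
by move=> k; exact: H.
Qed.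

Lemma component_smooth_field c W X : hol_chart c -> open W -> W `<=` dom c ->
  (forall b, smooth_on W (component c b X)) -> smooth_field W X.
Proof.
move=> hc oW Wc H q j; have o := open_dom_hol (hol_chart_at q).
apply: (component_smooth_change _ hc (hol_chart_at q)); first exact: openI.
  by move=> p [Wp qp]; split => //; exact: Wc.
by move=> k; apply: smooth_on_sub (H k) => p [].
Qed.

Lemma hol_field_component c W X b : hol_chart c -> open W -> W `<=` dom c ->
  hol_field W X -> hol_on W (component c b X).
Proof.
move=> hc oW Wc H; apply: hol_on_local => p Wp.
exists (dom (chart_at p)); first exact: chart_at_dom.
have o := open_dom_hol (hol_chart_at p).
apply: (component_hol_change _ (hol_chart_at p) hc); first exact: openI.
  by move=> q [Wq pq]; split => //; exact: Wc.
by move=> k; exact: H.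
Qed.

Lemma component_hol_field c W X : hol_chart c -> open W -> W `<=` dom c ->
  (forall b, hol_on W (component c b X)) -> hol_field W X.
Proof.
move=> hc oW Wc H q j; have o := open_dom_hol (hol_chart_at q).
apply: (component_hol_change _ hc (hol_chart_at q)); first exact: openI.
  by move=> p [Wp qp]; split => //; exact: Wc.
by move=> k; apply: hol_on_sub (H k) => p [].
Qed.

Lemma hol_field_smooth W X : hol_field W X -> smooth_field W X.
Proof. by move=> H q j; exact: hol_on_smooth. Qed.

Lemma smooth_field_sub W W' X : W' `<=` W -> smooth_field W X -> smooth_field W' X.
Proof. by move=> sW H q j; apply: smooth_on_sub (H q j) => p []; split => //; exact: sW. Qed.

Lemma hol_field_sub W W' X : W' `<=` W -> hol_field W X -> hol_field W' X.
Proof. by move=> sW H q j; apply: hol_on_sub (H q j) => p []; split => //; exact: sW. Qed.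

Lemma smooth_field_local W X :
  (forall p, W p -> exists2 W' : set M, W' p & smooth_field (W `&` W') X) ->
  smooth_field W X.
Proof.
move=> H q j; apply: smooth_on_local => p [Wp qp].
have [W' W'p H'] := H p Wp; exists W' => //.
by apply: smooth_on_sub (H' q j) => p' [[]].
Qed.

Lemma smooth_field_eq W X Y : open W -> (forall p, W p -> X p = Y p) ->
  smooth_field W X -> smooth_field W Y.
Proof.
move=> oW XY H q j; have o := open_dom_hol (hol_chart_at q).
apply: smooth_on_eq (openI oW o) _ (H q j) => p [Wp _].
by rewrite /component XY.
Qed.

Lemma hol_field_frame c a : hol_chart c -> hol_field (dom c) (frame c a).
Proof.
move=> hc; have o := open_dom_hol hc.
apply: (component_hol_field hc o) => // b.
apply: hol_on_eq o _ (hol_on_cst _ (a == b)%:R) => p cp.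
by rewrite component_frame.
Qed.

Lemma del_component c X f W q : open W -> W q -> hol_chart c -> dom c q ->
  smooth_on W f -> del q (X q) f = \sum_k component c k X q * pd c k f q.
Proof. by move=> oW Wq hc cq Hf; exact: (del_chart (X q) oW Wq hc cq Hf). Qed.

Lemma smooth_on_del W X f : open W -> smooth_field W X -> smooth_on W f ->
  smooth_on W (fun p => del p (X p) f).
Proof.
move=> oW HX Hf; apply: smooth_on_local => p Wp.
exists (dom (chart_at p)); first exact: chart_at_dom.
have h := hol_chart_at p; have oU := openI oW (open_dom_hol h).
have E q : (W `&` dom (chart_at p)) q ->
   \sum_k component (chart_at p) k X q * pd (chart_at p) k f q = del q (X q) f.
  by move=> [Wq pq]; rewrite -(del_component X oW Wq h pq Hf).
apply: (smooth_on_eq oU E); apply: smooth_on_sum => // k; apply: smooth_onM => //.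
apply: smooth_on_pd => //.
by apply: smooth_on_sub Hf => q [].
Qed.

Lemma smooth_on_delbar W X f : open W -> smooth_field W X -> smooth_on W f ->
  smooth_on W (fun p => delbar p (X p) f).
Proof.
move=> oW HX Hf; have H := smooth_on_del oW HX (smooth_onJ oW Hf).
apply: (smooth_on_eq oW _ (smooth_onJ oW H)) => p Wp.
by rewrite (delbarE _ oW Wp Hf).
Qed.

(** The second sum is symmetric in X and Y up to the order of the two partial
    derivatives. *)
Lemma del_del c W X Y f q : open W -> W q -> hol_chart c -> dom c q ->
  smooth_field W X -> smooth_field W Y -> smooth_on W f ->
  del q (X q) (fun p => del p (Y p) f) =
    \sum_k del q (X q) (component c k Y) * pd c k f q +
    \sum_k \sum_j component c k Y q * (component c j X q * pd c j (pd c k f) q).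
Proof.
move=> oW Wq hc cq HX HY Hf; have oc := open_dom_hol hc.
pose U := W `&` dom c; have oU : open U by exact: openI.
have Uq : U q by []; have Uc : U `<=` dom c by move=> p [].
have UW : U `<=` W by move=> p [].
have HfU := smooth_on_sub UW Hf.
have sp k : smooth_on U (pd c k f) by exact: smooth_on_pd.
have sY k : smooth_on U (component c k Y).
  exact: smooth_field_component hc oU Uc (smooth_field_sub UW HY).
have E p : U p -> del p (Y p) f = \sum_k component c k Y p * pd c k f p.
  by move=> [Wp cp]; exact: del_component oW Wp hc cp Hf.
rewrite (del_eq_on _ oU Uq E).
rewrite (del_sum (f := fun k p => component c k Y p * pd c k f p) _ oU Uq); last first.
  by move=> k; exact: smooth_onM.
rewrite -big_split; apply: eq_bigr => k _ /=.
rewrite (delM _ oU Uq (sY k) (sp k)); congr (_ + _).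
by rewrite (del_component X oU Uq hc cq (sp k)) mulr_sumr.
Qed.

(** The second order terms of [del_del] cancel by symmetry of second
    derivatives. *)
Lemma bracket_del W X Y f q : open W -> W q ->
  smooth_field W X -> smooth_field W Y -> smooth_on W f ->
  del q (bracket X Y q) f =
    del q (X q) (fun p => del p (Y p) f) - del q (Y q) (fun p => del p (X p) f).
Proof.
move=> oW Wq HX HY Hf; have h := hol_chart_at q; have cq := chart_at_dom q.
have oU := openI oW (open_dom_hol h).
rewrite (del_del oW Wq h cq HX HY Hf) (del_del oW Wq h cq HY HX Hf).
rewrite [X in _ - (_ + X)]exchange_big /=.
rewrite [X in _ = _ + X - _](eq_bigr (fun k => \sum_j component (chart_at q) j X q *
   (component (chart_at q) k Y q * pd (chart_at q) k (pd (chart_at q) j f) q))).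
  have alg (a b t : C) : a + t - (b + t) = a - b.
    by rewrite opprD addrACA subrr addr0.
  apply: etrans _ (esym (alg _ _ _)); rewrite -sumrB delE; apply: eq_bigr => j _.
  by rewrite mxE mulrBl.
move=> k _; apply: eq_bigr => j _.
have Us : W `&` dom (chart_at q) `<=` W by move=> p [].
have Ud : W `&` dom (chart_at q) `<=` dom (chart_at q) by move=> p [].
have P := pd_comm j k h oU Ud (conj Wq cq) (smooth_on_sub Us Hf).
by rewrite P; exact: mulrCA.
Qed.

Lemma bracket_component c W X Y q b : open W -> W q -> hol_chart c -> dom c q ->
  smooth_field W X -> smooth_field W Y ->
  component c b (bracket X Y) q =
    del q (X q) (component c b Y) - del q (Y q) (component c b X).
Proof.
move=> oW Wq hc cq HX HY; have oc := open_dom_hol hc.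
have Us : W `&` dom c `<=` W by move=> p [].
apply: (bracket_del (openI oW oc)); first by [].
- exact: smooth_field_sub HX.
- exact: smooth_field_sub HY.
- by apply: smooth_on_sub (zc_smooth b hc) => p [].
Qed.

(** The conjugate of [bracket_del]. *)
Lemma delbar_delbar W X Y f q : open W -> W q ->
  smooth_field W X -> smooth_field W Y -> smooth_on W f ->
  delbar q (bracket X Y q) f =
    delbar q (X q) (fun p => delbar p (Y p) f) -
    delbar q (Y q) (fun p => delbar p (X p) f).
Proof.
move=> oW Wq HX HY Hf; have Hf' := smooth_onJ oW Hf.
have H Z Z' : smooth_field W Z -> smooth_field W Z' ->
   delbar q (Z q) (fun p => delbar p (Z' p) f) =
   (del q (Z q) (fun p => del p (Z' p) (fun p => (f p)^*)))^*.
  move=> HZ HZ'; rewrite (delbarE _ oW Wq); last exact: smooth_on_delbar.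
  congr (_^*); apply: (del_eq_on _ oW Wq) => p Wp.
  by rewrite -(delJ _ oW Wp Hf).
rewrite (delbarE _ oW Wq Hf) (bracket_del oW Wq HX HY Hf') rmorphB /=.
by rewrite !H.
Qed.

(** For holomorphic X and Y the field X commutes with the conjugate of Y, since
    the coefficients of the one are constant for the other. *)
Lemma del_delbar_comm W X Y f q : open W -> W q ->
  hol_field W X -> hol_field W Y -> smooth_on W f ->
  del q (X q) (fun p => delbar p (Y p) f) =
  delbar q (Y q) (fun p => del p (X p) f).
Proof.
move=> oW Wq HX HY Hf; pose c := chart_at q.
have hc : hol_chart c by exact: hol_chart_at.
have cq : dom c q by exact: chart_at_dom.
have oc := open_dom_hol hc.
pose U := W `&` dom c; have oU : open U by exact: openI.
have Uq : U q by []; have Uc : U `<=` dom c by move=> p [].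
have UW : U `<=` W by move=> p [].
have HfU := smooth_on_sub UW Hf.
have sp k : smooth_on U (pd c k f) by exact: smooth_on_pd.
have sb k : smooth_on U (pdbar c k f) by exact: smooth_on_pdbar.
have hX k : hol_on U (component c k X).
  exact: hol_field_component hc oU Uc (hol_field_sub UW HX).
have hY k : hol_on U (component c k Y).
  exact: hol_field_component hc oU Uc (hol_field_sub UW HY).
have sX k := hol_on_smooth (hX k); have sY k := hol_on_smooth (hY k).
have sYJ k := smooth_onJ oU (sY k).
have E1 p : U p -> delbar p (Y p) f = \sum_k (component c k Y p)^* * pdbar c k f p.
  by move=> [Wp cp]; exact: (delbar_chart (Y p) oW Wp hc cp Hf).
have E2 p : U p -> del p (X p) f = \sum_k component c k X p * pd c k f p.
  by move=> [Wp cp]; exact: del_component oW Wp hc cp Hf.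
rewrite (del_eq_on _ oU Uq E1) (delbar_eq_on _ oU Uq E2).
rewrite (del_sum (f := fun k p => (component c k Y p)^* * pdbar c k f p) _ oU Uq);
  last by move=> k; exact: smooth_onM.
rewrite (delbar_sum (f := fun k p => component c k X p * pd c k f p) _ oU Uq);
  last by move=> k; exact: smooth_onM.
transitivity (\sum_k \sum_j (component c k Y q)^* *
   (component c j X q * pd c j (pdbar c k f) q)).
  apply: eq_bigr => k _; rewrite (delM _ oU Uq (sYJ k) (sb k)).
  rewrite (del_conj_hol _ oU Uq (hY k)) mul0r add0r.
  by rewrite (del_component X oU Uq hc cq (sb k)) mulr_sumr.
rewrite exchange_big; apply: eq_bigr => k _ /=.
rewrite (delbarM _ oU Uq (sX k) (sp k)) (delbar_hol _ Uq (hX k)) mul0r add0r.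
rewrite (delbar_chart _ oU Uq hc cq (sp k)) mulr_sumr; apply: eq_bigr => j _.
by rewrite (pd_pdbar_comm k j hc oU Uc Uq HfU); exact: mulrCA.
Qed.

(** The transition matrices between frames are holomorphic, so that dbar acts on
    the coefficients in any holomorphic frame. *)
Lemma dbar_component c W q v Y b : open W -> W q -> hol_chart c -> dom c q ->
  smooth_field W Y -> del q (dbar q v Y) (zc c b) = delbar q v (component c b Y).
Proof.
move=> oW Wq hc cq HY; pose d := chart_at q.
have hd : hol_chart d by exact: hol_chart_at.
have dq : dom d q by exact: chart_at_dom.
have oc := open_dom_hol hc; have od := open_dom_hol hd.
pose U := (W `&` dom d) `&` dom c; have oU : open U by apply: openI => //; exact: openI.
have Uq : U q by [].
have UW : U `<=` W by move=> p [[]].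
have Ud : U `<=` dom d by move=> p [[]].
have Udc : U `<=` dom d `&` dom c by move=> p [[]].
have sY k : smooth_on U (component d k Y).
  exact: smooth_field_component hd oU Ud (smooth_field_sub UW HY).
have hp k := zc_pd_hol k b hd hc oU Udc.
have sp k := hol_on_smooth (hp k).
have E p : U p -> component c b Y p = \sum_k component d k Y p * pd d k (zc c b) p.
  by move=> [[Wp dp] cp]; exact: component_change.
rewrite (delbar_eq_on _ oU Uq E).
rewrite (delbar_sum (f := fun k p => component d k Y p * pd d k (zc c b) p) _ oU Uq);
  last by move=> k; exact: smooth_onM.
rewrite delE; apply: eq_bigr => k _; rewrite mxE.
by rewrite (delbarM _ oU Uq (sY k) (sp k)) (delbar_hol _ Uq (hp k)) mulr0 addr0.
Qed.

End Fields.

(** * Inverses and derivatives of holomorphic functions *)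

Section MoreFunctions.
Context {R : realType} {m : nat} {M : complex_manifold R m}.
Local Notation C := R[i].
Implicit Types (f g : M -> C) (W : set M) (p q : M) (v w : 'rV[R[i]]_m).
Implicit Types (X Y Z : M -> 'rV[R[i]]_m).

Lemma delN W q v f : open W -> W q -> smooth_on W f ->
  del q v (fun p => - f p) = - del q v f.
Proof.
move=> oW Wq Hf.
have -> : (fun p => - f p) = fun p => -1 * f p.
  by apply/funext => p; rewrite mulN1r.
rewrite (delM v oW Wq (smooth_on_cst _ _) Hf).
have -> : del q v (fun=> -1) = 0 by exact: del_cst.
by rewrite mul0r add0r mulN1r.
Qed.

Lemma delbarN W q v f : open W -> W q -> smooth_on W f ->
  delbar q v (fun p => - f p) = - delbar q v f.
Proof.
move=> oW Wq Hf.
have -> : (fun p => - f p) = fun p => -1 * f p.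
  by apply/funext => p; rewrite mulN1r.
rewrite (delbarM v oW Wq (smooth_on_cst _ _) Hf).
have -> : delbar q v (fun=> -1) = 0 by exact: (delbar_cst _ oW Wq).
by rewrite mul0r add0r mulN1r.
Qed.

Lemma smooth_onN W f : open W -> smooth_on W f -> smooth_on W (fun p => - f p).
Proof.
move=> oW Hf.
have -> : (fun p => - f p) = fun p => -1 * f p.
  by apply/funext => p; rewrite mulN1r.
by apply: smooth_onM => //; exact: smooth_on_cst.
Qed.

(** Apply dbar to f f^-1 = 1. *)
Lemma hol_onV W f : open W -> (forall p, W p -> f p != 0) -> hol_on W f ->
  hol_on W (fun p => (f p)^-1).
Proof.
move=> oW f0 Hf; have sf := hol_on_smooth Hf; have sV := smooth_onV oW f0 sf.
apply: (holP oW sV) => q v Wq.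
have E : delbar q v (fun p => f p * (f p)^-1) = 0.
  have E1 p : W p -> f p * (f p)^-1 = 1 by move=> Wp; rewrite divff // f0.
  by rewrite (delbar_eq_on v oW Wq E1); exact: (delbar_cst _ oW Wq).
have := delbarM v oW Wq sf sV; rewrite E (delbar_hol v Wq Hf) mul0r add0r => /esym/eqP.
by rewrite mulf_eq0 (negbTE (f0 _ Wq)) => /eqP.
Qed.

Lemma hol_on_del W X f : open W -> hol_field W X -> hol_on W f ->
  hol_on W (fun p => del p (X p) f).
Proof.
move=> oW HX Hf; apply: hol_on_local => p Wp.
exists (dom (chart_at p)); first exact: chart_at_dom.
have h := hol_chart_at p; have o := openI oW (open_dom_hol h).
have sub : W `&` dom (chart_at p) `<=` dom (chart_at p) by move=> q [].
have sub' : W `&` dom (chart_at p) `<=` W by move=> q [].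
have E q : (W `&` dom (chart_at p)) q ->
   \sum_k component (chart_at p) k X q * pd (chart_at p) k f q = del q (X q) f.
  by move=> [Wq pq]; exact/esym/(del_component X oW Wq h pq (hol_on_smooth Hf)).
apply: (hol_on_eq o E); apply: (hol_on_sum o) => k; apply: (hol_onM o).
  exact: (hol_field_component k h o sub (hol_field_sub sub' HX)).
exact: (hol_on_pd k h o sub (hol_on_sub sub' Hf)).
Qed.

Lemma delM_eq W q v f g (df dg : C) : open W -> W q ->
  smooth_on W f -> smooth_on W g -> del q v f = df -> del q v g = dg ->
  del q v (fun p => f p * g p) = df * g q + f q * dg.
Proof. by move=> oW Wq Hf Hg <- <-; exact: (delM v oW Wq Hf Hg). Qed.

Lemma delbarM_eq W q v f g (df dg : C) : open W -> W q ->
  smooth_on W f -> smooth_on W g -> delbar q v f = df -> delbar q v g = dg ->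
  delbar q v (fun p => f p * g p) = df * g q + f q * dg.
Proof. by move=> oW Wq Hf Hg <- <-; exact: (delbarM v oW Wq Hf Hg). Qed.

Lemma delD_eq W q v f g (df dg : C) : open W -> W q ->
  smooth_on W f -> smooth_on W g -> del q v f = df -> del q v g = dg ->
  del q v (fun p => f p + g p) = df + dg.
Proof. by move=> oW Wq Hf Hg <- <-; exact: (delD v oW Wq Hf Hg). Qed.

Lemma delbarD_eq W q v f g (df dg : C) : open W -> W q ->
  smooth_on W f -> smooth_on W g -> delbar q v f = df -> delbar q v g = dg ->
  delbar q v (fun p => f p + g p) = df + dg.
Proof. by move=> oW Wq Hf Hg <- <-; exact: (delbarD v oW Wq Hf Hg). Qed.

End MoreFunctions.

(** * Locality of (1,0)-connections *)

Section Connections.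
Context {R : realType} {m : nat} {M : complex_manifold R m}.
Local Notation C := R[i].
Local Notation T := 'rV[R[i]]_m.
Local Notation field := (M -> 'rV[R[i]]_m).
Implicit Types (c : chart R m M) (f g : M -> C) (W : set M) (p q : M) (v w : T).
Implicit Types (X Y Z s t : field) (N : derivation M).

Lemma smooth_field0 W : smooth_field W (fun=> 0 : T).
Proof.
move=> q j; have -> : component (chart_at q) j (fun=> 0) = fun=> 0 :> C.
  by apply/funext => p; exact: del0.
exact: smooth_on_cst.
Qed.

Lemma smooth_fieldZD W f Y Z : open W -> smooth_on W f ->
  smooth_field W Y -> smooth_field W Z ->
  smooth_field W (fun q => f q *: Y q + Z q).
Proof.
move=> oW Hf HY HZ q j; have o := openI oW (open_dom_hol (hol_chart_at q)).
have E : component (chart_at q) j (fun q => f q *: Y q + Z q) =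
   fun p => f p * component (chart_at q) j Y p + component (chart_at q) j Z p.
  by apply/funext => p; exact: del_linear.
rewrite E; apply: (smooth_onD o); last exact: HZ.
by apply: (smooth_onM o); [apply: smooth_on_sub Hf => p []|exact: HY].
Qed.

Lemma conn_zero N p v : conn10 N -> N p v (fun=> 0) = 0.
Proof.
move=> [_ _ H].
have E : N p v (fun _ : M => 1 *: 0 + 0) =
    1 *: N p v (fun=> 0) + del p v (fun=> 1) *: 0 + N p v (fun=> 0).
  exact: (H setT (fun=> 1) (fun=> 0) (fun=> 0) p v openT I (smooth_on_cst _ _)
    (smooth_field0 _) (smooth_field0 _)).
move: E; rewrite scaler0 addr0 scaler0 addr0 scale1r.
by move=> /(congr1 (fun x => x - N p v (fun=> 0))); rewrite subrr addrK => <-.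
Qed.

(** The Leibniz rule requires smoothness on W only, so it applies to f s = s with
    f the indicator function of the complement of W; f and s vanish at p. *)
Lemma conn_null N W s p v : conn10 N -> open W -> W p ->
  (forall q, W q -> s q = 0) -> N p v s = 0.
Proof.
move=> cN oW Wp s0; have [_ _ H] := cN.
have Hs : smooth_field W s.
  by apply: smooth_field_eq oW _ (smooth_field0 W) => q Wq; rewrite s0.
(* f s = s everywhere, although f vanishes on W. *)
pose f q : C := if `[< W q >] then 0 else 1.
have f0 q : W q -> f q = 0 by move=> Wq; rewrite /f asboolT.
have Hf : smooth_on W f.
  by apply: smooth_on_eq oW _ (smooth_on_cst W 0) => q Wq; rewrite f0.
have E : N p v (fun q => f q *: s q + 0) =
    f p *: N p v s + del p v f *: s p + N p v (fun=> 0).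
  exact: (H W f s (fun=> 0) p v oW Wp Hf Hs (smooth_field0 W)).
move: E; have -> : (fun q => f q *: s q + 0) = s.
  apply/funext => q; rewrite addr0 /f; case: asboolP => [Wq|_].
    by rewrite s0 // scaler0.
  by rewrite scale1r.
by rewrite (f0 _ Wp) (s0 _ Wp) scaler0 scale0r (conn_zero p v cN) !addr0.
Qed.

Lemma conn_local N W s t p v : conn10 N -> open W -> W p -> smooth_field W s ->
  (forall q, W q -> s q = t q) -> N p v s = N p v t.
Proof.
move=> cN oW Wp Hs st; have [_ _ H] := cN.
have Ht : smooth_field W (fun q => t q - s q).
  by apply: smooth_field_eq oW _ (smooth_field0 W) => q Wq; rewrite st // subrr.
have E : N p v (fun q => 1 *: s q + (t q - s q)) =
    1 *: N p v s + del p v (fun=> 1) *: s p + N p v (fun q => t q - s q).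
  exact: (H W (fun=> 1) s (fun q => t q - s q) p v oW Wp (smooth_on_cst _ _) Hs Ht).
move: E; have -> : (fun q => 1 *: s q + (t q - s q)) = t.
  by apply/funext => q; rewrite scale1r addrC subrK.
have N0 : N p v (fun q => t q - s q) = 0.
  by apply: (conn_null v cN oW Wp) => q Wq; rewrite st // subrr.
by rewrite N0 del_cst scale0r !addr0 scale1r => ->.
Qed.

Lemma smooth_field_frame c W a : hol_chart c -> W `<=` dom c ->
  smooth_field W (frame c a).
Proof.
move=> hc Wc; apply: smooth_field_sub Wc _.
exact/hol_field_smooth/hol_field_frame.
Qed.

(** Over the domain of a chart a connection is determined by its values on the
    frame. *)
Lemma conn_frame N c W s p v : conn10 N -> hol_chart c -> open W ->
  W `<=` dom c -> W p -> smooth_field W s ->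
  N p v s = \sum_b (component c b s p *: N p v (frame c b) +
                    del p v (component c b s) *: frame c b p).
Proof.
move=> cN hc oW Wc Wp Hs; have [_ _ H] := cN.
have Hb b : smooth_on W (component c b s) by exact: smooth_field_component.
have He b : smooth_field W (frame c b) by exact: smooth_field_frame.
have E q : W q -> s q = \sum_b component c b s q *: frame c b q.
  by move=> Wq; exact: frame_basis hc (Wc _ Wq).
rewrite (conn_local v cN oW Wp Hs E).
suff : forall r : seq 'I_m,
   smooth_field W (fun q => \sum_(b <- r) component c b s q *: frame c b q) /\
   N p v (fun q => \sum_(b <- r) component c b s q *: frame c b q) =
   \sum_(b <- r) (component c b s p *: N p v (frame c b) +
                    del p v (component c b s) *: frame c b p).
  by move=> /(_ (index_enum _))[].
elim=> [|b r [IH1 IH2]].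
  have -> : (fun q => \sum_(b <- [::]) component c b s q *: frame c b q) = fun=> 0.
    by apply/funext => q; rewrite big_nil.
  by split; [exact: smooth_field0|rewrite big_nil conn_zero].
have -> : (fun q => \sum_(b <- b :: r) component c b s q *: frame c b q) =
  fun q => component c b s q *: frame c b q +
           (\sum_(b <- r) component c b s q *: frame c b q).
  by apply/funext => q; rewrite big_cons.
split; first exact: smooth_fieldZD.
by rewrite big_cons -IH2; exact: (H W).
Qed.

End Connections.

(** * Algebraic identities *)

Section SemilinearSums.
Context {R : realType} {m : nat}.
Local Notation C := R[i].
Local Notation T := 'rV[R[i]]_m.

Lemma scalar_map_sum (f : T -> C) n (a : 'I_n -> C) (x : 'I_n -> T) :
  (forall a x y, f (a *: x + y) = a * f x + f y) ->
  f (\sum_i a i *: x i) = \sum_i a i * f (x i).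
Proof.
move=> Hf.
have f0 : f 0 = 0.
  by have := Hf (-1) 0 0; rewrite scaler0 addr0 mulN1r addNr.
elim: (index_enum _) => [|i r IH]; first by rewrite !big_nil.
by rewrite !big_cons Hf IH.
Qed.

Lemma linear_map_sum (f : T -> T) n (a : 'I_n -> C) (x : 'I_n -> T) :
  linear f -> f (\sum_i a i *: x i) = \sum_i a i *: f (x i).
Proof.
move=> Hf.
have f0 : f 0 = 0.
  by have := Hf (-1) 0 0; rewrite scaler0 addr0 scaleN1r addNr.
elim: (index_enum _) => [|i r IH]; first by rewrite !big_nil.
by rewrite !big_cons Hf IH.
Qed.

Lemma antilinear_map_sum (f : T -> T) n (a : 'I_n -> C) (x : 'I_n -> T) :
  antilinear f -> f (\sum_i a i *: x i) = \sum_i (a i)^* *: f (x i).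
Proof.
move=> Hf.
have f0 : f 0 = 0.
  by have := Hf (-1) 0 0; rewrite scaler0 addr0 rmorphN1 scaleN1r addNr.
elim: (index_enum _) => [|i r IH]; first by rewrite !big_nil.
by rewrite !big_cons Hf IH.
Qed.

Lemma sum_pick (V : nmodType) n (x : 'I_n -> V) a :
  (forall b, b != a -> x b = 0) -> \sum_b x b = x a.
Proof. by move=> H; rewrite (bigD1 a) //= big1 ?addr0. Qed.

Lemma conj_norm (x : C) : `|x| ^* = `|x|.
Proof. by apply: conj_Creal; exact: normr_real. Qed.

(** The off-diagonal coefficients of kappa P kappa: the moduli cancel. *)
Lemma conj_Pcoef_alg (x y z : C) : x != 0 -> y != 0 ->
  (`|y| / y)^* * (z^* / (2 * `|x * y|) * y)^* * (`|x| / x) = z / (2 * x).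
Proof.
move=> x0 y0.
have nx : `|x| != 0 by rewrite normr_eq0.
have ny : `|y| != 0 by rewrite normr_eq0.
have y0' : y^* != 0 by rewrite conjC_eq0.
rewrite normrM !rmorphM !fmorphV /= !rmorphM /= !conj_norm conjCK conjC_nat.
move: `|x| `|y| (y^*) nx ny y0' => r s y' nx ny y0'.
by field; rewrite x0 y0' nx ny.
Qed.

Lemma subr_sub_ACA (V : zmodType) (x y p p' r r' : V) :
  x + y - (p + p' - (r + r')) = (x - (p - r)) + (y - (p' - r')).
Proof.
have -> : p + p' - (r + r') = (p - r) + (p' - r') by rewrite opprD addrACA.
by rewrite opprD addrACA.
Qed.

(** The Koszul formula for a frame of commuting fields in which the metric is
    diagonal with coefficients of differential H, the matrix H being symmetric:
    G a b c stands for g(nabla_a e_b, e_c). *)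
Lemma koszul_alg (I : eqType) (G : I -> I -> I -> C) (H : I -> I -> C) :
  (forall a b c, G a b c = G b a c) -> (forall a b, H a b = H b a) ->
  (forall a b c, (b == c)%:R * H a c = G a b c + G a c b) ->
  forall a b c, 2 * G a b c =
    (b == c)%:R * H a b + (a == c)%:R * H a b - (a == b)%:R * H a c.
Proof.
move=> Gs Hs GH a b c.
have Ma := GH a b c; have Mb := GH b c a; have Mc := GH c a b.
rewrite (Gs b a) in Mb; rewrite (Gs c a) (Gs c b) in Mc.
have E1 : (b == c)%:R * H a b = (b == c)%:R * H a c.
  by case: eqP => [->|_] //; rewrite !mul0r.
have E2 : (a == c)%:R * H a b = (c == a)%:R * H b a by rewrite Hs eq_sym.
have E3 : (a == b)%:R * H a c = (a == b)%:R * H c b.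
  by case: eqP => [->|_]; [rewrite Hs|rewrite !mul0r].
by rewrite E1 E2 E3 Ma Mb Mc; ring.
Qed.

(** The off-diagonal part of the Christoffel symbols of [koszul_alg] is the
    commutator of the matrix Pd with the diagonal projections. *)
Lemma chern_alg (I : eqType) (a b c : I) (G : C) (H Pd : I -> I -> C) (x : I -> C) :
  (forall a b, H a b = H b a) -> (forall a, x a != 0) ->
  (forall a b, a != b -> Pd a b = H a b / (2 * x a)) ->
  2 * (G * x c) = (b == c)%:R * H a b + (a == c)%:R * H a b - (a == b)%:R * H a c ->
  G - (- ((b == a)%:R * Pd c a) - - ((a == c)%:R * Pd c b)) =
    (b == c)%:R * (H a b / (2 * x b)).
Proof.
move=> Hs x0 HPd E.
have -> : G = 2 * (G * x c) / (2 * x c) by field; exact: x0.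
rewrite E {E G} [b == a]eq_sym.
have [ab|ab] := eqVneq a b; have [ac|ac] := eqVneq a c.
- by rewrite -ab ac eqxx; field; exact: x0.
- rewrite -ab (negbTE ac) /= !(mul0r, mul1r) HPd 1?eq_sym // (Hs c a).
  by field; rewrite x0.
- rewrite -ac [b == a]eq_sym (negbTE ab) /= !(mul0r, mul1r) HPd //.
  by field; rewrite !x0.
by case: eqVneq => [->|bc]; rewrite /= !(mul0r, mul1r); field; rewrite ?x0.
Qed.

(** Coefficient a of D'(P s) - P(D's), for D' diagonal with coefficients th and
    with the derivatives of the coefficients of P given by [del_Pcoef]. *)
Lemma chern_P_alg n (a : 'I_n) (ds s pc th v : 'I_n -> C) :
  \sum_b (ds b * pc b + s b * ((th b - th a) * pc b - (a == b)%:R * v b)) +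
  th a * (\sum_b s b * pc b) - \sum_b (ds b + th b * s b) * pc b = - (v a * s a).
Proof.
rewrite mulr_sumr -big_split -sumrB (sum_pick (a := a)) /= => [|b ba].
  by rewrite eqxx mul1r; ring.
by rewrite eq_sym (negbTE ba) mul0r; ring.
Qed.

End SemilinearSums.

(** * A Frobenius manifold in canonical coordinates *)

Local Opaque del delbar frame pd pdbar.

Section Adapted.
Context {R : realType} {m : nat} {M : complex_manifold R m}.
Local Notation C := R[i].
Local Notation T := 'rV[R[i]]_m.
Local Notation field := (M -> 'rV[R[i]]_m).
Variables (F : frobenius_data M) (kappa P : M -> T -> T).

Definition Pcoef (u : chart R m M) (eta : M -> C) (a b : 'I_m) (q : M) : C :=
  if a == b then - zc u b q
  else (part2 u eta a b q)^* / (2 * `|part1 u eta a q * part1 u eta b q|)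
         * part1 u eta b q.

(** The data at a point in the hypothesis of the theorem, packed into one
    predicate. *)
Definition adapted (u : chart R m M) (eta : M -> C) : Prop :=
  [/\ canonical_chart F u, normalized_chart F u, metric_potential F u eta &
      forall q, dom u q -> forall b,
        kappa q (frame u b q) =
          (`|part1 u eta b q| / part1 u eta b q) *: frame u b q /\
        P q (frame u b q) = \sum_a Pcoef u eta a b q *: frame u a q].

Hypothesis HF : is_frobenius F.
Hypothesis Hk : forall p, antilinear (kappa p).
Hypothesis HP : forall p, linear (P p).
Variables (u : chart R m M) (eta : M -> C).
Hypothesis A : adapted u eta.

Local Notation U := (dom u).
Local Notation e := (frame u).
Local Notation et := (part1 u eta).
Local Notation et2 := (part2 u eta).
Local Notation co b q v := (del q v (zc u b)).

Lemma adapted_hol : hol_chart u. Proof. by have [[]] := A. Qed.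
Local Notation hu := adapted_hol.
Lemma adapted_open : open U. Proof. exact: open_dom_hol adapted_hol. Qed.
Local Notation oU := adapted_open.

Lemma eta_hol : hol_on U eta. Proof. by have [_ _ []] := A. Qed.

Lemma eta1_pd q a : U q -> et a q = pd u a eta q.
Proof. by move=> uq; exact: (del_frame oU uq a hu uq (hol_on_smooth eta_hol)). Qed.

Lemma eta1_hol a : hol_on U (et a).
Proof.
apply: hol_on_eq oU _ (hol_on_pd a hu oU (@subset_refl _ _) eta_hol) => q uq.
by rewrite eta1_pd.
Qed.

Lemma eta1_smooth a : smooth_on U (et a).
Proof. exact/hol_on_smooth/eta1_hol. Qed.

Lemma eta2_pd q a b : U q -> et2 a b q = pd u a (et b) q.
Proof. by move=> uq; exact: (del_frame oU uq a hu uq (eta1_smooth b)). Qed.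

Lemma eta2_hol a b : hol_on U (et2 a b).
Proof.
apply: hol_on_eq oU _ (hol_on_pd a hu oU (@subset_refl _ _) (eta1_hol b)) => q uq.
by rewrite eta2_pd.
Qed.

(** The eta_ab are second derivatives of the potential eta. *)
Lemma eta2_sym q a b : U q -> et2 a b q = et2 b a q.
Proof.
move=> uq; rewrite /part2.
have E c : forall p, U p -> et c p = pd u c eta p by move=> p; exact: eta1_pd.
have sp c := smooth_on_pd c hu oU (@subset_refl _ _) (hol_on_smooth eta_hol).
have D a' b' : del q (e a' q) (et b') = pd u a' (pd u b' eta) q.
  have D1 := del_eq_on (e a' q) oU uq (E b').
  have D2 := del_frame oU uq a' hu uq (sp b').
  exact: etrans D1 D2.
apply: etrans (D a b) (etrans _ (esym (D b a))).
exact: pd_comm hu oU (@subset_refl _ _) uq (hol_on_smooth eta_hol).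
Qed.

Lemma del_eta1 q v b : U q -> del q v (et b) = \sum_a co a q v * et2 a b q.
Proof.
move=> uq; rewrite (del_chart v oU uq hu uq (eta1_smooth b)).
by apply: eq_bigr => a _; rewrite eta2_pd.
Qed.

Lemma co_frame q a b : U q -> co b q (e a q) = (a == b)%:R.
Proof. exact: del_frame_zc hu. Qed.

Lemma co_sum q (x : 'I_m -> C) b : U q -> co b q (\sum_a x a *: e a q) = x b.
Proof. by move=> uq; exact: frame_coord hu uq. Qed.

Lemma co_expand q v : U q -> v = \sum_a co a q v *: e a q.
Proof. exact: frame_basis hu. Qed.

Lemma co_inj q v w : U q -> (forall b, co b q v = co b q w) -> v = w.
Proof. exact: frame_inj hu. Qed.

Lemma prod_frame q a b : U q -> fprod F q (e a q) (e b q) = (a == b)%:R *: e a q.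
Proof. by move=> uq; have [[_ H] _ _ _] := A; exact: H. Qed.

(** Distinct frame vectors are orthogonal because the e_a are orthogonal
    idempotents and g is invariant: g(e_a, e_b) = g(e_a o e_a, e_b) = g(e_a, e_a o e_b). *)
Lemma fg_frame q a b : U q -> fg F q (e a q) (e b q) = (a == b)%:R * et b q.
Proof.
move=> uq; have [ab|nab] := eqVneq a b.
  by rewrite ab mul1r; have [_ _ [_ H] _] := A; exact: H.
rewrite mul0r -[e a q]scale1r -[1]/((true : nat)%:R) -(eqxx a) -prod_frame //.
rewrite (fg_invariant HF) prod_frame // (negbTE nab) scale0r (fg_sym HF).
have := fg_linear HF q (-1) 0 0 (e a q).
by rewrite scaler0 addr0 mulN1r addNr.
Qed.

Lemma fg_expandl q (x : 'I_m -> C) w : U q ->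
  fg F q (\sum_a x a *: e a q) w = \sum_a x a * fg F q (e a q) w.
Proof.
move=> uq; apply: (scalar_map_sum (f := fun v => fg F q v w)) => a v1 v2.
exact: (fg_linear HF).
Qed.

Lemma fg_frame_l q a w : U q -> fg F q (e a q) w = co a q w * et a q.
Proof.
move=> uq; rewrite (fg_sym HF) {1}(co_expand w uq) fg_expandl //.
rewrite (sum_pick (a := a)) => [|b /negbTE ba].
  by rewrite fg_frame // eqxx mul1r.
by rewrite fg_frame // ba mul0r mulr0.
Qed.

Lemma fg_co q v w : U q -> fg F q v w = \sum_b co b q v * co b q w * et b q.
Proof.
move=> uq; rewrite {1}(co_expand v uq) fg_expandl //.
by apply: eq_bigr => b _; rewrite fg_frame_l // mulrA.
Qed.

(** Otherwise e_a would be orthogonal to the whole frame. *)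
Lemma et_neq0 q a : U q -> et a q != 0.
Proof.
move=> uq; apply/eqP => E0.
have e0 : e a q = 0.
  by apply: (@fg_nondeg _ _ _ _ HF q) => w; rewrite fg_frame_l // E0 mulr0.
have := co_frame a a uq; rewrite e0 del0 eqxx => /eqP.
by rewrite eq_sym oner_eq0.
Qed.

Lemma co_prod q v w b : U q -> co b q (fprod F q v w) = co b q v * co b q w.
Proof.
move=> uq.
have E1 a : fprod F q (e a q) w = co a q w *: e a q.
  rewrite (fprodC HF) {1}(co_expand w uq).
  rewrite (linear_map_sum _ _ (fprod_linear HF q (e a q))).
  rewrite (sum_pick (a := a)) => [|c /negbTE ca].
    by rewrite prod_frame // eqxx scale1r.
  by rewrite prod_frame // ca scale0r scaler0.
rewrite {1}(co_expand v uq) (linear_map_sum _ _ (fprod_linear HF q w)).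
rewrite -(co_sum (fun a => co a q v * co a q w) b uq); congr (del _ _ _).
by apply: eq_bigr => a _; rewrite E1 scalerA.
Qed.

(** The unimodular factor by which kappa acts on e_b. *)
Definition kfac b (q : M) : C := `|et b q| / et b q.

Lemma co_kappa q v b : U q -> co b q (kappa q v) = (co b q v)^* * kfac b q.
Proof.
move=> uq; rewrite {1}(co_expand v uq) (antilinear_map_sum _ _ (Hk q)).
rewrite -(co_sum (fun a => (co a q v)^* * kfac a q) b uq); congr (del _ _ _).
apply: eq_bigr => a _; have [_ _ _ H] := A.
by rewrite (H q uq a).1 scalerA.
Qed.

Lemma co_P q v a : U q -> co a q (P q v) = \sum_b co b q v * Pcoef u eta a b q.
Proof.
move=> uq; rewrite {1}(co_expand v uq) (linear_map_sum _ _ (HP q)) del_suml.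
apply: eq_bigr => b _; have [_ _ _ H] := A.
by rewrite (H q uq b).2 delZl co_sum.
Qed.

(** As P is g-symmetric and kappa an involution, this is the h-adjoint of P. *)
Definition Pdag (q : M) (v : T) : T := kappa q (P q (kappa q v)).

Definition Pdcoef (a b : 'I_m) (q : M) : C :=
  if a == b then - (zc u b q)^* else et2 a b q / (2 * et a q).

Lemma kfac_unit q b : U q -> (kfac b q)^* * kfac b q = 1.
Proof.
move=> uq; have n0 := et_neq0 b uq.
rewrite /kfac rmorphM fmorphV /= conj_norm mulrACA -expr2 normCK.
rewrite -invfM [_^* * _]mulrC divff // mulf_neq0 // conjC_eq0 //.
Qed.

Lemma kfac_Pcoef q a b : U q ->
  (kfac b q)^* * (Pcoef u eta a b q)^* * kfac a q = Pdcoef a b q.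
Proof.
move=> uq; rewrite /Pcoef /Pdcoef; case: eqVneq => [->|ab].
  by rewrite rmorphN mulrN mulNr mulrAC kfac_unit // mul1r.
exact: conj_Pcoef_alg (et_neq0 a uq) (et_neq0 b uq).
Qed.

Lemma co_Pdag q v a : U q -> co a q (Pdag q v) = \sum_b co b q v * Pdcoef a b q.
Proof.
move=> uq; rewrite /Pdag co_kappa // co_P // rmorph_sum mulr_suml.
apply: eq_bigr => b _; rewrite co_kappa // -kfac_Pcoef //.
have alg (x y z w : C) : (x^* * y * z)^* * w = x * (y^* * z^* * w).
  by rewrite !rmorphM /= conjCK !mulrA.
exact: alg.
Qed.

Lemma Pdag_linear q : linear (Pdag q).
Proof. by move=> a v w; rewrite /Pdag Hk HP Hk conjCK. Qed.

Lemma co_euler q b : U q -> co b q (feuler F q) = zc u b q.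
Proof. by move=> uq; have [_ H _ _] := A; rewrite (H q uq) co_sum. Qed.

Lemma hform_co q v w : U q ->
  hform F kappa q v w = \sum_b co b q v * (co b q w)^* * `|et b q|.
Proof.
move=> uq; rewrite /hform fg_co //; apply: eq_bigr => b _.
by rewrite co_kappa // /kfac mulrA -mulrA divfK // et_neq0.
Qed.

(** * The Levi-Civita connection and the (1,0)-part of the Chern connection *)

Local Notation nab := (fnabla F).

Lemma nabla_conn : conn10 nab.
Proof. exact: lc_conn (fnablaP HF). Qed.

Lemma frame_hol a : hol_field U (e a).
Proof. exact: hol_field_frame hu. Qed.

Lemma frame_smooth a : smooth_field U (e a).
Proof. exact/hol_field_smooth/frame_hol. Qed.

Lemma bracket_frame a b q : U q -> bracket (e a) (e b) q = 0.
Proof.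
move=> uq; apply: (co_inj uq) => c; rewrite del0.
rewrite [LHS](bracket_component c oU uq hu uq (frame_smooth a) (frame_smooth b)).
have E d : forall p, U p -> component u c (e d) p = (d == c)%:R.
  by move=> p up; exact: (component_frame d c hu up).
have Z x d : del q x (component u c (e d)) = 0.
  by rewrite (del_eq_on x oU uq (E d)); exact: del_cst.
exact: etrans (congr2 (fun x y => x - y) (Z _ b) (Z _ a)) (subrr 0).
Qed.

Lemma nabla_frame_sym a b q : U q -> nab q (e a q) (e b) = nab q (e b q) (e a).
Proof.
move=> uq; apply: subr0_eq.
exact: etrans (lc_torsion (fnablaP HF) oU uq (frame_hol a) (frame_hol b))
  (bracket_frame a b uq).
Qed.

Lemma nabla_frame_metric a b c q : U q ->
  (b == c)%:R * et2 a c q =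
  fg F q (nab q (e a q) (e b)) (e c q) + fg F q (nab q (e a q) (e c)) (e b q).
Proof.
move=> uq.
have L := lc_metric (fnablaP HF) oU uq (frame_hol a) (frame_hol b) (frame_hol c).
have S := fg_sym HF q (e b q) (nab q (e a q) (e c)).
have E p : U p -> fg F p (e b p) (e c p) = (b == c)%:R * et c p by exact: fg_frame.
apply: etrans (etrans L (congr1 (fun z => _ + z) S)).
apply: etrans (esym (del_eq_on (e a q) oU uq E)).
apply: etrans (esym (delM (e a q) oU uq (smooth_on_cst _ _) (eta1_smooth c))).
rewrite (del_cst q (e a q) (b == c)%:R).
have alg (x y z : C) : x * y = 0 * z + x * y by rewrite mul0r add0r.
exact: alg.
Qed.

(** The Levi-Civita connection of a diagonal metric deriving from a potential. *)
Lemma nabla_frame_koszul a b c q : U q ->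
  2 * (co c q (nab q (e a q) (e b)) * et c q) =
  (b == c)%:R * et2 a b q + (a == c)%:R * et2 a b q - (a == b)%:R * et2 a c q.
Proof.
move=> uq; rewrite -(fg_frame_l c _ uq) (fg_sym HF).
exact: (koszul_alg (fun a b c => congr1 (fun w => fg F q w (e c q))
    (nabla_frame_sym a b uq)) (fun a b => eta2_sym a b uq)
  (fun a b c => nabla_frame_metric a b c uq)).
Qed.

(** The operator D', defined by the relation D' = nabla - [P^dag, Phi]. *)
Definition chern10 : derivation M := fun q v s =>
  nab q v s - (Pdag q (Phi F q v (s q)) - Phi F q v (Pdag q (s q))).

Lemma Phi_linear_l q w : linear (fun v => Phi F q v w).
Proof. by move=> a x y; rewrite /Phi (fprod_linear HF) opprD scalerN. Qed.

Lemma Phi_linear_r q v : linear (Phi F q v).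
Proof.
move=> a x y; rewrite /Phi !(fprodC HF q v) (fprod_linear HF) opprD.
by rewrite scalerN.
Qed.

Lemma co_Phi q v w b : U q -> co b q (Phi F q v w) = - (co b q v * co b q w).
Proof. by move=> uq; rewrite /Phi delNl co_prod. Qed.

Lemma co_Pdag_Phi_frame q a b c : U q ->
  co c q (Pdag q (Phi F q (e a q) (e b q))) = - ((b == a)%:R * Pdcoef c a q).
Proof.
move=> uq; apply: etrans (co_Pdag _ _ uq) _.
have E d : co d q (Phi F q (e a q) (e b q)) = - ((a == d)%:R * (b == d)%:R).
  exact: etrans (co_Phi _ _ _ uq) (congr2 (fun x y => - (x * y)) (co_frame a d uq)
    (co_frame b d uq)).
rewrite (sum_pick (a := a)) => [|d /negbTE da].
  by rewrite (E a) eqxx mul1r mulNr.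
by rewrite (E d) eq_sym da mul0r oppr0 mul0r.
Qed.

Lemma co_Phi_Pdag_frame q a b c : U q ->
  co c q (Phi F q (e a q) (Pdag q (e b q))) = - ((a == c)%:R * Pdcoef c b q).
Proof.
move=> uq; apply: etrans (co_Phi _ _ _ uq) _.
have E : co c q (Pdag q (e b q)) = Pdcoef c b q.
  apply: etrans (co_Pdag _ _ uq) _.
  rewrite (sum_pick (a := b)) => [|d /negbTE db].
    by rewrite (co_frame b b uq) eqxx mul1r.
  by rewrite (co_frame b d uq) eq_sym db mul0r.
exact: (congr2 (fun x y => - (x * y)) (co_frame a c uq) E).
Qed.

(** The canonical frame is parallel for D' up to scaling: subtracting
    [P^dag, Phi] removes the off-diagonal part of nabla. *)
(** On coefficients, D' is derivation plus multiplication by [theta]. *)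
Lemma co_chern10_frame q a b c : U q ->
  co c q (chern10 q (e a q) (e b)) = (b == c)%:R * (et2 a b q / (2 * et b q)).
Proof.
move=> uq; rewrite /chern10 delDl delNl delDl delNl.
have E1 := co_Pdag_Phi_frame a b c uq; have E2 := co_Phi_Pdag_frame a b c uq.
have H1 x y : x != y -> Pdcoef x y q = et2 x y q / (2 * et x q).
  by move=> /negbTE xy; rewrite /Pdcoef xy.
have K := chern_alg (fun x y => eta2_sym x y uq) (fun x => et_neq0 x uq) H1
  (nabla_frame_koszul a b c uq).
exact: etrans (congr2 (fun x y => co c q (nab q (e a q) (e b)) - (x - y)) E1 E2) K.
Qed.

(** Half the logarithmic derivative of eta_b, which is the (1,0)-part of
    d log |eta_b|. *)
Definition theta b q v : C := del q v (et b) / (2 * et b q).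

Lemma chern10_linear_l q s : linear (fun v => nab q v s) ->
  linear (fun v => chern10 q v s).
Proof.
move=> H a v w; rewrite /chern10 H (Phi_linear_l q (s q)) (Pdag_linear q).
rewrite (Phi_linear_l q (Pdag q (s q))) scalerBr scalerBr.
exact: subr_sub_ACA.
Qed.

Lemma co_chern10_frame_vec q v b c : U q ->
  co c q (chern10 q v (e b)) = (b == c)%:R * theta b q v.
Proof.
move=> uq.
have L : linear (fun v => chern10 q v (e b)).
  apply: chern10_linear_l; have [_ H _] := nabla_conn.
  exact: H oU uq (frame_smooth b).
rewrite {1}(co_expand v uq) (linear_map_sum _ _ L) del_suml /theta.
rewrite (del_eta1 _ _ uq) mulr_suml mulr_sumr; apply: eq_bigr => a _.
rewrite delZl (co_chern10_frame a b c uq).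
have alg (x y z w : C) : x * (y * (z / w)) = y * (x * z / w).
  by rewrite mulrCA [x * (z / w)]mulrA.
exact: alg.
Qed.

Lemma co_chern10 W q v s b : open W -> W q -> U q -> smooth_field W s ->
  co b q (chern10 q v s) =
    del q v (component u b s) + theta b q v * component u b s q.
Proof.
move=> oW Wq uq Hs; pose W' := W `&` U.
have oW' : open W' := openI oW oU.
have W'U : W' `<=` U by move=> p [].
have W'W : W' `<=` W by move=> p [].
have E := conn_frame v nabla_conn hu oW' W'U (conj Wq uq) (smooth_field_sub W'W Hs).
have Es : s q = \sum_d component u d s q *: e d q by exact: co_expand.
have L : linear (fun w => Pdag q (Phi F q v w) - Phi F q v (Pdag q w)).
  move=> a x y; rewrite (Phi_linear_r q v) !(Pdag_linear q) (Phi_linear_r q v).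
  by rewrite scalerBr opprD addrACA.
have E2 : chern10 q v s = \sum_d (component u d s q *: chern10 q v (e d) +
    del q v (component u d s) *: e d q).
  rewrite /chern10 E {1 2}Es.
  rewrite (linear_map_sum _ _ L) -sumrB; apply: eq_bigr => d _.
  have alg (k : C) (x y z : T) : k *: x + z - k *: y = k *: (x - y) + z.
    by rewrite scalerBr addrAC.
  exact: alg.
rewrite E2 del_suml.
have Ed d : co b q (component u d s q *: chern10 q v (e d) +
    del q v (component u d s) *: e d q) =
    (d == b)%:R * (theta d q v * component u d s q) +
    (d == b)%:R * del q v (component u d s).
  rewrite delDl !delZl (co_chern10_frame_vec v d b uq) (co_frame d b uq).
  have alg (x y z t : C) : x * (t * y) + z * t = t * (y * x) + t * z.
    by rewrite mulrCA [x * y]mulrC [z * t]mulrC.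
  exact: alg.
rewrite (eq_bigr _ (fun d _ => Ed d)) (sum_pick (a := b)) => [|d /negbTE db].
  by rewrite eqxx !mul1r addrC.
by rewrite db !mul0r addr0.
Qed.

(** * Derivatives of the metric coefficients and of the potential *)

Definition nrm b (q : M) : C := `|et b q|.

Lemma nrm_neq0 b q : U q -> nrm b q != 0.
Proof.
have nn (x : C) : x != 0 -> `|x| != 0 by rewrite normr_eq0.
by move=> uq; exact: nn _ (et_neq0 b uq).
Qed.

Lemma nrm_smooth b : smooth_on U (nrm b).
Proof.
exact: (smooth_on_norm oU (fun q uq => et_neq0 b uq) (eta1_smooth b)).
Qed.

Lemma etV_hol b : hol_on U (fun q => (et b q)^-1).
Proof. exact: (hol_onV oU (fun q uq => et_neq0 b uq) (eta1_hol b)). Qed.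

Lemma kfac_smooth b : smooth_on U (kfac b).
Proof.
exact: (smooth_onM oU (nrm_smooth b) (hol_on_smooth (etV_hol b))).
Qed.

Lemma del_et_theta b q v : U q -> del q v (et b) = 2 * theta b q v * et b q.
Proof.
move=> uq; rewrite /theta; have alg (x y : C) : y != 0 -> x = 2 * (x / (2 * y)) * y.
  by move=> y0; field.
exact: alg (et_neq0 b uq).
Qed.

(** Differentiate |eta_b|^2 = eta_b (conj eta_b), where the second factor is
    antiholomorphic. *)
Lemma del_nrm b q v : U q -> del q v (nrm b) = theta b q v * nrm b q.
Proof.
move=> uq; have s1 := nrm_smooth b; have s2 := eta1_smooth b.
have E p : U p -> nrm b p * nrm b p = et b p * (et b p)^*.
  by move=> up; rewrite -normCK expr2.
have D1 := delM v oU uq s1 s1.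
have D2 := delM v oU uq s2 (smooth_onJ oU s2).
have D3 := del_eq_on v oU uq E.
have D4 := etrans (esym D1) (etrans D3 D2).
rewrite (del_conj_hol v oU uq (eta1_hol b)) (del_et_theta b v uq) in D4.
have alg (x n t e e' : C) : n != 0 -> n * n = e * e' ->
   x * n + n * x = 2 * t * e * e' + e * 0 -> x = t * n.
  move=> n0 nE H; have n2 : 2 * n != 0 by rewrite mulf_neq0 // pnatr_eq0.
  apply: (mulfI n2); transitivity (x * n + n * x); first by ring.
  by rewrite H -mulrA -nE; ring.
exact: alg (nrm_neq0 b uq) (E q uq) D4.
Qed.

Lemma nrm_real b q : (nrm b q)^* = nrm b q.
Proof. exact: conj_norm. Qed.

Lemma delbar_nrm b q v : U q -> delbar q v (nrm b) = (theta b q v)^* * nrm b q.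
Proof.
move=> uq; rewrite (delbarE v oU uq (nrm_smooth b)).
have -> : (fun p => (nrm b p)^*) = nrm b by apply/funext => p; exact: nrm_real.
by rewrite (del_nrm b v uq) rmorphM; congr (_ * _); exact: nrm_real.
Qed.

(** Differentiate k_b eta_b = |eta_b|. *)
Lemma del_kfac b q v : U q -> del q v (kfac b) = - theta b q v * kfac b q.
Proof.
move=> uq; have s1 := kfac_smooth b; have s2 := eta1_smooth b.
have E p : U p -> kfac b p * et b p = nrm b p.
  by move=> up; rewrite /kfac divfK // et_neq0.
have D := etrans (esym (delM v oU uq s1 s2)) (del_eq_on v oU uq E).
rewrite (del_nrm b v uq) (del_et_theta b v uq) -(E q uq) in D.
have alg (x k t e : C) : e != 0 -> x * e + k * (2 * t * e) = t * (k * e) -> x = - t * k.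
  move=> e0 H; apply: (mulIf e0); apply: (addIr (k * (2 * t * e))); rewrite H; ring.
exact: alg (et_neq0 b uq) D.
Qed.

Lemma delbar_kfac b q v : U q -> delbar q v (kfac b) = (theta b q v)^* * kfac b q.
Proof.
move=> uq; have s1 := kfac_smooth b; have s2 := eta1_smooth b.
have E p : U p -> kfac b p * et b p = nrm b p.
  by move=> up; rewrite /kfac divfK // et_neq0.
have D := etrans (esym (delbarM v oU uq s1 s2)) (delbar_eq_on v oU uq E).
rewrite (delbar_nrm b v uq) (delbar_hol v uq (eta1_hol b)) -(E q uq) in D.
have alg (x k t e : C) : e != 0 -> x * e + k * 0 = t * (k * e) -> x = t * k.
  by move=> e0 H; apply: (mulIf e0); rewrite -mulrA -H mulr0 addr0.
exact: alg (et_neq0 b uq) D.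
Qed.

Lemma Pcoef_smooth a b : smooth_on U (Pcoef u eta a b).
Proof.
rewrite /Pcoef; case: eqVneq => _.
  exact: (smooth_onN oU (zc_smooth b hu)).
have nn (x y : C) : x != 0 -> y != 0 -> 2 * `|x * y| != 0.
  by move=> x0 y0; rewrite mulf_neq0 ?pnatr_eq0 // normr_eq0 mulf_neq0.
apply: (smooth_onM oU); last exact: eta1_smooth.
apply: (smooth_onM oU).
  exact: (smooth_onJ oU (hol_on_smooth (eta2_hol a b))).
apply: (smooth_onV oU) => [p up|].
  exact: nn (et_neq0 a up) (et_neq0 b up).
apply: (smooth_onM oU (smooth_on_cst _ _)).
apply: (smooth_on_norm oU) => [p up|].
  by apply: mulf_neq0; exact: et_neq0.
exact: (smooth_onM oU (eta1_smooth a) (eta1_smooth b)).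
Qed.

(** For a distinct from b, differentiate
    P_ab |eta_a| |eta_b| = (conj eta_ab) eta_b / 2, where conj eta_ab is
    antiholomorphic. *)
Lemma del_Pcoef a b q v : U q ->
  del q v (Pcoef u eta a b) =
    (theta b q v - theta a q v) * Pcoef u eta a b q - (a == b)%:R * co b q v.
Proof.
move=> uq; have [->|ab] := eqVneq a b.
  have E p : U p -> Pcoef u eta b b p = - zc u b p by rewrite /Pcoef eqxx.
  rewrite (del_eq_on v oU uq E) (delN v oU uq (zc_smooth b hu)).
  by rewrite subrr mul0r mul1r add0r.
rewrite mul0r subr0.
have E p : U p -> Pcoef u eta a b p * (nrm a p * nrm b p) =
    2^-1 * ((et2 a b p)^* * et b p).
  move=> up; rewrite /Pcoef (negbTE ab).
  have alg (x y z : C) : x != 0 -> y != 0 ->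
    z / (2 * `|x * y|) * y * (`|x| * `|y|) = 2^-1 * (z * y).
    move=> x0 y0; have nx : `|x| != 0 by rewrite normr_eq0.
    have ny : `|y| != 0 by rewrite normr_eq0.
    rewrite normrM; move: `|x| `|y| nx ny => r s r0 s0.
    by field; rewrite r0 s0.
  exact: alg (et_neq0 a up) (et_neq0 b up).
have sP := Pcoef_smooth a b; have sa := nrm_smooth a; have sb := nrm_smooth b.
have se := eta1_smooth b; have s2 := smooth_onJ oU (hol_on_smooth (eta2_hol a b)).
have D1 := delM_eq oU uq sP (smooth_onM oU sa sb) (erefl _)
  (delM_eq oU uq sa sb (del_nrm a v uq) (del_nrm b v uq)).
have D2 := delM_eq oU uq (smooth_on_cst U 2^-1) (smooth_onM oU s2 se)
  (del_cst q v 2^-1) (delM_eq oU uq s2 se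
    (del_conj_hol v oU uq (eta2_hol a b)) (del_et_theta b v uq)).
have D3 := etrans (esym D1) (etrans (del_eq_on v oU uq E) D2).
have alg (x p na nb ta tb h e : C) : na != 0 -> nb != 0 ->
   p * (na * nb) = 2^-1 * (h * e) ->
   x * (na * nb) + p * (ta * na * nb + na * (tb * nb)) =
     0 * (h * e) + 2^-1 * (0 * e + h * (2 * tb * e)) -> x = (tb - ta) * p.
  move=> na0 nb0 H1 H2; apply: (mulIf (mulf_neq0 na0 nb0)).
  apply: (addIr (p * (ta * na * nb + na * (tb * nb)))); rewrite H2.
  transitivity (2 * tb * (2^-1 * (h * e))); first by ring.
  by rewrite -H1; ring.
exact: alg (nrm_neq0 a uq) (nrm_neq0 b uq) (E q uq) D3.
Qed.

Lemma chern10E q v s : chern10 q v s =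
  nab q v s - (Pdag q (Phi F q v (s q)) - Phi F q v (Pdag q (s q))).
Proof. by []. Qed.

(** * The identities of a CV-structure *)

Local Opaque chern10 theta dbar bracket.

Lemma coB b q x y (a c : C) : co b q x = a -> co b q y = c -> co b q (x - y) = a - c.
Proof. by move=> <- <-; rewrite delDl delNl. Qed.

Lemma coD b q x y (a c : C) : co b q x = a -> co b q y = c -> co b q (x + y) = a + c.
Proof. by move=> <- <-; rewrite delDl. Qed.

Lemma coN b q x (a : C) : co b q x = a -> co b q (- x) = - a.
Proof. by move=> <-; rewrite delNl. Qed.

Lemma co_Phi_eq q v w b (x y : C) : U q -> co b q v = x -> co b q w = y ->
  co b q (Phi F q v w) = - (x * y).
Proof. by move=> uq <- <-; exact: co_Phi. Qed.

Lemma co_kappa_eq q v b (x : C) : U q -> co b q v = x ->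
  co b q (kappa q v) = x^* * kfac b q.
Proof. by move=> uq <-; exact: co_kappa. Qed.

Lemma co_Phit_eq q v w b (x y : C) : U q -> co b q v = x -> co b q w = y ->
  co b q (Phit F kappa q v w) = - (x^* * y).
Proof.
move=> uq Ex Ey.
apply: etrans (co_kappa_eq uq (co_Phi_eq uq Ex (co_kappa_eq uq Ey))) _.
have alg : forall x y k : C, k^* * k = 1 -> (- (x * (y^* * k)))^* * k = - (x^* * y).
  move=> x0 y0 k kk; rewrite rmorphN !rmorphM /= conjCK.
  by rewrite mulNr -!mulrA kk mulr1.
exact: alg (kfac_unit b uq).
Qed.

Lemma co_Uop_eq q w b (y : C) : U q -> co b q w = y ->
  co b q (Uop F q w) = zc u b q * y.
Proof.
move=> uq <-; rewrite -(co_euler b uq); exact: co_prod.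
Qed.

Lemma co_Uopt_eq q w b (y : C) : U q -> co b q w = y ->
  co b q (kappa q (Uop F q (kappa q w))) = (zc u b q)^* * y.
Proof.
move=> uq Ey.
apply: etrans (co_kappa_eq uq (co_Uop_eq uq (co_kappa_eq uq Ey))) _.
have alg : forall x y k : C, k^* * k = 1 -> (x * (y^* * k))^* * k = x^* * y.
  by move=> x y0 k kk; rewrite !rmorphM /= conjCK -!mulrA kk mulr1.
exact: alg (kfac_unit b uq).
Qed.

Section OnOpen.
Variable W : set M.
Hypotheses (oW : open W) (WU : W `<=` U).
Implicit Types (X Y s t : field) (f : M -> C).

Local Notation cmp b s := (component u b s).

Lemma smooth_cmp b s : smooth_field W s -> smooth_on W (cmp b s).
Proof. exact: (smooth_field_component b hu oW WU). Qed.

Lemma hol_cmp b s : hol_field W s -> hol_on W (cmp b s).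
Proof. exact: (hol_field_component b hu oW WU). Qed.

Lemma smooth_from_cmp X (f : 'I_m -> M -> C) : (forall b, smooth_on W (f b)) ->
  (forall b q, W q -> co b q (X q) = f b q) -> smooth_field W X.
Proof.
move=> Hf E; apply: (component_smooth_field hu oW WU) => b.
by apply: (smooth_on_eq oW _ (Hf b)) => q Wq; exact/esym/E.
Qed.

Lemma et2V_hol b : hol_on W (fun q => (2 * et b q)^-1).
Proof.
apply: (hol_onV oW) => [q Wq|].
  by rewrite mulf_neq0 ?pnatr_eq0 //; exact: et_neq0 (WU Wq).
apply: (hol_onM oW (hol_on_cst _ _)); exact: hol_on_sub WU (eta1_hol b).
Qed.

Lemma smooth_et b : smooth_on W (et b).
Proof. exact: smooth_on_sub WU (eta1_smooth b). Qed.

Lemma smooth_theta b X : smooth_field W X -> smooth_on W (fun q => theta b q (X q)).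
Proof.
move=> HX; exact: (smooth_onM oW (smooth_on_del oW HX (smooth_et b))
  (hol_on_smooth (et2V_hol b))).
Qed.

(** The form theta_b is holomorphic; for this reason the curvature of D' + dbar
    has no (1,1)-part. *)
Lemma hol_theta b X : hol_field W X -> hol_on W (fun q => theta b q (X q)).
Proof.
move=> HX; exact: (hol_onM oW (hol_on_del oW HX (hol_on_sub WU (eta1_hol b)))
  (et2V_hol b)).
Qed.

Lemma co_chern10_eq p v t b f : W p -> smooth_field W t ->
  (forall q, W q -> cmp b t q = f q) ->
  co b p (chern10 p v t) = del p v f + theta b p v * f p.
Proof.
move=> Wp Ht E; apply: etrans (co_chern10 v b oW Wp (WU Wp) Ht) _.
by rewrite (del_eq_on v oW Wp E) (E p Wp).
Qed.

Lemma co_dbar_eq p v t b f : W p -> smooth_field W t ->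
  (forall q, W q -> cmp b t q = f q) -> co b p (dbar p v t) = delbar p v f.
Proof.
move=> Wp Ht E; apply: etrans (dbar_component v b oW Wp hu (WU Wp) Ht) _.
exact: delbar_eq_on oW Wp E.
Qed.

Lemma smooth_chern10 X s : smooth_field W X -> smooth_field W s ->
  smooth_field W (cov chern10 X s).
Proof.
move=> HX Hs; apply: (smooth_from_cmp (f := fun b q =>
  del q (X q) (cmp b s) + theta b q (X q) * cmp b s q)) => [b|b q Wq].
  exact: (smooth_onD oW (smooth_on_del oW HX (smooth_cmp b Hs))
    (smooth_onM oW (smooth_theta b HX) (smooth_cmp b Hs))).
exact: co_chern10_eq.
Qed.

Lemma smooth_dbar X s : smooth_field W X -> smooth_field W s ->
  smooth_field W (cov (@dbar R m M) X s).
Proof.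
move=> HX Hs; apply: (smooth_from_cmp (f := fun b q =>
  delbar q (X q) (cmp b s))) => [b|b q Wq].
  exact: smooth_on_delbar oW HX (smooth_cmp b Hs).
exact: co_dbar_eq.
Qed.

Lemma smooth_Phi X s : smooth_field W X -> smooth_field W s ->
  smooth_field W (fun q => Phi F q (X q) (s q)).
Proof.
move=> HX Hs; apply: (smooth_from_cmp (f := fun b q => - (cmp b X q * cmp b s q))).
  move=> b; exact: (smooth_onN oW (smooth_onM oW (smooth_cmp b HX) (smooth_cmp b Hs))).
by move=> b q Wq; exact: co_Phi_eq (WU Wq) (erefl _) (erefl _).
Qed.

Lemma smooth_kappa s : smooth_field W s -> smooth_field W (fapp kappa s).
Proof.
move=> Hs; apply: (smooth_from_cmp (f := fun b q => (cmp b s q)^* * kfac b q)).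
  move=> b; exact: (smooth_onM oW (smooth_onJ oW (smooth_cmp b Hs))
    (smooth_on_sub WU (kfac_smooth b))).
by move=> b q Wq; exact: co_kappa_eq (WU Wq) (erefl _).
Qed.

Lemma smooth_Phit X s : smooth_field W X -> smooth_field W s ->
  smooth_field W (fun q => Phit F kappa q (X q) (s q)).
Proof. by move=> HX Hs; exact: smooth_kappa (smooth_Phi HX (smooth_kappa Hs)). Qed.

Lemma smooth_Uop s : smooth_field W s -> smooth_field W (fapp (Uop F) s).
Proof.
move=> Hs; apply: (smooth_from_cmp (f := fun b q => zc u b q * cmp b s q)).
  move=> b; exact: (smooth_onM oW (smooth_on_sub WU (zc_smooth b hu)) (smooth_cmp b Hs)).
by move=> b q Wq; exact: co_Uop_eq (WU Wq) (erefl _).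
Qed.

Lemma smooth_P s : smooth_field W s -> smooth_field W (fapp P s).
Proof.
move=> Hs; apply: (smooth_from_cmp (f := fun a q =>
   \sum_b cmp b s q * Pcoef u eta a b q)) => [a|a q Wq]; last exact: co_P (WU Wq).
apply: (smooth_on_sum oW) => b.
exact: (smooth_onM oW (smooth_cmp b Hs) (smooth_on_sub WU (Pcoef_smooth a b))).
Qed.

Lemma smooth_hform s t : smooth_field W s -> smooth_field W t ->
  smooth_on W (fun q => hform F kappa q (s q) (t q)).
Proof.
move=> Hs Ht; apply: (smooth_on_eq oW (f := fun q =>
  \sum_b cmp b s q * (cmp b t q)^* * nrm b q)) => [q Wq|].
  exact/esym/(hform_co _ _ (WU Wq)).
apply: (smooth_on_sum oW) => b.
apply: (smooth_onM oW); last exact: smooth_on_sub WU (nrm_smooth b).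
exact: (smooth_onM oW (smooth_cmp b Hs) (smooth_onJ oW (smooth_cmp b Ht))).
Qed.

Variable p : M.
Hypothesis Wp : W p.
Let up : U p := WU Wp.

Lemma dbar_Phi X s v : hol_field W X -> smooth_field W s ->
  dbar p v (fun q => Phi F q (X q) (s q)) = Phi F p (X p) (dbar p v s).
Proof.
move=> HX Hs; apply: (co_inj up) => b; have sX := hol_field_smooth HX.
have E q : W q -> cmp b (fun q => Phi F q (X q) (s q)) q = - (cmp b X q * cmp b s q).
  by move=> Wq; exact: co_Phi_eq (WU Wq) (erefl _) (erefl _).
apply: etrans (co_dbar_eq v Wp (smooth_Phi sX Hs) E) _.
have E2 := co_dbar_eq v Wp Hs (fun q _ => erefl (cmp b s q)).
apply: etrans _ (esym (co_Phi_eq up (erefl _) E2)).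
have sx := smooth_cmp b sX; have ss := smooth_cmp b Hs.
apply: etrans (delbarN v oW Wp (smooth_onM oW sx ss)) _; congr (- _).
apply: etrans (delbarM_eq oW Wp sx ss (delbar_hol v Wp (hol_cmp b HX)) (erefl _)) _.
by rewrite mul0r add0r.
Qed.

Lemma dbar_dbar X Y s : smooth_field W X -> smooth_field W Y -> smooth_field W s ->
  cov (@dbar R m M) X (cov (@dbar R m M) Y s) p
  - cov (@dbar R m M) Y (cov (@dbar R m M) X s) p
  - cov (@dbar R m M) (bracket X Y) s p = 0.
Proof.
move=> HX HY Hs; apply: (co_inj up) => b.
have E Z : forall q, W q -> cmp b (cov (@dbar R m M) Z s) q = delbar q (Z q) (cmp b s).
  by move=> q Wq; exact: co_dbar_eq Wq Hs (fun q _ => erefl (cmp b s q)).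
have E1 := co_dbar_eq (X p) Wp (smooth_dbar HY Hs) (E Y).
have E2 := co_dbar_eq (Y p) Wp (smooth_dbar HX Hs) (E X).
have E3 := co_dbar_eq (bracket X Y p) Wp Hs (fun q _ => erefl (cmp b s q)).
apply: etrans (coB (coB E1 E2) E3) _.
rewrite del0; apply/eqP; rewrite subr_eq0; apply/eqP.
exact/esym/(delbar_delbar oW Wp HX HY (smooth_cmp b Hs)).
Qed.

(** Both D' and Phi are diagonal, so that only the derivatives of the
    coefficients of X and Y remain, and they add up to the bracket. *)
(** The relation D'P = Phi.  The off-diagonal coefficients of P are parallel, and
    the diagonal ones are minus the coordinates. *)
Lemma chern10_Phit X s v : hol_field W X -> smooth_field W s ->
  chern10 p v (fun q => Phit F kappa q (X q) (s q)) =
  Phit F kappa p (X p) (chern10 p v s).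
Proof.
move=> HX Hs; apply: (co_inj up) => b; have sX := hol_field_smooth HX.
have E q : W q -> cmp b (fun q => Phit F kappa q (X q) (s q)) q =
    - ((cmp b X q)^* * cmp b s q).
  by move=> Wq; exact: co_Phit_eq (WU Wq) (erefl _) (erefl _).
apply: etrans (co_chern10_eq v Wp (smooth_Phit sX Hs) E) _.
have E2 := co_chern10_eq v Wp Hs (fun q _ => erefl (cmp b s q)).
apply: etrans _ (esym (co_Phit_eq up (erefl _) E2)).
have sx := smooth_onJ oW (smooth_cmp b sX); have ss := smooth_cmp b Hs.
have D := delM_eq oW Wp sx ss (del_conj_hol v oW Wp (hol_cmp b HX)) (erefl _).
rewrite (delN v oW Wp (smooth_onM oW sx ss)) D.
have alg : forall x s ds th : C, - (0 * s + x * ds) + th * - (x * s) = - (x * (ds + th * s)).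
  by move=> *; ring.
exact: alg.
Qed.

(** The form theta_b is closed, being half of d log eta_b. *)
Lemma theta_bracket b X Y : smooth_field W X -> smooth_field W Y ->
  theta b p (bracket X Y p) =
  del p (X p) (fun q => theta b q (Y q)) - del p (Y p) (fun q => theta b q (X q)).
Proof.
move=> HX HY; pose w q : C := (2 * et b q)^-1.
have sw : smooth_on W w := hol_on_smooth (et2V_hol b).
have se := smooth_et b.
have e0 q : W q -> et b q != 0 by move=> /WU; exact: et_neq0.
(* Differentiate 2 eta_b w = 1. *)
have Dw v : 2 * et b p * del p v w = - (2 * del p v (et b) * w p).
  have E q : W q -> 2 * et b q * w q = 1.
    by move=> Wq; rewrite divff // mulf_neq0 ?pnatr_eq0 // e0.
  have D := delM_eq oW Wp (smooth_onM oW (smooth_on_cst W 2) se) sw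
    (delM_eq oW Wp (smooth_on_cst W 2) se (del_cst p v 2) (erefl _)) (erefl _).
  have := etrans (esym D) (etrans (del_eq_on v oW Wp E) (del_cst p v 1)).
  have alg (x y a z : C) : (0 * x + 2 * y) * a + z = 0 -> z = - (2 * y * a).
    by move=> H; apply/eqP; rewrite -addr_eq0 -H; apply/eqP; ring.
  exact: alg.
have DX := delM_eq oW Wp (smooth_on_del oW HY se) sw (erefl (del p (X p) _)) (erefl _).
have DY := delM_eq oW Wp (smooth_on_del oW HX se) sw (erefl (del p (Y p) _)) (erefl _).
have B := bracket_del oW Wp HX HY se.
apply: etrans (congr1 (fun x => x / (2 * et b p)) B) _.
apply: etrans _ (esym (congr2 (fun x y => x - y) DX DY)).
have alg (xy yx xe ye xw yw a e : C) : e != 0 -> 2 * e * xw = - (2 * xe * a) ->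
   2 * e * yw = - (2 * ye * a) ->
   (xy - yx) * a = (xy * a + ye * xw) - (yx * a + xe * yw).
  move=> e1 H1 H2; apply: (mulfI (mulf_neq0 (lt0r_neq0 (ltr0n _ 2)) e1)).
  transitivity (2 * e * (xy * a) + ye * - (2 * xe * a)
     - (2 * e * (yx * a)) - xe * - (2 * ye * a)); first by ring.
  by rewrite -H1 -H2; ring.
exact: alg (e0 p Wp) (Dw (X p)) (Dw (Y p)).
Qed.

(** D' is diagonal, and its connection form is closed by [theta_bracket]. *)
Lemma chern10_flat X Y s : smooth_field W X -> smooth_field W Y -> smooth_field W s ->
  cov chern10 X (cov chern10 Y s) p - cov chern10 Y (cov chern10 X s) p
  - cov chern10 (bracket X Y) s p = 0.
Proof.
move=> HX HY Hs; apply: (co_inj up) => b; have ss := smooth_cmp b Hs.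
have E Z : forall q, W q -> cmp b (cov chern10 Z s) q =
    del q (Z q) (cmp b s) + theta b q (Z q) * cmp b s q.
  by move=> q Wq; exact: co_chern10_eq Wq Hs (fun q _ => erefl (cmp b s q)).
have E1 := co_chern10_eq (X p) Wp (smooth_chern10 HY Hs) (E Y).
have E2 := co_chern10_eq (Y p) Wp (smooth_chern10 HX Hs) (E X).
have E3 := co_chern10_eq (bracket X Y p) Wp Hs (fun q _ => erefl (cmp b s q)).
apply: etrans (coB (coB E1 E2) E3) _.
have D Z Z' : smooth_field W Z' ->
    del p (Z p) (fun q => del q (Z' q) (cmp b s) + theta b q (Z' q) * cmp b s q) =
    del p (Z p) (fun q => del q (Z' q) (cmp b s)) +
    (del p (Z p) (fun q => theta b q (Z' q)) * cmp b s p +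
     theta b p (Z' p) * del p (Z p) (cmp b s)).
  move=> HZ'; exact: (delD_eq oW Wp (smooth_on_del oW HZ' ss)
    (smooth_onM oW (smooth_theta b HZ') ss) (erefl _)
    (delM (Z p) oW Wp (smooth_theta b HZ') ss)).
rewrite del0 (D X Y HY) (D Y X HX) (theta_bracket b HX HY).
rewrite (bracket_del oW Wp HX HY ss).
have alg : forall xys yxs xty ytx tx ty xs ys s : C,
  xys + (xty * s + ty * xs) + tx * (ys + ty * s)
  - (yxs + (ytx * s + tx * ys) + ty * (xs + tx * s))
  - (xys - yxs + (xty - ytx) * s) = 0 by move=> *; ring.
exact: alg.
Qed.

Lemma chern10_Phi X Y s : smooth_field W X -> smooth_field W Y -> smooth_field W s ->
  (cov chern10 X (fun q => Phi F q (Y q) (s q)) p - Phi F p (Y p) (cov chern10 X s p))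
  - (cov chern10 Y (fun q => Phi F q (X q) (s q)) p - Phi F p (X p) (cov chern10 Y s p))
  - Phi F p (bracket X Y p) (s p) = 0.
Proof.
move=> HX HY Hs; apply: (co_inj up) => b; have ss := smooth_cmp b Hs.
have E Z q : W q -> cmp b (fun q => Phi F q (Z q) (s q)) q = - (cmp b Z q * cmp b s q).
  by move=> Wq; exact: co_Phi_eq (WU Wq) (erefl _) (erefl _).
have D Z Z' : smooth_field W Z' ->
    co b p (cov chern10 Z (fun q => Phi F q (Z' q) (s q)) p) =
    - (del p (Z p) (cmp b Z') * cmp b s p + cmp b Z' p * del p (Z p) (cmp b s))
    + theta b p (Z p) * - (cmp b Z' p * cmp b s p).
  move=> HZ'; have sz := smooth_cmp b HZ'.
  apply: etrans (co_chern10_eq (Z p) Wp (smooth_Phi HZ' Hs) (E Z')) _.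
  rewrite (delN (Z p) oW Wp (smooth_onM oW sz ss)).
  by rewrite (delM (Z p) oW Wp sz ss).
have G Z := co_chern10_eq (Z p) Wp Hs (fun q _ => erefl (cmp b s q)).
have Br : co b p (bracket X Y p) = del p (X p) (cmp b Y) - del p (Y p) (cmp b X).
  exact: bracket_component b oW Wp hu up HX HY.
apply: etrans (coB (coB (coB (D X Y HY) (co_Phi_eq up (erefl (co b p (Y p))) (G X)))
  (coB (D Y X HX) (co_Phi_eq up (erefl (co b p (X p))) (G Y))))
  (co_Phi_eq up Br (erefl (co b p (s p))))) _.
rewrite del0.
have alg : forall xy yx x y s xs ys tx ty : C,
  - (xy * s + y * xs) + tx * - (y * s) - - (y * (xs + tx * s))
  - (- (yx * s + x * ys) + ty * - (x * s) - - (x * (ys + ty * s)))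
  - - ((xy - yx) * s) = 0 by move=> *; ring.
exact: alg.
Qed.

Lemma dbar_Phit X Y s : smooth_field W X -> smooth_field W Y -> smooth_field W s ->
  (cov (@dbar R m M) X (fun q => Phit F kappa q (Y q) (s q)) p
    - Phit F kappa p (Y p) (cov (@dbar R m M) X s p))
  - (cov (@dbar R m M) Y (fun q => Phit F kappa q (X q) (s q)) p
    - Phit F kappa p (X p) (cov (@dbar R m M) Y s p))
  - Phit F kappa p (bracket X Y p) (s p) = 0.
Proof.
move=> HX HY Hs; apply: (co_inj up) => b; have ss := smooth_cmp b Hs.
have E Z q : W q -> cmp b (fun q => Phit F kappa q (Z q) (s q)) q =
    - ((cmp b Z q)^* * cmp b s q).
  by move=> Wq; exact: co_Phit_eq (WU Wq) (erefl _) (erefl _).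
have D Z Z' : smooth_field W Z' ->
    co b p (cov (@dbar R m M) Z (fun q => Phit F kappa q (Z' q) (s q)) p) =
    - ((del p (Z p) (cmp b Z'))^* * cmp b s p
        + (cmp b Z' p)^* * delbar p (Z p) (cmp b s)).
  move=> HZ'; have sz := smooth_cmp b HZ'; have sz' := smooth_onJ oW sz.
  apply: etrans (co_dbar_eq (Z p) Wp (smooth_Phit HZ' Hs) (E Z')) _.
  apply: etrans (delbarN (Z p) oW Wp (smooth_onM oW sz' ss)) _; congr (- _).
  exact: (delbarM_eq oW Wp sz' ss (delbarJ (Z p) oW Wp sz) (erefl _)).
have G Z := co_dbar_eq (Z p) Wp Hs (fun q _ => erefl (cmp b s q)).
have Br : co b p (bracket X Y p) = del p (X p) (cmp b Y) - del p (Y p) (cmp b X).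
  exact: bracket_component b oW Wp hu up HX HY.
apply: etrans (coB (coB (coB (D X Y HY) (co_Phit_eq up (erefl (co b p (Y p))) (G X)))
  (coB (D Y X HX) (co_Phit_eq up (erefl (co b p (X p))) (G Y))))
  (co_Phit_eq up Br (erefl (co b p (s p))))) _.
rewrite del0.
have alg : forall xy yx x y s xs ys : C,
  - (xy^* * s + y^* * xs) - - (y^* * xs)
  - (- (yx^* * s + x^* * ys) - - (x^* * ys))
  - - ((xy - yx)^* * s) = 0 by move=> *; rewrite rmorphB /=; ring.
exact: alg.
Qed.

(** Both sides vanish: the right-hand one because Phi and its conjugate are
    diagonal, the left-hand one because [theta] is holomorphic. *)
Lemma chern10_dbar X Y s : hol_field W X -> hol_field W Y -> smooth_field W s ->
  cov chern10 X (cov (@dbar R m M) Y s) p - cov (@dbar R m M) Y (cov chern10 X s) p =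
  - (Phi F p (X p) (Phit F kappa p (Y p) (s p))
     - Phit F kappa p (Y p) (Phi F p (X p) (s p))).
Proof.
move=> HX HY Hs; apply: (co_inj up) => b; have ss := smooth_cmp b Hs.
have sX := hol_field_smooth HX; have sY := hol_field_smooth HY.
have E1 q : W q -> cmp b (cov (@dbar R m M) Y s) q = delbar q (Y q) (cmp b s).
  by move=> Wq; exact: co_dbar_eq Wq Hs (fun q _ => erefl (cmp b s q)).
have E2 q : W q -> cmp b (cov chern10 X s) q =
    del q (X q) (cmp b s) + theta b q (X q) * cmp b s q.
  by move=> Wq; exact: co_chern10_eq Wq Hs (fun q _ => erefl (cmp b s q)).
have D1 := co_chern10_eq (X p) Wp (smooth_dbar sY Hs) E1.
have D2 := co_dbar_eq (Y p) Wp (smooth_chern10 sX Hs) E2.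
have D3 := delbarD_eq oW Wp (smooth_on_del oW sX ss)
  (smooth_onM oW (smooth_theta b sX) ss)
  (esym (del_delbar_comm oW Wp HX HY ss))
  (delbarM_eq oW Wp (smooth_theta b sX) ss
    (delbar_hol (Y p) Wp (hol_theta b HX)) (erefl _)).
have C1 := co_Phi_eq up (erefl (co b p (X p)))
  (co_Phit_eq up (erefl (co b p (Y p))) (erefl (co b p (s p)))).
have C2 := co_Phit_eq up (erefl (co b p (Y p)))
  (co_Phi_eq up (erefl (co b p (X p))) (erefl (co b p (s p)))).
apply: etrans (coB D1 (etrans D2 D3)) (etrans _ (esym (coN (coB C1 C2)))).
have alg : forall xys th ys s x y : C,
  xys + th * ys - (xys + (0 * s + th * ys)) =
  - (- (x * - (y^* * s)) - - (y^* * - (x * s))) by move=> *; ring.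
exact: alg.
Qed.

(** The derivative of k_b, which is - theta_b k_b, cancels the connection form. *)
Lemma chern10_kappa s v : smooth_field W s ->
  chern10 p v (fapp kappa s) = kappa p (dbar p v s).
Proof.
move=> Hs; apply: (co_inj up) => b; have ss := smooth_cmp b Hs.
have E q : W q -> cmp b (fapp kappa s) q = (cmp b s q)^* * kfac b q.
  by move=> Wq; exact: co_kappa_eq (WU Wq) (erefl _).
have sk := smooth_on_sub WU (kfac_smooth b).
apply: etrans (co_chern10_eq v Wp (smooth_kappa Hs) E) _.
have D := delM_eq oW Wp (smooth_onJ oW ss) sk (delJ v oW Wp ss) (del_kfac b v up).
have G := co_dbar_eq v Wp Hs (fun q _ => erefl (cmp b s q)).
apply: etrans _ (esym (co_kappa_eq up G)); rewrite D.
have alg : forall ds s k th : C, ds * k + s * (- th * k) + th * (s * k) = ds * k by move=> *; ring.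
exact: alg.
Qed.

(** Here the antiholomorphic derivative of k_b produces the connection form. *)
Lemma dbar_kappa s v : smooth_field W s ->
  dbar p v (fapp kappa s) = kappa p (chern10 p v s).
Proof.
move=> Hs; apply: (co_inj up) => b; have ss := smooth_cmp b Hs.
have E q : W q -> cmp b (fapp kappa s) q = (cmp b s q)^* * kfac b q.
  by move=> Wq; exact: co_kappa_eq (WU Wq) (erefl _).
have sk := smooth_on_sub WU (kfac_smooth b).
apply: etrans (co_dbar_eq v Wp (smooth_kappa Hs) E) _.
have D := delbarM_eq oW Wp (smooth_onJ oW ss) sk (delbarJ v oW Wp ss) (delbar_kfac b v up).
have G := co_chern10_eq v Wp Hs (fun q _ => erefl (cmp b s q)).
apply: etrans D (etrans _ (esym (co_kappa_eq up G))).
have alg : forall ds s k th : C, ds^* * k + s^* * (th^* * k) = (ds + th * s)^* * k.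
  by move=> *; rewrite rmorphD rmorphM /=; ring.
exact: alg.
Qed.

(** The connection form theta_b is the logarithmic derivative of h(e_b, e_b). *)
Lemma chern10_metric s t v : smooth_field W s -> smooth_field W t ->
  del p v (fun q => hform F kappa q (s q) (t q)) =
  hform F kappa p (chern10 p v s) (t p) + hform F kappa p (s p) (dbar p v t).
Proof.
move=> Hs Ht.
have E q : W q -> hform F kappa q (s q) (t q) =
    \sum_b cmp b s q * (cmp b t q)^* * nrm b q.
  by move=> Wq; exact: hform_co (WU Wq).
have sn b := smooth_on_sub WU (nrm_smooth b).
have ss b := smooth_cmp b Hs; have st b := smooth_cmp b Ht.
have stJ b := smooth_onJ oW (st b); have sst b := smooth_onM oW (ss b) (stJ b).
rewrite (del_eq_on v oW Wp E).
rewrite (del_sum (f := fun b q => cmp b s q * (cmp b t q)^* * nrm b q) v oW Wp);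
  last by move=> b; exact: (smooth_onM oW (sst b) (sn b)).
rewrite (hform_co _ _ up) (hform_co _ _ up) -big_split; apply: eq_bigr => b _.
have G := co_chern10_eq v Wp Hs (fun q _ => erefl (cmp b s q)).
have G' := co_dbar_eq v Wp Ht (fun q _ => erefl (cmp b t q)).
have D := delM_eq oW Wp (sst b) (sn b) (delM_eq oW Wp (ss b) (stJ b) (erefl _)
  (delJ v oW Wp (st b))) (del_nrm b v up).
have alg : forall ds s t dt n th : C, (ds * t^* + s * dt^*) * n + s * t^* * (th * n) =
  (ds + th * s) * t^* * n + s * dt^* * n by move=> *; ring.
apply: etrans D (etrans (alg _ _ _ _ _ _) _).
exact: esym (congr2 (fun x y => x * (co b p (t p))^* * nrm b p +
   co b p (s p) * y^* * nrm b p) G G').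
Qed.

Lemma dbar_metric s t v : smooth_field W s -> smooth_field W t ->
  delbar p v (fun q => hform F kappa q (s q) (t q)) =
  hform F kappa p (dbar p v s) (t p) + hform F kappa p (s p) (chern10 p v t).
Proof.
move=> Hs Ht.
have E q : W q -> hform F kappa q (s q) (t q) =
    \sum_b cmp b s q * (cmp b t q)^* * nrm b q.
  by move=> Wq; exact: hform_co (WU Wq).
have sn b := smooth_on_sub WU (nrm_smooth b).
have ss b := smooth_cmp b Hs; have st b := smooth_cmp b Ht.
have stJ b := smooth_onJ oW (st b); have sst b := smooth_onM oW (ss b) (stJ b).
rewrite (delbar_eq_on v oW Wp E).
rewrite (delbar_sum (f := fun b q => cmp b s q * (cmp b t q)^* * nrm b q) v oW Wp);
  last by move=> b; exact: (smooth_onM oW (sst b) (sn b)).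
rewrite (hform_co _ _ up) (hform_co _ _ up) -big_split; apply: eq_bigr => b _.
have G := co_dbar_eq v Wp Hs (fun q _ => erefl (cmp b s q)).
have G' := co_chern10_eq v Wp Ht (fun q _ => erefl (cmp b t q)).
have D := delbarM_eq oW Wp (sst b) (sn b) (delbarM_eq oW Wp (ss b) (stJ b) (erefl _)
  (delbarJ v oW Wp (st b))) (delbar_nrm b v up).
have alg : forall ds s t dt n th : C, (ds * t^* + s * dt^*) * n + s * t^* * (th^* * n) =
  ds * t^* * n + s * (dt + th * t)^* * n by move=> *; rewrite rmorphD rmorphM /=; ring.
apply: etrans D (etrans (alg _ _ _ _ _ _) _).
exact: esym (congr2 (fun x y => x * (co b p (t p))^* * nrm b p +
   co b p (s p) * y^* * nrm b p) G G').
Qed.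

Lemma chern10_Uop X s : smooth_field W X -> smooth_field W s ->
  (cov chern10 X (fapp (Uop F) s) p - Uop F p (cov chern10 X s p))
  + Phi F p (X p) (s p) = 0.
Proof.
move=> HX Hs; apply: (co_inj up) => b; have ss := smooth_cmp b Hs.
have E q : W q -> cmp b (fapp (Uop F) s) q = zc u b q * cmp b s q.
  by move=> Wq; exact: co_Uop_eq (WU Wq) (erefl _).
have G1 := co_chern10_eq (X p) Wp (smooth_Uop Hs) E.
have G2 := co_chern10_eq (X p) Wp Hs (fun q _ => erefl (cmp b s q)).
have D := delM (X p) oW Wp (smooth_on_sub WU (zc_smooth b hu)) ss.
have C1 := co_Phi_eq up (erefl (co b p (X p))) (erefl (co b p (s p))).
apply: etrans (coD (coB (etrans G1 (congr1 (fun x => x + _) D)) (co_Uop_eq up G2)) C1) _.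
rewrite del0.
have alg : forall x z s ds th : C,
  x * s + z * ds + th * (z * s) - z * (ds + th * s) + - (x * s) = 0 by move=> *; ring.
exact: alg.
Qed.

Lemma dbar_Uop s v : smooth_field W s ->
  dbar p v (fapp (Uop F) s) - Uop F p (dbar p v s) = 0.
Proof.
move=> Hs; apply: (co_inj up) => b; have ss := smooth_cmp b Hs.
have E q : W q -> cmp b (fapp (Uop F) s) q = zc u b q * cmp b s q.
  by move=> Wq; exact: co_Uop_eq (WU Wq) (erefl _).
have G1 := co_dbar_eq v Wp (smooth_Uop Hs) E.
have G2 := co_dbar_eq v Wp Hs (fun q _ => erefl (cmp b s q)).
have D := delbarM_eq oW Wp (smooth_on_sub WU (zc_smooth b hu)) ss
  (delbar_hol v Wp (hol_on_sub WU (hol_on_zc b hu))) (erefl _).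
apply: etrans (coB (etrans G1 D) (co_Uop_eq up G2)) _.
rewrite del0.
have alg : forall z s ds : C, 0 * s + z * ds - z * ds = 0 by move=> *; ring.
exact: alg.
Qed.

(** * The Euler field and the harmonicity relations *)

Lemma euler_hol : hol_field W (feuler F).
Proof. exact: hol_field_sub (@subsetT _ W) (feuler_hol HF). Qed.

Lemma cmp_euler b q : W q -> cmp b (feuler F) q = zc u b q.
Proof. by move=> Wq; exact: co_euler (WU Wq). Qed.

Lemma del_cmp_euler b v : del p v (cmp b (feuler F)) = co b p v.
Proof. exact: (del_eq_on v oW Wp (cmp_euler b)). Qed.

Lemma smooth_frame b : smooth_field W (e b).
Proof. exact: smooth_field_frame hu WU. Qed.

Lemma del_cmp_frame b c v : del p v (cmp c (e b)) = 0.
Proof.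
have E q : W q -> cmp c (e b) q = (b == c)%:R.
  by move=> Wq; exact: component_frame hu (WU Wq).
by rewrite (del_eq_on v oW Wp E); exact: del_cst.
Qed.

(** The coefficients of the Euler field are the coordinates. *)
Lemma bracket_euler_frame b : bracket (feuler F) (e b) p = - e b p.
Proof.
apply: (co_inj up) => c.
have B := bracket_component c oW Wp hu up (hol_field_smooth euler_hol) (smooth_frame b).
apply: etrans B _; rewrite del_cmp_frame del_cmp_euler.
apply: etrans (sub0r _) _; exact/esym/delNl.
Qed.

(** Homogeneity of g, evaluated on (e_b, e_b): E(eta_b) = - d eta_b, as
    [E, e_b] = - e_b. *)
Lemma theta_euler b : theta b p (feuler F p) = - fd F / 2.
Proof.
have L := feuler_metric HF oU up (frame_hol b) (frame_hol b).
have E q : U q -> fg F q (e b q) (e b q) = et b q.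
  by move=> uq; rewrite fg_frame // eqxx mul1r.
have Eb : fg F p (- e b p) (e b p) = - et b p.
  have := fg_linear HF p (-1) (e b p) 0 (e b p).
  have Z : fg F p 0 (e b p) = 0.
    have := fg_linear HF p (-1) 0 0 (e b p).
    by rewrite scaler0 addr0 mulN1r addNr.
  by rewrite addr0 Z addr0 scaleN1r mulN1r (E p up).
have Eb' : fg F p (e b p) (- e b p) = - et b p by rewrite (fg_sym HF) Eb.
have alg : forall x y d : C, y != 0 -> x - - y - - y = (2 - d) * y ->
    x / (2 * y) = - d / 2.
  move=> x y d y0 H; have -> : x = (x - - y - - y) - 2 * y by ring.
  by rewrite H; field.
have D := del_eq_on (feuler F p) oU up E.
have K : del p (feuler F p) (et b) - - et b p - - et b p = (2 - fd F) * et b p.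
  have B := bracket_euler_frame b.
  have L2 := etrans (congr1 (fun w => fg F p w (e b p)) B) Eb.
  have L3 := etrans (congr1 (fun w => fg F p (e b p) w) B) Eb'.
  have L1 := congr2 (fun x y => x - y) (congr2 (fun x y => x - y) D L2) L3.
  exact: etrans (esym L1) (etrans L (congr1 (fun z => (2 - fd F) * z) (E p up))).
exact: alg (et_neq0 b up) K.
Qed.

(** On each coefficient Q is multiplication by theta_b(E) + 1 - (2 - d) / 2,
    which vanishes by [theta_euler]. *)
Lemma Qop_zero s : smooth_field W s -> Qop F chern10 s p = 0.
Proof.
move=> Hs; apply: (co_inj up) => b; have ss := smooth_cmp b Hs.
have G := co_chern10_eq (feuler F p) Wp Hs (fun q _ => erefl (cmp b s q)).
have B := bracket_component b oW Wp hu up (hol_field_smooth euler_hol) Hs.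
have Z := delZl p ((2 - fd F) / 2) (s p) (zc u b).
apply: etrans (coB (coB G B) Z) _.
rewrite (del_cmp_euler b) theta_euler del0.
have alg : forall x d y : C, x + - d / 2 * y - (x - y) - (2 - d) / 2 * y = 0.
  by move=> x d y; field.
exact: alg.
Qed.

Lemma chern10_P s v : smooth_field W s ->
  chern10 p v (fapp P s) - P p (chern10 p v s) = Phi F p v (s p).
Proof.
move=> Hs; apply: (co_inj up) => a.
have E q : W q -> cmp a (fapp P s) q = \sum_b cmp b s q * Pcoef u eta a b q.
  by move=> Wq; exact: co_P (WU Wq).
have G1 := co_chern10_eq v Wp (smooth_P Hs) E.
have sP b := smooth_on_sub WU (Pcoef_smooth a b).
have D := del_sum (f := fun b q => cmp b s q * Pcoef u eta a b q) v oW Wp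
  (fun b => smooth_onM oW (smooth_cmp b Hs) (sP b)).
have D' b := delM_eq oW Wp (smooth_cmp b Hs) (sP b) (erefl _) (del_Pcoef a b v up).
have G2 := co_P (chern10 p v s) a up.
have G b := co_chern10_eq v Wp Hs (fun q _ => erefl (cmp b s q)).
have G2' : co a p (P p (chern10 p v s)) =
   \sum_b (del p v (cmp b s) + theta b p v * cmp b s p) * Pcoef u eta a b p.
  apply: etrans G2 _; apply: eq_bigr => b _.
  exact: (congr1 (fun x => x * Pcoef u eta a b p) (G b)).
have G1' : co a p (chern10 p v (fapp P s)) =
  \sum_b (del p v (cmp b s) * Pcoef u eta a b p + cmp b s p *
     ((theta b p v - theta a p v) * Pcoef u eta a b p - (a == b)%:R * co b p v)) +
  theta a p v * \sum_b cmp b s p * Pcoef u eta a b p.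
  apply: etrans G1 _; congr (_ + _); apply: etrans D _.
  by apply: eq_bigr => b _; exact: D'.
apply: etrans (coB G1' G2') (etrans _ (esym (co_Phi v (s p) a up))).
exact: chern_P_alg a (fun b => del p v (cmp b s)) (fun b => cmp b s p)
  (fun b => Pcoef u eta a b p) (fun b => theta b p v) (fun b => co b p v).
Qed.

(** The vanishing of the torsion, extended from holomorphic fields to smooth
    ones by expansion in the frame. *)
Lemma nabla_euler s : smooth_field W s ->
  nab p (feuler F p) s - bracket (feuler F) s p = nab p (s p) (feuler F).
Proof.
move=> Hs; have sE := hol_field_smooth euler_hol.
have [_ L _] := nabla_conn.
have N1 := conn_frame (feuler F p) nabla_conn hu oW WU Wp Hs.
have N2 : nab p (s p) (feuler F) = \sum_b cmp b s p *: nab p (e b p) (feuler F).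
  rewrite {1}(co_expand (s p) up).
  exact: linear_map_sum (L W (feuler F) p oW Wp sE).
have B : bracket (feuler F) s p = \sum_b (cmp b s p *: bracket (feuler F) (e b) p +
    del p (feuler F p) (cmp b s) *: e b p).
  apply: (co_inj up) => c.
  have Bc := bracket_component c oW Wp hu up sE Hs.
  apply: etrans Bc _; rewrite del_cmp_euler del_suml.
  have Ec b : co c p (cmp b s p *: bracket (feuler F) (e b) p +
     del p (feuler F p) (cmp b s) *: e b p) =
     (b == c)%:R * (del p (feuler F p) (cmp b s) - cmp b s p).
    rewrite bracket_euler_frame delDl !delZl delNl (co_frame b c up).
    have alg : forall x y z : C, x * - y + z * y = y * (z - x) by move=> *; ring.
    exact: alg.
  rewrite (eq_bigr _ (fun b _ => Ec b)) (sum_pick (a := c)) => [|b /negbTE bc].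
    by rewrite eqxx mul1r.
  by rewrite bc mul0r.
rewrite N1 N2 B -sumrB; apply: eq_bigr => b _.
have Tor := lc_torsion (fnablaP HF) oW Wp euler_hol (hol_field_sub WU (frame_hol b)).
have alg : forall (k : C) (x y z w : T), x - y = z -> k *: x + w - (k *: z + w) = k *: y.
  by move=> k x y z w <-; rewrite opprD addrACA subrr addr0 -scalerBr opprB addrC subrK.
exact: alg Tor.
Qed.

(** The commutator with Phi along the Euler field is minus the commutator with
    the multiplication by it; the remaining terms agree by [nabla_euler]. *)
Lemma Qop_Vop s : smooth_field W s ->
  Qop F chern10 s p =
    Vop F s p + (Pdag p (Uop F p (s p)) - Uop F p (Pdag p (s p))).
Proof.
move=> Hs; rewrite /Qop /Vop /cov chern10E -(nabla_euler Hs).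
have PN x : Pdag p (- x) = - Pdag p x.
  have := Pdag_linear p (-1) x 0; have P0 : Pdag p 0 = 0.
    have := Pdag_linear p (-1) 0 0.
    by rewrite scaler0 addr0 scaleN1r addNr.
  by rewrite !addr0 P0 addr0 !scaleN1r.
rewrite {1}/Phi PN -/(Uop F p (s p)) /Phi -/(Uop F p (Pdag p (s p))).
have alg : forall x y z a b : T, x - (- a - - b) - y - z = x - y - z + (a - b).
  move=> x y z a b; rewrite opprB opprK [- b + a]addrC.
  by rewrite [x + _ - y]addrAC [LHS]addrAC.
exact: alg.
Qed.

End OnOpen.

(** * Fibrewise symmetries *)

Lemma Pcoef_sym q a b : U q ->
  Pcoef u eta a b q * et a q = Pcoef u eta b a q * et b q.
Proof.
move=> uq; rewrite /Pcoef [b == a]eq_sym; case: eqVneq => [-> //|_].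
have alg : forall h k x y : C, h = k ->
    h^* / (2 * `|x * y|) * y * x = k^* / (2 * `|y * x|) * x * y.
  by move=> h k x y ->; rewrite [y * x]mulrC mulrAC.
exact: alg (eta2_sym a b uq).
Qed.

Lemma P_selfadjoint q x y : U q -> fg F q (P q x) y = fg F q x (P q y).
Proof.
move=> uq; rewrite (fg_co _ _ uq) (fg_co _ _ uq).
transitivity (\sum_a \sum_b co b q x * Pcoef u eta a b q * co a q y * et a q).
  by apply: eq_bigr => a _; rewrite (co_P x a uq) !mulr_suml.
rewrite exchange_big; apply: eq_bigr => b _ /=.
rewrite (co_P y b uq) mulr_sumr mulr_suml; apply: eq_bigr => a _.
have alg : forall x y pa pb ea eb : C, pa * ea = pb * eb ->
   x * pa * y * ea = x * (y * pb) * eb.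
  move=> x0 y0 pa pb ea eb H.
  transitivity (x0 * y0 * (pa * ea)); first by ring.
  by rewrite H; ring.
exact: alg (Pcoef_sym a b uq).
Qed.

Lemma kappaK q x : U q -> kappa q (kappa q x) = x.
Proof.
move=> uq; apply: (co_inj uq) => b.
apply: etrans (co_kappa_eq uq (co_kappa_eq uq (erefl (co b q x)))) _.
have alg : forall x k : C, k^* * k = 1 -> (x^* * k)^* * k = x.
  by move=> x0 k kk; rewrite rmorphM /= conjCK -mulrA kk mulr1.
exact: alg (kfac_unit b uq).
Qed.

Lemma hform_herm q x y : U q -> hform F kappa q y x = (hform F kappa q x y)^*.
Proof.
move=> uq; rewrite (hform_co _ _ uq) (hform_co _ _ uq) rmorph_sum.
apply: eq_bigr => b _.
have alg : forall x y n : C, n^* = n -> y * x^* * n = (x * y^* * n)^*.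
  by move=> x0 y0 n nn; rewrite !rmorphM /= conjCK nn [y0 * _]mulrC.
exact: alg (nrm_real b q).
Qed.

Lemma hform_gt0 q x : U q -> x != 0 -> 0 < hform F kappa q x x.
Proof.
move=> uq x0; rewrite (hform_co _ _ uq).
have ge b : 0 <= co b q x * (co b q x)^* * `|et b q|.
  have alg : forall z y : C, 0 <= z * z^* * `|y|.
    by move=> z y; rewrite mulr_ge0 ?mul_conjC_ge0.
  exact: alg.
rewrite lt_def sumr_ge0 => [|b _]; last exact: ge.
rewrite andbT; apply: contra x0; rewrite psumr_eq0 => [|b _]; last exact: ge.
move=> /allP H; apply/eqP; apply: (co_inj uq) => b; rewrite del0.
have := H b (mem_index_enum b).
have alg : forall z y : C, y != 0 -> (z * z^* * `|y| == 0) -> z = 0.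
  move=> z y y0; rewrite !mulf_eq0 conjC_eq0 normr_eq0 (negbTE y0) orbF orbb.
  by move/eqP.
exact: alg (et_neq0 b uq).
Qed.

Lemma hform_Phi q x a b : U q ->
  hform F kappa q (Phi F q x a) b = hform F kappa q a (Phit F kappa q x b).
Proof.
move=> uq; rewrite (hform_co _ _ uq) (hform_co _ _ uq); apply: eq_bigr => c _.
have E1 := co_Phi_eq uq (erefl (co c q x)) (erefl (co c q a)).
have E2 := co_Phit_eq uq (erefl (co c q x)) (erefl (co c q b)).
apply: etrans (congr1 (fun z => z * (co c q b)^* * `|et c q|) E1) _.
apply: etrans _ (esym (congr1 (fun z => co c q a * z^* * `|et c q|) E2)).
have alg : forall x a b n : C, - (x * a) * b^* * n = a * (- (x^* * b))^* * n.
  by move=> *; rewrite rmorphN rmorphM /= conjCK; ring.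
exact: alg.
Qed.

Lemma hform_Uop q a b : U q ->
  hform F kappa q (Uop F q a) b =
  hform F kappa q a (kappa q (Uop F q (kappa q b))).
Proof.
move=> uq; rewrite (hform_co _ _ uq) (hform_co _ _ uq); apply: eq_bigr => c _.
have E1 := co_Uop_eq uq (erefl (co c q a)).
have E2 := co_Uopt_eq uq (erefl (co c q b)).
apply: etrans (congr1 (fun z => z * (co c q b)^* * `|et c q|) E1) _.
apply: etrans _ (esym (congr1 (fun z => co c q a * z^* * `|et c q|) E2)).
have alg : forall x a b n : C, x * a * b^* * n = a * (x^* * b)^* * n.
  by move=> *; rewrite rmorphM /= conjCK; ring.
exact: alg.
Qed.

Lemma Phi_comm q x y s : U q ->
  Phi F q x (Phi F q y s) = Phi F q y (Phi F q x s).
Proof.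
move=> uq; apply: (co_inj uq) => b.
have E v w := co_Phi_eq (b := b) uq (erefl (co b q v))
  (co_Phi_eq uq (erefl (co b q w)) (erefl (co b q s))).
apply: etrans (E x y) (etrans _ (esym (E y x))).
have alg : forall x y s : C, - (x * - (y * s)) = - (y * - (x * s)) by move=> *; ring.
exact: alg.
Qed.

Lemma Phit_comm q x y s : U q ->
  Phit F kappa q x (Phit F kappa q y s) = Phit F kappa q y (Phit F kappa q x s).
Proof.
move=> uq; apply: (co_inj uq) => b.
have E v w := co_Phit_eq (b := b) uq (erefl (co b q v))
  (co_Phit_eq uq (erefl (co b q w)) (erefl (co b q s))).
apply: etrans (E x y) (etrans _ (esym (E y x))).
have alg : forall x y s : C, - (x * - (y * s)) = - (y * - (x * s)) by move=> *; ring.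
exact: alg.
Qed.

Lemma Phi_Uop q x s : U q -> Phi F q x (Uop F q s) = Uop F q (Phi F q x s).
Proof.
move=> uq; apply: (co_inj uq) => b.
have E1 := co_Phi_eq uq (erefl (co b q x)) (co_Uop_eq uq (erefl (co b q s))).
have E2 := co_Uop_eq uq (co_Phi_eq uq (erefl (co b q x)) (erefl (co b q s))).
apply: etrans E1 (etrans _ (esym E2)).
have alg : forall x z s : C, - (x * (z * s)) = z * - (x * s) by move=> *; ring.
exact: alg.
Qed.

Lemma Phi_Uopt q x s : U q ->
  Phi F q x (kappa q (Uop F q (kappa q s))) =
  kappa q (Uop F q (kappa q (Phi F q x s))).
Proof.
move=> uq; apply: (co_inj uq) => b.
have E1 := co_Phi_eq uq (erefl (co b q x)) (co_Uopt_eq uq (erefl (co b q s))).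
have E2 := co_Uopt_eq uq (co_Phi_eq uq (erefl (co b q x)) (erefl (co b q s))).
apply: etrans E1 (etrans _ (esym E2)).
have alg : forall x z s : C, - (x * (z * s)) = z * - (x * s) by move=> *; ring.
exact: alg.
Qed.
End Adapted.

(** * The global structure *)

Section Assembly.
Context {R : realType} {m : nat} {M : complex_manifold R m}.
Local Notation C := R[i].
Local Notation T := 'rV[R[i]]_m.
Local Notation field := (M -> 'rV[R[i]]_m).
Variables (F : frobenius_data M) (kappa P : M -> T -> T).
Hypothesis HF : is_frobenius F.
Hypothesis Hk : forall p, antilinear (kappa p).
Hypothesis HP : forall p, linear (P p).
Hypothesis Had : forall p, exists u eta, dom u p /\ adapted F kappa P u eta.
Implicit Types (W : set M) (p q : M) (X Y s t : field) (x y v : T).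

Local Notation D' := (chern10 F kappa P).
Local Notation h := (hform F kappa).

(** The chart around p may be cut down to any neighbourhood of p. *)
Lemma localize W p : open W -> W p -> exists u eta, adapted F kappa P u eta /\
  exists W' : set M, [/\ open W', W' p, W' `<=` dom u & W' `<=` W].
Proof.
move=> oW Wp; have [u [eta [up A]]] := Had p; exists u, eta; split => //.
exists (W `&` dom u); split=> [||q []|q []] //.
exact: (openI oW (adapted_open A)).
Qed.

Lemma smooth_localize W X : open W ->
  (forall u eta W', adapted F kappa P u eta -> open W' -> W' `<=` dom u ->
     W' `<=` W -> smooth_field W' X) -> smooth_field W X.
Proof.
move=> oW H; apply: smooth_field_local => p Wp.
have [u [eta [up A]]] := Had p; exists (dom u) => //.
by apply: (H u eta) => //; exact: (openI oW (adapted_open A)).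
Qed.

Lemma smooth_on_localize W (f : M -> C) : open W ->
  (forall u eta W', adapted F kappa P u eta -> open W' -> W' `<=` dom u ->
     W' `<=` W -> smooth_on W' f) -> smooth_on W f.
Proof.
move=> oW H; apply: smooth_on_local => p Wp.
have [u [eta [up A]]] := Had p; exists (dom u) => //.
by apply: (H u eta) => //; exact: (openI oW (adapted_open A)).
Qed.

Lemma chern10_conn : conn10 D'.
Proof.
have [_ L Z] := nabla_conn HF; split.
- move=> W X Y oW HX HY; apply: smooth_localize => // u eta W' A oW' WU WW.
  exact: (smooth_chern10 HF Hk HP A oW' WU (smooth_field_sub WW HX)
    (smooth_field_sub WW HY)).
- move=> W Y p oW Wp HY.
  exact: (chern10_linear_l HF Hk HP (L W Y p oW Wp HY)).
move=> W f Y Z' p v oW Wp Hf HY HZ; rewrite !chern10E (Z W) //.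
rewrite !(Pdag_linear Hk HP, Phi_linear_r HF).
have alg : forall (k : C) (a b d e1 e2 a' e1' e2' : T),
  k *: a + b + a' - (k *: e1 + e1' - (k *: e2 + e2')) =
  k *: (a - (e1 - e2)) + b + (a' - (e1' - e2')).
  move=> k a b _ e1 e2 a' e1' e2'.
  rewrite !scalerBr [k *: a + b + a']addrAC [LHS]addrAC [RHS]addrAC.
  by congr (_ + b); exact: subr_sub_ACA.
exact: alg.
Qed.

Lemma hform_linear_l p (a : C) x y z : h p (a *: x + y) z = a * h p x z + h p y z.
Proof. exact: (fg_linear HF). Qed.

Lemma hform_semilinear_r p (a : C) x y z :
  h p z (a *: x + y) = a^* * h p z x + h p z y.
Proof. by rewrite /hform Hk !(fg_sym HF p z) (fg_linear HF). Qed.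

Lemma hform_pos p x : x != 0 -> 0 < h p x x.
Proof. by have [u [eta [up A]]] := Had p; exact: (hform_gt0 HF Hk A up). Qed.

Lemma hform_nondeg p : Defs.nondegenerate (h p).
Proof.
by move=> x H; apply/eqP/negPn/negP => /(hform_pos p); rewrite H ltxx.
Qed.

Lemma kappa_invol p x : kappa p (kappa p x) = x.
Proof. by have [u [eta [up A]]] := Had p; exact: (kappaK HF Hk A). Qed.

Lemma hform_hermitian p x y : h p y x = (h p x y)^*.
Proof. by have [u [eta [up A]]] := Had p; exact: (hform_herm HF Hk A). Qed.

(** For fixed points of kappa, h coincides with g, hence is symmetric as well as
    hermitian. *)
Lemma hform_real p x y : kappa p x = x -> kappa p y = y -> h p x y \is Num.real.
Proof.
move=> kx ky; apply/CrealP; rewrite -hform_hermitian /hform kx ky.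
exact: (fg_sym HF).
Qed.

Lemma P_symmetric : adjoint (fg F) P P.
Proof. by move=> p x y; have [u [eta [up A]]] := Had p; exact: (P_selfadjoint HF HP A). Qed.

Lemma Pdag_adjoint : adjoint h P (Pdag kappa P).
Proof. by move=> p x y; rewrite /hform /Pdag kappa_invol P_symmetric. Qed.

Lemma chern10_chern : chern h D'.
Proof.
split; first exact: chern10_conn.
- move=> W Y Z p v oW Wp HY HZ.
  have [u [eta [A [W' [oW' Wp' WU WW]]]]] := localize oW Wp.
  exact: (chern10_metric HF Hk HP A oW' WU Wp' v (smooth_field_sub WW HY)
    (smooth_field_sub WW HZ)).
- move=> W Y Z p v oW Wp HY HZ.
  have [u [eta [A [W' [oW' Wp' WU WW]]]]] := localize oW Wp.
  exact: (dbar_metric HF Hk HP A oW' WU Wp' v (smooth_field_sub WW HY)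
    (smooth_field_sub WW HZ)).
Qed.

Lemma Qop0 W s p : open W -> W p -> smooth_field W s -> Qop F D' s p = 0.
Proof.
move=> oW Wp Hs; have [u [eta [A [W' [oW' Wp' WU WW]]]]] := localize oW Wp.
exact: (Qop_zero HF Hk HP A oW' WU Wp' (smooth_field_sub WW Hs)).
Qed.

Lemma kappa_lin0 p : kappa p 0 = 0.
Proof.
by have := Hk p (-1) 0 0; rewrite scaler0 addr0 rmorphN1 scaleN1r addNr.
Qed.

Lemma Phi_lin0 p x : Phi F p x 0 = 0.
Proof.
by have := Phi_linear_r HF p x (-1) 0 0; rewrite scaler0 addr0 scaleN1r addNr.
Qed.

Lemma hform_0l p x : h p 0 x = 0.
Proof.
by have := hform_linear_l p (-1) 0 0 x; rewrite scaler0 addr0 mulN1r addNr.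
Qed.

Lemma hform_0r p x : h p x 0 = 0.
Proof. by rewrite hform_hermitian hform_0l rmorph0. Qed.

Lemma smooth_Phi_all W X s : open W -> smooth_field W X -> smooth_field W s ->
  smooth_field W (fun q => Phi F q (X q) (s q)).
Proof.
move=> oW HX Hs; apply: smooth_localize => // u eta W' A oW' WU WW.
exact: (smooth_Phi HF A oW' WU (smooth_field_sub WW HX) (smooth_field_sub WW Hs)).
Qed.

Lemma smooth_P_all W s : open W -> smooth_field W s -> smooth_field W (fapp P s).
Proof.
move=> oW Hs; apply: smooth_localize => // u eta W' A oW' WU WW.
exact: (smooth_P HF HP A oW' WU (smooth_field_sub WW Hs)).
Qed.

Lemma smooth_kappa_all W s : open W -> smooth_field W s ->
  smooth_field W (fapp kappa s).
Proof.
move=> oW Hs; apply: smooth_localize => // u eta W' A oW' WU WW.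
exact: (smooth_kappa HF Hk A oW' WU (smooth_field_sub WW Hs)).
Qed.

(** Every identity is pointwise, and near p it is one of the computations in an
    adapted chart.  Those which involve Q reduce to Q = 0. *)
Lemma CV_structure : is_CV D' (Phi F) (Phit F kappa) kappa h (Uop F) (Qop F D').
Proof.
split.
- by move=> W X s; exact: smooth_Phi_all.
- by move=> p x; exact: (Phi_linear_r HF).
- by move=> p s; exact: (Phi_linear_l HF).
- by move=> W s; exact: smooth_kappa_all.
- exact: Hk.
- move=> W s t oW Hs Ht; apply: smooth_on_localize => // u eta W' A oW' WU WW.
  exact: (smooth_hform HF Hk A oW' WU (smooth_field_sub WW Hs) (smooth_field_sub WW Ht)).
- move=> W s oW Hs; apply: smooth_localize => // u eta W' A oW' WU WW.
  exact: (smooth_Uop HF A oW' WU (smooth_field_sub WW Hs)).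
- move=> p a x y; rewrite /Uop !(fprodC HF p (feuler F p)).
  exact: (fprod_linear HF).
- move=> W s oW Hs; apply: (smooth_field_eq oW _ (smooth_field0 W)) => q Wq.
  by rewrite (Qop0 oW Wq Hs).
- move=> W f s t p oW Wp Hf Hs Ht.
  rewrite (Qop0 oW Wp Hs) (Qop0 oW Wp Ht) scaler0 addr0.
  exact: (Qop0 oW Wp (smooth_fieldZD oW Hf Hs Ht)).
- by move=> p x y s; have [u [eta [up A]]] := Had p; exact: (Phi_comm HF A).
- move=> W X s p v oW Wp HX Hs.
  have [u [eta [A [W' [oW' Wp' WU WW]]]]] := localize oW Wp.
  exact: (dbar_Phi HF A oW' WU Wp' v (hol_field_sub WW HX) (smooth_field_sub WW Hs)).
- move=> W X Y s p oW Wp HX HY Hs.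
  have [u [eta [A [W' [oW' Wp' WU WW]]]]] := localize oW Wp.
  exact: (dbar_dbar A oW' WU Wp' (hol_field_smooth (hol_field_sub WW HX))
    (hol_field_smooth (hol_field_sub WW HY)) (smooth_field_sub WW Hs)).
- by move=> p x y s; have [u [eta [up A]]] := Had p; exact: (Phit_comm HF Hk A).
- move=> W X s p v oW Wp HX Hs.
  have [u [eta [A [W' [oW' Wp' WU WW]]]]] := localize oW Wp.
  exact: (chern10_Phit HF Hk HP A oW' WU Wp' v (hol_field_sub WW HX)
    (smooth_field_sub WW Hs)).
- move=> W X Y s p oW Wp HX HY Hs.
  have [u [eta [A [W' [oW' Wp' WU WW]]]]] := localize oW Wp.
  exact: (chern10_flat HF Hk HP A oW' WU Wp' (hol_field_smooth (hol_field_sub WW HX))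
    (hol_field_smooth (hol_field_sub WW HY)) (smooth_field_sub WW Hs)).
- move=> W X Y s p oW Wp HX HY Hs.
  have [u [eta [A [W' [oW' Wp' WU WW]]]]] := localize oW Wp.
  exact: (chern10_Phi HF Hk HP A oW' WU Wp' (hol_field_smooth (hol_field_sub WW HX))
    (hol_field_smooth (hol_field_sub WW HY)) (smooth_field_sub WW Hs)).
- move=> W X Y s p oW Wp HX HY Hs.
  have [u [eta [A [W' [oW' Wp' WU WW]]]]] := localize oW Wp.
  exact: (dbar_Phit HF Hk A oW' WU Wp' (hol_field_smooth (hol_field_sub WW HX))
    (hol_field_smooth (hol_field_sub WW HY)) (smooth_field_sub WW Hs)).
- move=> W X Y s p oW Wp HX HY Hs.
  have [u [eta [A [W' [oW' Wp' WU WW]]]]] := localize oW Wp.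
  exact: (chern10_dbar HF Hk HP A oW' WU Wp' (hol_field_sub WW HX)
    (hol_field_sub WW HY) (smooth_field_sub WW Hs)).
- exact: kappa_invol.
- move=> W s p v oW Wp Hs.
  have [u [eta [A [W' [oW' Wp' WU WW]]]]] := localize oW Wp.
  exact: (chern10_kappa HF Hk HP A oW' WU Wp' v (smooth_field_sub WW Hs)).
- move=> W s p v oW Wp Hs.
  have [u [eta [A [W' [oW' Wp' WU WW]]]]] := localize oW Wp.
  exact: (dbar_kappa HF Hk HP A oW' WU Wp' v (smooth_field_sub WW Hs)).
- by [].
- exact: hform_linear_l.
- exact: hform_semilinear_r.
- exact: hform_nondeg.
- exact: hform_hermitian.
- exact: hform_real.
- by move=> p x a b; have [u [eta [up A]]] := Had p; exact: (hform_Phi HF Hk A).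
- exact: chern10_chern.
- by move=> p x s; have [u [eta [up A]]] := Had p; exact: (Phi_Uop HF A).
- move=> W X s p oW Wp HX Hs; have sX := hol_field_smooth HX.
  rewrite (Qop0 oW Wp Hs) Phi_lin0 (Qop0 oW Wp (smooth_Phi_all oW sX Hs)) subr0 subr0.
  have [u [eta [A [W' [oW' Wp' WU WW]]]]] := localize oW Wp.
  exact: (chern10_Uop HF Hk HP A oW' WU Wp' (smooth_field_sub WW sX)
    (smooth_field_sub WW Hs)).
- move=> W s p v oW Wp Hs.
  have [u [eta [A [W' [oW' Wp' WU WW]]]]] := localize oW Wp.
  exact: (dbar_Uop HF A oW' WU Wp' v (smooth_field_sub WW Hs)).
- move=> W X s p oW Wp HX Hs; have [cS _ _] := chern10_conn.
  have sX := hol_field_smooth HX.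
  rewrite (Qop0 oW Wp (cS W X s oW sX Hs)) subr0.
  have -> : cov D' X (Qop F D' s) p = 0.
    by apply: (conn_null _ chern10_conn oW Wp) => q Wq; exact: (Qop0 oW Wq Hs).
  rewrite add0r; apply/eqP; rewrite subr_eq0; apply/eqP.
  by have [u [eta [up A]]] := Had p; exact: (Phi_Uopt HF Hk A).
- move=> W s p oW Wp Hs.
  by rewrite (Qop0 oW Wp Hs) (Qop0 oW Wp (smooth_kappa_all oW Hs)) kappa_lin0 addr0.
- by move=> p a b; have [u [eta [up A]]] := Had p; exact: (hform_Uop HF Hk A).
- move=> W s t p oW Wp Hs Ht.
  by rewrite (Qop0 oW Wp Hs) (Qop0 oW Wp Ht) hform_0l hform_0r.
Qed.

(** The commutator of P^dag with Phi along the unit vanishes, as this Phi is minus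
    the identity. *)
Lemma unit_parallel p : cov D' (funit F) (funit F) p = 0.
Proof.
rewrite /cov chern10E (funit_flat HF) /Phi !(funitP HF).
have := Pdag_linear Hk HP p (-1) (funit F p) 0.
have P0 : Pdag kappa P p 0 = 0.
  have := Pdag_linear Hk HP p (-1) 0 0.
  by rewrite scaler0 addr0 scaleN1r addNr.
by rewrite !addr0 P0 addr0 !scaleN1r => ->; rewrite opprK addNr subr0.
Qed.

Lemma harmonic : fd F \is Num.real -> harmonic_frobenius F kappa P.
Proof.
move=> dr; exists D', P, (Pdag kappa P); split.
- split; last exact: hform_pos.
  by split=> //; [exact: chern10_chern|exact: unit_parallel|exact: CV_structure].
- split; [exact: HP|exact: smooth_P_all|exact: P_symmetric|exact: Pdag_adjoint].
- move=> W s p v oW Wp Hs.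
  have [u [eta [A [W' [oW' Wp' WU WW]]]]] := localize oW Wp.
  exact: (chern10_P HF Hk HP A oW' WU Wp' v (smooth_field_sub WW Hs)).
- by move=> W s p v _ _ _; exact: chern10E.
split=> // W s p oW Wp Hs.
have [u [eta [A [W' [oW' Wp' WU WW]]]]] := localize oW Wp.
exact: (Qop_Vop HF Hk HP A oW' WU Wp' (smooth_field_sub WW Hs)).
Qed.

End Assembly.

Theorem proposition4p29 (R : realType) (m : nat) (M : complex_manifold R m)
    (F : frobenius_data M) (kappa P : M -> 'rV[R[i]]_m -> 'rV[R[i]]_m) :
  is_frobenius F -> semisimple F -> fd F \is Num.real ->
  (forall p, antilinear (kappa p)) ->
  (forall p, linear (P p)) ->
  (forall p, exists (u : chart R m M) (eta : M -> R[i]),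
     [/\ dom u p, canonical_chart F u, normalized_chart F u, metric_potential F u eta &
         forall q, dom u q -> forall b,
           kappa q (frame u b q) =
             (`|part1 u eta b q| / part1 u eta b q) *: frame u b q /\
           P q (frame u b q) =
             \sum_a (if a == b then - zc u b q
                     else (part2 u eta a b q)^*
                          / (2 * `|part1 u eta a q * part1 u eta b q|)
                          * part1 u eta b q) *: frame u a q]) ->
  harmonic_frobenius F kappa P.
Proof.
move=> HF _ dr Hk HP H; apply: harmonic => // p.
by have [u [eta [up c n e k]]] := H p; exists u, eta; split.
Qed.
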